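(* Let $R$ be a commutative ring with $1$, $r$ a positive integer, $u_1,u_2\in R$, and let $\mathscr H_{2,r}$ be the level two degenerate Hecke algebra over $R$ with parameters $u_1,u_2$. Then each of the following sets is a cellular basis of $\mathscr H_{2,r}$ in the sense of Graham–Lehrer (with respect to the poset $\Lambda_2^+(r)$ of bipartitions of $r$ under the dominance order and the anti-involution fixing the generators): (1) $S_1=\{\mathfrak x_{\mathfrak s\mathfrak t}\mid\lambda\in\Lambda_2^+(r),\ \mathfrak s,\mathfrak t\in\mathcal T^s(\lambda)\}$; (2) $S_2=\{\mathfrak y_{\mathfrak s\mathfrak t}\mid\lambda\in\Lambda_2^+(r),\ \mathfrak s,\mathfrak t\in\mathcal T^s(\lambda)\}$; (3) $S_3=\{\bar{\mathfrak x}_{\mathfrak s\mathfrak t}\mid\lambda\in\Lambda_2^+(r),\ \mathfrak s,\mathfrak t\in\mathcal T^s(\lambda)\}$; (4) $S_4=\{\bar{\mathfrak y}_{\mathfrak s\mathfrak t}\mid\lambda\in\Lambda_2^+(r),\ \mathfrak s,\mathfrak t\in\mathcal T^s(\lambda)\}$.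
   Context: $\mathscr H_{2,r}$ is the $R$-algebra generated by $s_1,\dots,s_{r-1},y_1,\dots,y_r$ subject to: the $s_i$ satisfy the Coxeter relations of $\mathfrak S_r$; $y_iy_\ell=y_\ell y_i$; $s_iy_j=y_js_i$ for $j\ne i,i+1$; $s_iy_i-y_{i+1}s_i=-1$, $y_is_i-s_iy_{i+1}=-1$; $(y_1-u_1)(y_1-u_2)=0$. $\Lambda_2^+(r)$ is the set of bipartitions $\lambda=(\lambda^{(1)},\lambda^{(2)})$ of $r$; $\lambda\unlhd\mu$ iff $\sum_{j\le i}\lambda^{(1)}_j\le\sum_{j\le i}\mu^{(1)}_j$ and $|\lambda^{(1)}|+\sum_{j\le i}\lambda^{(2)}_j\le|\mu^{(1)}|+\sum_{j\le i}\mu^{(2)}_j$ for all $i$. $\mathcal T^s(\lambda)$ is the set of standard $\lambda$-tableaux (fillings of the two Young diagrams with $1,\dots,r$, each once, increasing along rows and down columns in each component). $\mathfrak t^\lambda$ has $1,\dots,r$ entered along the rows of $\lambda^{(1)}$ and then of $\lambda^{(2)}$. $\mathfrak S_r$ acts on the right of tableaux by permuting entries; $d(\mathfrak s)$ is defined by $\mathfrak t^\lambda d(\mathfrak s)=\mathfrak s$. For $i=1,2$, $x_{\lambda^{(i)}}$ (resp. $y_{\lambda^{(i)}}$) is the sum of $w$ (resp. $(-1)^{\ell(w)}w$) over the row stabilizer of the $i$-th component of $\mathfrak t^\lambda$. With $a=|\lambda^{(1)}|$, put $\pi_\lambda=\prod_{i=1}^a(y_i-u_2)$ and $\tilde\pi_\lambda=\prod_{i=1}^a(y_i-u_1)$.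 For $\mathfrak s,\mathfrak t\in\mathcal T^s(\lambda)$: $\mathfrak x_{\mathfrak s\mathfrak t}=d(\mathfrak s)^{-1}\pi_\lambda x_{\lambda^{(1)}}y_{\lambda^{(2)}}d(\mathfrak t)$, $\mathfrak y_{\mathfrak s\mathfrak t}=d(\mathfrak s)^{-1}\tilde\pi_\lambda x_{\lambda^{(1)}}y_{\lambda^{(2)}}d(\mathfrak t)$, $\bar{\mathfrak x}_{\mathfrak s\mathfrak t}=d(\mathfrak s)^{-1}\pi_\lambda y_{\lambda^{(1)}}x_{\lambda^{(2)}}d(\mathfrak t)$, $\bar{\mathfrak y}_{\mathfrak s\mathfrak t}=d(\mathfrak s)^{-1}\tilde\pi_\lambda y_{\lambda^{(1)}}x_{\lambda^{(2)}}d(\mathfrak t)$. A basis $\{c^\lambda_{\mathfrak s\mathfrak t}\}$ of an algebra $A$ with anti-involution $*$ is cellular if $(c^\lambda_{\mathfrak s\mathfrak t})^*=c^\lambda_{\mathfrak t\mathfrak s}$ and for all $a\in A$, $c^\lambda_{\mathfrak s\mathfrak t}a\equiv\sum_{\mathfrak v}r_{\mathfrak v}(\mathfrak t,a)c^\lambda_{\mathfrak s\mathfrak v}$ modulo the span of the $c^\mu_{\mathfrak u\mathfrak v}$ with $\mu\rhd\lambda$, with $r_{\mathfrak v}(\mathfrak t,a)\in R$ independent of $\mathfrak s$. *)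

(* Defs.v *)
From HB Require Import structures.
From mathcomp Require Import all_boot all_order all_fingroup all_algebra.
From mathcomp Require Import boolp.

Set Implicit Arguments.
Unset Strict Implicit.
Unset Printing Implicit Defensive.

Import Order.TTheory GRing.Theory.
Local Open Scope ring_scope.

(* Algebras given by generators and relations: expressions in the generators
   modulo the least congruence that contains the relations and the identities
   of associative unital R-algebras.  The library's algType requires 1 != 0;
   as the zero ring is allowed here, presented algebras only get a pzRingType
   and an lmodType structure, linked by presented_scaleAl and _scaleAr. *)
Section Presentation.
Variables (R : comPzRingType) (G : Type).

Inductive aexpr :=
  | Cst of R
  | Gen of G
  | Add of aexpr & aexpr
  | Mul of aexpr & aexpr.

Definition Sub x y := Add x (Mul (Cst (-1)) y).

Variable rel : aexpr -> aexpr -> Prop.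

Inductive aeq : aexpr -> aexpr -> Prop :=
  | aeq_rel x y : rel x y -> aeq x y
  | aeq_refl x : aeq x x
  | aeq_sym x y : aeq x y -> aeq y x
  | aeq_trans x y z : aeq x y -> aeq y z -> aeq x z
  | aeq_Add x x' y y' : aeq x x' -> aeq y y' -> aeq (Add x y) (Add x' y')
  | aeq_Mul x x' y y' : aeq x x' -> aeq y y' -> aeq (Mul x y) (Mul x' y')
  | aeq_addA x y z : aeq (Add x (Add y z)) (Add (Add x y) z)
  | aeq_addC x y : aeq (Add x y) (Add y x)
  | aeq_add0 x : aeq (Add (Cst 0) x) x
  | aeq_addN x : aeq (Add (Mul (Cst (-1)) x) x) (Cst 0)
  | aeq_mulA x y z : aeq (Mul x (Mul y z)) (Mul (Mul x y) z)
  | aeq_mul1l x : aeq (Mul (Cst 1) x) x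
  | aeq_mul1r x : aeq (Mul x (Cst 1)) x
  | aeq_mulDl x y z : aeq (Mul (Add x y) z) (Add (Mul x z) (Mul y z))
  | aeq_mulDr x y z : aeq (Mul x (Add y z)) (Add (Mul x y) (Mul x z))
  | aeq_cstD a b : aeq (Cst (a + b)) (Add (Cst a) (Cst b))
  | aeq_cstM a b : aeq (Cst (a * b)) (Mul (Cst a) (Cst b))
  | aeq_cstC a x : aeq (Mul (Cst a) x) (Mul x (Cst a)).

HB.instance Definition _ := gen_eqMixin aexpr.
HB.instance Definition _ := gen_choiceMixin aexpr.

Definition aeqb (x y : aexpr) : bool := `[< aeq x y >].

Lemma aeqb_refl : reflexive aeqb.
Proof. by move=> x; apply/asboolP/aeq_refl. Qed.

Lemma aeqb_sym : symmetric aeqb.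
Proof. by move=> x y; apply/asboolP/asboolP => /aeq_sym. Qed.

Lemma aeqb_trans : transitive aeqb.
Proof. by move=> y x z /asboolP xy /asboolP yz; apply/asboolP/(aeq_trans xy). Qed.

Canonical aeqb_equiv := EquivRel aeqb aeqb_refl aeqb_sym aeqb_trans.

Definition presented := {eq_quot aeqb_equiv}%qT.

HB.instance Definition _ := Choice.on presented.
HB.instance Definition _ := Quotient.on presented.

Definition pclass (x : aexpr) : presented := (\pi_presented x)%qT.
Local Notation pi := pclass.
Local Notation repr := generic_quotient.repr.

Lemma pi_eq x y : pi x = pi y <-> aeq x y.
Proof.
by split=> [/eqmodP/asboolP//|xy]; apply/eqmodP/asboolP.
Qed.

Lemma pclass_ind (P : presented -> Prop) :
  (forall x, P (pi x)) -> forall x, P x.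
Proof. by move=> Ppi x; rewrite -[x]reprK; apply: Ppi. Qed.

Lemma repr_pi x : aeq (repr (pi x)) x.
Proof. by apply/pi_eq; rewrite /pclass reprK. Qed.

Definition padd (x y : presented) := pi (Add (repr x) (repr y)).
Definition pmul (x y : presented) := pi (Mul (repr x) (repr y)).
Definition popp (x : presented) := pi (Mul (Cst (-1)) (repr x)).
Definition pscale (a : R) (x : presented) := pi (Mul (Cst a) (repr x)).

Lemma paddE x y : padd (pi x) (pi y) = pi (Add x y).
Proof. by apply/pi_eq; apply: aeq_Add; apply: repr_pi. Qed.
Lemma pmulE x y : pmul (pi x) (pi y) = pi (Mul x y).
Proof. by apply/pi_eq; apply: aeq_Mul; apply: repr_pi. Qed.
Lemma poppE x : popp (pi x) = pi (Mul (Cst (-1)) x).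
Proof. by apply/pi_eq/aeq_Mul; [apply: aeq_refl | apply: repr_pi]. Qed.
Lemma pscaleE a x : pscale a (pi x) = pi (Mul (Cst a) x).
Proof. by apply/pi_eq/aeq_Mul; [apply: aeq_refl | apply: repr_pi]. Qed.

Let opE := (paddE, pmulE, poppE, pscaleE).

Fact paddA : associative padd.
Proof.
by elim/pclass_ind=> x; elim/pclass_ind=> y; elim/pclass_ind=> z; rewrite !opE;
  apply/pi_eq/aeq_addA.
Qed.
Fact paddC : commutative padd.
Proof. by elim/pclass_ind=> x; elim/pclass_ind=> y; rewrite !opE; apply/pi_eq/aeq_addC. Qed.
Fact padd0 : left_id (pi (Cst 0)) padd.
Proof. by elim/pclass_ind=> x; rewrite !opE; apply/pi_eq/aeq_add0. Qed.
Fact paddN : left_inverse (pi (Cst 0)) popp padd.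
Proof. by elim/pclass_ind=> x; rewrite !opE; apply/pi_eq/aeq_addN. Qed.

HB.instance Definition _ :=
  GRing.isZmodule.Build presented paddA paddC padd0 paddN.

Fact pmulA : associative pmul.
Proof.
by elim/pclass_ind=> x; elim/pclass_ind=> y; elim/pclass_ind=> z; rewrite !opE;
  apply/pi_eq/aeq_mulA.
Qed.
Fact pmul1l : left_id (pi (Cst 1)) pmul.
Proof. by elim/pclass_ind=> x; rewrite !opE; apply/pi_eq/aeq_mul1l. Qed.
Fact pmul1r : right_id (pi (Cst 1)) pmul.
Proof. by elim/pclass_ind=> x; rewrite !opE; apply/pi_eq/aeq_mul1r. Qed.
Fact pmulDl : left_distributive pmul padd.
Proof.
by elim/pclass_ind=> x; elim/pclass_ind=> y; elim/pclass_ind=> z; rewrite !opE;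
  apply/pi_eq/aeq_mulDl.
Qed.
Fact pmulDr : right_distributive pmul padd.
Proof.
by elim/pclass_ind=> x; elim/pclass_ind=> y; elim/pclass_ind=> z; rewrite !opE;
  apply/pi_eq/aeq_mulDr.
Qed.

HB.instance Definition _ :=
  GRing.Zmodule_isPzRing.Build presented pmulA pmul1l pmul1r pmulDl pmulDr.

Fact pscaleA a b x : pscale a (pscale b x) = pscale (a * b) x.
Proof.
elim/pclass_ind: x => x; rewrite !opE; apply/pi_eq.
apply: aeq_trans (aeq_mulA _ _ _) _; apply: aeq_Mul (aeq_refl _).
exact/aeq_sym/aeq_cstM.
Qed.
Fact pscale1 : left_id 1 pscale.
Proof. by elim/pclass_ind=> x; rewrite !opE; apply/pi_eq/aeq_mul1l. Qed.
Fact pscaleDr : right_distributive pscale padd.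
Proof.
by move=> a; elim/pclass_ind=> x; elim/pclass_ind=> y; rewrite !opE; apply/pi_eq/aeq_mulDr.
Qed.
Fact pscaleDl x : {morph pscale^~ x : a b / a + b >-> padd a b}.
Proof.
move=> a b; elim/pclass_ind: x => x; rewrite /= !opE; apply/pi_eq.
apply: aeq_trans (aeq_mulDl _ _ _); apply: aeq_Mul (aeq_refl _).
exact: aeq_cstD.
Qed.

HB.instance Definition _ := GRing.Zmodule_isLmodule.Build R presented
  pscaleA pscale1 pscaleDr pscaleDl.

Fact pscaleAl a x y : pscale a (pmul x y) = pmul (pscale a x) y.
Proof.
by elim/pclass_ind: x => x; elim/pclass_ind: y => y; rewrite !opE; apply/pi_eq/aeq_mulA.
Qed.
Fact pscaleAr a x y : pscale a (pmul x y) = pmul x (pscale a y).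
Proof.
elim/pclass_ind: x => x; elim/pclass_ind: y => y; rewrite !opE; apply/pi_eq.
apply: aeq_trans (aeq_mulA _ _ _) _.
apply: aeq_trans (aeq_sym (aeq_mulA _ _ _)).
exact: aeq_Mul (aeq_cstC _ _) (aeq_refl _).
Qed.

Lemma presented_scaleAl (a : R) (x y : presented) : a *: (x * y) = (a *: x) * y.
Proof. exact: pscaleAl. Qed.
Lemma presented_scaleAr (a : R) (x y : presented) : a *: (x * y) = x * (a *: y).
Proof. exact: pscaleAr. Qed.

Definition pgen (g : G) : presented := pi (Gen g).

End Presentation.

Arguments Cst {R G}.
Arguments Gen {R G}.

(* Graham-Lehrer cellular bases. *)
Section Cellular.
Variables (R : comPzRingType) (G : Type).
Variable rel : aexpr R G -> aexpr R G -> Prop.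
Local Notation A := (presented rel).

Definition anti_involution (star : A -> A) : Prop :=
  [/\ forall x y, star (x + y) = star x + star y,
      forall a x, star (a *: x) = a *: star x,
      forall x y, star (x * y) = star y * star x
    & involutive star].

Definition is_basis (I : finType) (b : I -> A) : Prop :=
  forall x : A, exists! f : {ffun I -> R}, x = \sum_i f i *: b i.

Variables (d : Order.disp_t) (L : finPOrderType d) (T : L -> finType).
Variable c : forall l : L, T l -> T l -> A.

Definition in_upper_span (l : L) (x : A) : Prop :=
  exists g : forall m : L, T m -> T m -> R,
    x = \sum_(m | (l < m)%O) \sum_(u : T m) \sum_(v : T m) g m u v *: c u v.

Definition cellular_basis (star : A -> A) : Prop :=
  [/\ is_basis (fun i : {l : L & (T l * T l)%type} =>
                  c (tagged i).1 (tagged i).2),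
      forall (l : L) (s t : T l), star (c s t) = c t s
    & forall (l : L) (t : T l) (a : A), exists f : T l -> R,
        forall s : T l, in_upper_span l (c s t * a - \sum_v f v *: c s v)].

End Cellular.

(* Components of bipartitions are indexed by bool: false is the first one and
   true the second.  A partition of some n <= r is padded with zeros to a
   weakly decreasing family of r parts, each at most r.  All indices (rows,
   columns, tableau entries, generators) start at 0. *)
Section Bipartitions.
Variable r : nat.

Definition is_bipart (p : {ffun bool -> {ffun 'I_r -> 'I_r.+1}}) : bool :=
  [forall k : bool, forall i : 'I_r, forall j : 'I_r,
     (i <= j)%N ==> (p k j <= p k i)%N]
  && ((\sum_(k : bool) \sum_(i < r) p k i)%N == r).

Record bipart := Bipart {
  bipart_val : {ffun bool -> {ffun 'I_r -> 'I_r.+1}};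
  _ : is_bipart bipart_val
}.

HB.instance Definition _ := [isSub for bipart_val].
HB.instance Definition _ := [Finite of bipart by <:].

Definition part (l : bipart) (k : bool) (i : 'I_r) : nat := bipart_val l k i.

Definition psum (l : bipart) (k : bool) (i : nat) : nat :=
  (\sum_(j < r | (j < i)%N) part l k j)%N.

Definition comp_size (l : bipart) (k : bool) : nat := (\sum_(j < r) part l k j)%N.

Definition dominated (l m : bipart) : bool :=
  [forall i : 'I_r.+1,
     (psum l false i <= psum m false i)%N &&
     (comp_size l false + psum l true i <= comp_size m false + psum m true i)%N].

Lemma dominated_refl : reflexive dominated.
Proof. by move=> l; apply/forallP => i; rewrite !leqnn. Qed.

Lemma dominated_trans : transitive dominated.
Proof.
move=> m l n /forallP lm /forallP mn; apply/forallP => i.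
have /andP[a1 a2] := lm i; have /andP[b1 b2] := mn i.
by rewrite (leq_trans a1 b1) (leq_trans a2 b2).
Qed.

Lemma psumS (l : bipart) k (i : 'I_r) : psum l k i.+1 = (psum l k i + part l k i)%N.
Proof.
rewrite /psum (bigD1 i) //= addnC; congr addn; apply: eq_bigl => j.
by rewrite ltnS ltn_neqAle andbC.
Qed.

Lemma psum_full (l : bipart) k : psum l k r = comp_size l k.
Proof. by apply: eq_bigl => j; rewrite ltn_ord. Qed.

Lemma dominated_anti : antisymmetric dominated.
Proof.
move=> l m /andP[/forallP lm /forallP ml].
have e i (lei : (i <= r)%N) : psum l false i = psum m false i /\
    (comp_size l false + psum l true i = comp_size m false + psum m true i)%N.
  have /andP[a1 a2] := lm (Ordinal (lei : (i < r.+1)%N)).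
  have /andP[b1 b2] := ml (Ordinal (lei : (i < r.+1)%N)).
  by split; apply/eqP; rewrite eqn_leq ?a1 ?b1 ?a2 ?b2.
have esz : comp_size l false = comp_size m false.
  by rewrite -!psum_full; case: (e r (leqnn r)).
have ep k i : (i <= r)%N -> psum l k i = psum m k i.
  move=> /e[e1 e2]; case: k => //.
  by apply/eqP; rewrite -(eqn_add2l (comp_size l false)) e2 esz.
apply/val_inj/ffunP => k; apply/ffunP => i; apply/val_inj.
apply/eqP; rewrite -(eqn_add2l (psum l k i)) -[X in X == _]psumS.
by rewrite !ep ?psumS ?(ltnW (ltn_ord i)) ?ltn_ord.
Qed.

Fact dominance_display : Order.disp_t. Proof. exact: Order.Disp tt tt. Qed.

HB.instance Definition _ := Order.Le_isPOrder.Build dominance_display bipart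
  dominated_refl dominated_anti dominated_trans.

Section Tableaux.
Variable l : bipart.

(* (k, i, j) : row i and column j of component k *)
Definition in_diagram (b : bool * 'I_r * 'I_r) : bool :=
  (b.2 < part l b.1.1 b.1.2)%N.

Definition box := {b : bool * 'I_r * 'I_r | in_diagram b}.

Definition bcomp (b : box) : bool := (val b).1.1.
Definition brow (b : box) : 'I_r := (val b).1.2.
Definition bcol (b : box) : 'I_r := (val b).2.

Definition is_std (t : {ffun box -> 'I_r}) : bool :=
  [&& [forall n : 'I_r, #|[set b | t b == n]| == 1%N],
      [forall b, forall b', [&& bcomp b == bcomp b', brow b == brow b'
          & (bcol b < bcol b')%N] ==> (t b < t b')%N]
    & [forall b, forall b', [&& bcomp b == bcomp b', bcol b == bcol b'
          & (brow b < brow b')%N] ==> (t b < t b')%N]].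

Definition stdtab : finType := {t : {ffun box -> 'I_r} | is_std t}.

Definition initial_entry (b : box) : nat :=
  ((if bcomp b then comp_size l false else 0) + psum l (bcomp b) (brow b)
    + bcol b)%N.

Lemma psum_mono k i j : (i <= j)%N -> (psum l k i <= psum l k j)%N.
Proof.
move=> leij; rewrite /psum [leqRHS](bigID (fun m : 'I_r => (m < i)%N)) /=.
rewrite (eq_bigl (fun m : 'I_r => (m < j)%N && (m < i)%N)) ?leq_addr // => m.
by rewrite andb_idl // => /leq_trans; apply.
Qed.

Lemma bipart_size : (comp_size l false + comp_size l true)%N = r.
Proof.
by case: l => p pP; rewrite addnC -[RHS](eqP (proj2 (andP pP))) big_bool.
Qed.

Lemma initial_entry_row (b : box) :
  (initial_entry b <
   (if bcomp b then comp_size l false else 0) + psum l (bcomp b) (brow b).+1)%N.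
Proof. by rewrite psumS /initial_entry addnA ltn_add2l; exact: (valP b). Qed.

Lemma initial_entry_lt (b : box) : (initial_entry b < r)%N.
Proof.
apply: leq_trans (initial_entry_row b) (leq_trans _ (eq_leq bipart_size)).
have := psum_mono (bcomp b) (ltn_ord (brow b)); rewrite psum_full.
case: (bcomp b) => le_s.
  by rewrite leq_add2l.
exact: leq_trans le_s (leq_addr _ _).
Qed.

(* the tableau t^lambda *)
Definition initial_tab : {ffun box -> 'I_r} :=
  [ffun b => Ordinal (initial_entry_lt b)].

End Tableaux.

Definition tab_act (l : bipart) (t : {ffun box l -> 'I_r}) (w : 'S_r) :
  {ffun box l -> 'I_r} := [ffun b => w (t b)].

(* The product in 'S_r is left-to-right, so tab_act is a right action. *)
Lemma tab_actM (l : bipart) (t : {ffun box l -> 'I_r}) (v w : 'S_r) :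
  tab_act t (v * w)%g = tab_act (tab_act t v) w.
Proof. by apply/ffunP => b; rewrite !ffunE permM. Qed.

Lemma initial_entry_inj (l : bipart) : injective (@initial_entry l).
Proof.
have lt_row (b b' : box l) : bcomp b = bcomp b' -> (brow b < brow b')%N ->
    (initial_entry b < initial_entry b')%N.
  move=> ek lt_i; apply: leq_trans (initial_entry_row b) _.
  by rewrite /initial_entry -addnA ek leq_add2l (leq_trans (psum_mono _ _ lt_i)) ?leq_addr.
have lt_comp (b b' : box l) : bcomp b = false -> bcomp b' = true ->
    (initial_entry b < initial_entry b')%N.
  move=> kb kb'; apply: leq_trans (initial_entry_row b) _.
  rewrite /initial_entry kb kb' add0n -addnA.
  by rewrite (leq_trans (psum_mono _ _ (ltn_ord _))) // psum_full leq_addr.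
move=> b b' e; have nlt : (initial_entry b < initial_entry b')%N = false by rewrite e ltnn.
have ngt : (initial_entry b' < initial_entry b)%N = false by rewrite e ltnn.
have ek : bcomp b = bcomp b'.
  case kb: (bcomp b); case kb': (bcomp b') => //.
    by rewrite (lt_comp b' b) in ngt.
  by rewrite (lt_comp b b') in nlt.
have ei : brow b = brow b'.
  apply/val_inj; case: (ltngtP (brow b) (brow b')) => // h.
    by rewrite (lt_row b b') in nlt.
  by rewrite (lt_row b' b) in ngt.
have ej : bcol b = bcol b'.
  by move: e; rewrite /initial_entry ek ei => /addnI/val_inj.
apply: val_inj; move: ek ei ej; rewrite /bcomp /brow /bcol.
by case: (val b) => [[? ?] ?]; case: (val b') => [[? ?] ?] /= -> -> ->.
Qed.

(* the permutation d(t); the default value is never used, see tab_permP *)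
Definition tab_perm (l : bipart) (t : stdtab l) : 'S_r :=
  odflt 1%g [pick w : 'S_r | tab_act (initial_tab l) w == val t].

Lemma tab_permP (l : bipart) (t : stdtab l) :
  tab_act (initial_tab l) (tab_perm t) = val t.
Proof.
rewrite /tab_perm; case: pickP => [w /eqP//|/= no_w]; exfalso.
have /andP[/forallP t1 _] := valP t; set f := val t in t1 no_w.
have finj : injective f.
  move=> b b' e; have /cards1P[c Ec] := t1 (f b).
  have : b' \in [set c] by rewrite -Ec inE e.
  have : b \in [set c] by rewrite -Ec inE.
  by rewrite !inE => /eqP-> /eqP->.
have le_r : (#|{: 'I_r}| <= #|{: box l}|)%N.
  rewrite -(card_codom finj).
  apply/subset_leq_card/subsetP => n _.
  have /cards1P[c Ec] := t1 n; have : c \in [set c] by rewrite inE.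
  by rewrite -Ec inE => /eqP<-; apply: codom_f.
have iinj : injective (initial_tab l).
  by move=> b b'; rewrite !ffunE => /(congr1 val)/= /initial_entry_inj.
have [g gK Kg] := inj_card_bij iinj le_r.
have winj : injective (f \o g) by exact: inj_comp finj (can_inj Kg).
have /eqP := no_w (perm winj); apply.
by apply/ffunP => b; rewrite ffunE permE /= gK.
Qed.

Definition ord_lo (i : 'I_r.-1) : 'I_r := widen_ord (leq_pred r) i.

Fact ord_hi_subproof (i : 'I_r.-1) : (i.+1 < r)%N.
Proof. by have := ltn_ord i; rewrite ltn_predRL. Qed.
Definition ord_hi (i : 'I_r.-1) : 'I_r := Ordinal (ord_hi_subproof i).

Definition word_perm (v : seq 'I_r.-1) : 'S_r :=
  (\prod_(i <- v) tperm (ord_lo i) (ord_hi i))%g.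

Lemma word_perm_tperm n (i j : 'I_r) : (j = i + n.+1 :> nat)%N ->
  exists v, word_perm v = tperm i j.
Proof.
elim: n j => [|n IHn] j ej.
  have lti : (i < r.-1)%N by rewrite ltn_predRL (leq_trans _ (ltn_ord j)) // ej addn1.
  exists [:: Ordinal lti]; rewrite /word_perm big_seq1.
  by congr tperm; apply: val_inj => //=; rewrite ej addn1.
have ltk : (i + n.+1 < r)%N by apply: leq_trans (ltn_ord j); rewrite ej !addnS ltnS leqnSn.
have [v vP] := IHn (Ordinal ltk) erefl.
have lti : (i + n.+1 < r.-1)%N by rewrite ltn_predRL (leq_trans _ (ltn_ord j)) // ej !addnS.
exists (Ordinal lti :: rcons v (Ordinal lti)).
have -> : tperm i j = (tperm i (Ordinal ltk) ^ tperm (Ordinal ltk) j)%g.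
  rewrite tpermJ tpermL tpermD // -val_eqE /= ?ej; last first.
    by rewrite -[X in _ != X]addn0 eqn_add2l.
  by rewrite -[X in _ != X]addn0 eqn_add2l.
have elo : ord_lo (Ordinal lti) = Ordinal ltk by exact: val_inj.
have ehi : ord_hi (Ordinal lti) = j by apply: val_inj; rewrite /= ej !addnS.
rewrite /word_perm -cats1 big_cons big_cat big_seq1 -/(word_perm v) vP.
by rewrite elo ehi /conjg tpermV.
Qed.

Lemma word_perm_surj (w : 'S_r) :
  exists n, [exists v : n.-tuple 'I_r.-1, word_perm v == w].
Proof.
suff [v vw] : exists v, word_perm v = w.
  by exists (size v); apply/existsP; exists (in_tuple v); rewrite /= vw.
have [ts -> dts] := prod_tpermP w.
elim: ts dts => [|[i j] ts IHts] /= => [_|/andP[ne_ij /IHts[v2 E2]]].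
  by exists [::]; rewrite /word_perm !big_nil.
have [v1 E1] : exists v, word_perm v = tperm i j.
  move: ne_ij; rewrite /dpair /= -val_eqE neq_ltn => /orP[] lt.
    by apply: (@word_perm_tperm (j - i).-1); rewrite prednK ?subn_gt0 // subnKC // ltnW.
  rewrite tpermC.
  by apply: (@word_perm_tperm (i - j).-1); rewrite prednK ?subn_gt0 // subnKC // ltnW.
by exists (v1 ++ v2); rewrite /word_perm big_cat big_cons -/(word_perm v1) E1 -E2.
Qed.

Definition coxeter_length (w : 'S_r) : nat := ex_minn (word_perm_surj w).

Lemma reduced_word_exists (w : 'S_r) :
  exists v : (coxeter_length w).-tuple 'I_r.-1, word_perm v == w.
Proof. by rewrite /coxeter_length; case: ex_minnP => n /existsP. Qed.

Definition reduced_word (w : 'S_r) : seq 'I_r.-1 := xchoose (reduced_word_exists w).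

Lemma reduced_wordK (w : 'S_r) : word_perm (reduced_word w) = w.
Proof. exact/eqP/(xchooseP (reduced_word_exists w)). Qed.

Definition row_entries (l : bipart) (k : bool) (i : 'I_r) : {set 'I_r} :=
  [set initial_tab l b | b : box l & (bcomp b == k) && (brow b == i)].

(* the row stabilizer of component k of t^lambda, which fixes the entries of
   the other component *)
Definition row_stab (l : bipart) (k : bool) : {set 'S_r} :=
  [set w : 'S_r | perm_on (\bigcup_i row_entries l k i) w &
     [forall i, [set w n | n in row_entries l k i] == row_entries l k i]].

End Bipartitions.

Section Hecke.
Variables (R : comPzRingType) (r : nat) (u1 u2 : R).

(* inl i is s_(i+1), inr j is y_(j+1) *)
Definition hgen := ('I_r.-1 + 'I_r)%type.

Let s (i : 'I_r.-1) : aexpr R hgen := Gen (inl i).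
Let y (j : 'I_r) : aexpr R hgen := Gen (inr j).

Inductive hecke_rel : aexpr R hgen -> aexpr R hgen -> Prop :=
  | hecke_ss i : hecke_rel (Mul (s i) (s i)) (Cst 1)
  | hecke_far (i j : 'I_r.-1) : (i.+1 < j)%N ->
      hecke_rel (Mul (s i) (s j)) (Mul (s j) (s i))
  | hecke_braid (i j : 'I_r.-1) : j = i.+1 :> nat ->
      hecke_rel (Mul (Mul (s i) (s j)) (s i)) (Mul (Mul (s j) (s i)) (s j))
  | hecke_yy i j : hecke_rel (Mul (y i) (y j)) (Mul (y j) (y i))
  | hecke_sy i j : j <> ord_lo i -> j <> ord_hi i ->
      hecke_rel (Mul (s i) (y j)) (Mul (y j) (s i))
  | hecke_sy_lo i : hecke_rel
      (Sub (Mul (s i) (y (ord_lo i))) (Mul (y (ord_hi i)) (s i))) (Cst (-1))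
  | hecke_ys_lo i : hecke_rel
      (Sub (Mul (y (ord_lo i)) (s i)) (Mul (s i) (y (ord_hi i)))) (Cst (-1))
  | hecke_y1 (j : 'I_r) : j = 0%N :> nat ->
      hecke_rel (Mul (Sub (y j) (Cst u1)) (Sub (y j) (Cst u2))) (Cst 0).

Definition hecke := presented hecke_rel.

HB.instance Definition _ := GRing.PzRing.on hecke.
HB.instance Definition _ := GRing.Lmodule.on hecke.

Definition hs (i : 'I_r.-1) : hecke := pgen hecke_rel (inl i).
Definition hy (j : 'I_r) : hecke := pgen hecke_rel (inr j).

Definition hperm (w : 'S_r) : hecke := \prod_(i <- reduced_word w) hs i.

(* pi_lambda for u = u2, tilde pi_lambda for u = u1 *)
Definition hpi (u : R) (l : bipart r) : hecke :=
  \prod_(i < r | (i < comp_size l false)%N) (hy i - u *: (1 : hecke)).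

(* x_(lambda^(k)) and its signed version y_(lambda^(k)) *)
Definition hx (l : bipart r) (k : bool) : hecke :=
  \sum_(w in row_stab l k) hperm w.
Definition hxsgn (l : bipart r) (k : bool) : hecke :=
  \sum_(w in row_stab l k) (-1) ^+ coxeter_length w *: hperm w.

Section Elements.
Variables (l : bipart r) (t1 t2 : stdtab l).

Definition xst : hecke := hperm (tab_perm t1)^-1%g * hpi u2 l
  * hx l false * hxsgn l true * hperm (tab_perm t2).
Definition yst : hecke := hperm (tab_perm t1)^-1%g * hpi u1 l
  * hx l false * hxsgn l true * hperm (tab_perm t2).
Definition xbarst : hecke := hperm (tab_perm t1)^-1%g * hpi u2 l
  * hxsgn l false * hx l true * hperm (tab_perm t2).
Definition ybarst : hecke := hperm (tab_perm t1)^-1%g * hpi u1 l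
  * hxsgn l false * hx l true * hperm (tab_perm t2).
End Elements.

End Hecke.

(* Main.v *)
Require Import Defs.
From mathcomp Require Import all_boot all_order all_fingroup all_algebra.
From mathcomp Require Import boolp zify ring.

(* Write t_(l,k) for transpositions.  The elements z_k = y_k - sum_(l < k) t_(l,k)
   are permuted by the symmetric group, w z_(w k) = z_k w.  Let a conjugate pi_A
   of pi_a = prod_(i < a) (y_i - v2), where {v1, v2} = {u1, u2}, be attached to
   every a-element set A of entries.  Then z_k pi_A = v1 pi_A for k in A, and
   z_k pi_A = v2 pi_A + pi_(A + k) - sum_(l in A) t_(l,k) pi_A otherwise, so the
   2^r r! elements pi_A w span the algebra; the same formulas define a module
   with basis the pairs (A, w), so they form a basis.

   In this basis a cell element is a signed sum of the (A, w) with w carrying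
   the rows of s to those of t.  Pair it with the signed sum over the w that
   carry the columns of one standard tableau to those of another, with the
   opposite sign on each component.  If two entries share a row of the first
   and a column of the second tableau, transposing them cancels the sum;
   otherwise a counting argument gives dominance.  The Gram matrix is thus
   unitriangular, and as the number of pairs of standard tableaux is 2^r r!
   (the up and down operators of Young's lattice of bipartitions satisfy
   DU - UD = 2), it follows over any ring that the cell elements form a basis.
   The cancellation argument also bounds the expansions of x_lambda w and of
   x_lambda y_k, which gives the cellular multiplication rule. *)

Set Implicit Arguments.
Unset Strict Implicit.
Unset Printing Implicit Defensive.

Import Order.TTheory GRing.Theory.
Local Open Scope ring_scope.

(** * Coxeter presentation of the symmetric group *)

(** The four families are one construction: [v2] is the parameter in the product and [e k] tells
    whether component [k] carries signs, so everything is done once, for either order of the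
    parameters and any [e]. The ring may be zero or have 2 as a zero divisor, so arguments by
    dimension or by halving are out of reach. Cancelling sums are therefore paired off term by term,
    and bases come from invertible matrices: the Gram matrix factors through the coordinates, and
    because the count makes both factors square, the one-sided inverse obtained from it is
    two-sided, which yields spanning. The [z_k] trade the inhomogeneous relations between [s_i] and
    [y_j] for plain equivariance. The price is that commutation of the [y_k] becomes
    [z_i z_j - z_j z_i = t_(i,j) (z_i - z_j)], the one laborious relation to check in the module.
    Since [hperm] is a product along a chosen reduced word, even [T (v * w) = T v * T w] rests on
    the Coxeter presentation; hence the words below. The 2 in [DU - UD] counts components: a
    partition has one more addable than removable box. *)

Section CoxeterWords.
Variables (m : nat) (E : seq nat -> seq nat -> Prop).
Hypothesis Erefl : forall v, E v v.
Hypothesis Etrans : forall v w x, E v w -> E w x -> E v x.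
Hypothesis Ecat : forall v v' w w', E v v' -> E w w' -> E (v ++ w) (v' ++ w').
Hypothesis Ess : forall i, (i < m)%N -> E [:: i; i] [::].
Hypothesis Efar : forall i j, (i < m)%N -> (j < m)%N ->
  (i.+1 < j)%N || (j.+1 < i)%N -> E [:: i; j] [:: j; i].
Hypothesis Ebraid : forall i, (i.+1 < m)%N ->
  E [:: i.+1; i; i.+1] [:: i; i.+1; i].

(* n-1, ..., j: as a word in the generators, the minimal coset representative moving n to j *)
Definition desc (n j : nat) : seq nat := rev (iota j (n - j)).

Lemma desc_rcons n j : (j < n)%N -> desc n j = rcons (desc n j.+1) j.
Proof.
by move=> jn; rewrite /desc -rev_cons -[(n - j)%N]prednK ?subn_gt0 // subnS.
Qed.

Lemma desc_cat n k j : (j <= k <= n)%N -> desc n j = desc n k ++ desc k j.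
Proof.
move=> /andP[jk kn]; rewrite /desc -rev_cat; congr rev.
have -> : (n - j = (k - j) + (n - k))%N by lia.
by rewrite iotaD subnKC.
Qed.

Lemma desc_cons n j : (j <= n)%N -> desc n.+1 j = n :: desc n j.
Proof.
move=> jn; rewrite (@desc_cat _ n) ?jn //=.
by rewrite /desc subSn // subnn.
Qed.

Lemma mem_desc n j i : (i \in desc n j) = (j <= i < n)%N.
Proof. by rewrite mem_rev mem_iota; lia. Qed.

Lemma far_cat (w : seq nat) i : (i < m)%N ->
  all (fun l => (l < m)%N && ((l.+1 < i)%N || (i.+1 < l)%N)) w -> E (w ++ [:: i]) (i :: w).
Proof.
move=> im; elim: w => [|l w IHw] //= /andP[/andP[lm far] /IHw Ew].
apply: Etrans (Ecat (Erefl [:: l]) Ew) _.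
exact: (Ecat (Efar lm im far) (Erefl w)).
Qed.

(** Append a letter [i] to a descending run ending at [j]: it commutes to the left if [i.+1 < j],
    prolongs the run if [i.+1 = j], cancels its last letter if [i = j], and for [i > j] a braid move
    lets it pass to the left as [i.-1]. Whatever leaves the run is below [n]. *)
Lemma coxeter_split n (v : seq nat) : (n < m)%N -> all (fun i => i < n.+1)%N v ->
  exists w j, [/\ all (fun i => i < n)%N w, (j <= n.+1)%N & E v (w ++ desc n.+1 j)].
Proof.
move=> nm; elim/last_ind: v => [|v i IHv] /=.
  by exists [::], n.+1; rewrite /desc subnn.
rewrite all_rcons => /andP[lt_in /IHv[w [j [wn jn Ev]]]].
have {}Ev : E (rcons v i) (w ++ (desc n.+1 j ++ [:: i])).
  by rewrite -cats1 catA; apply: Ecat.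
have [lt_ij|lt_ji|eq_ij] := ltngtP i j.
- have [lt_i1j|eq_i1j] : (i.+1 < j)%N \/ i.+1 = j by lia.
    exists (w ++ [:: i]), j; split=> //; first by rewrite all_cat wn /= andbT; lia.
    apply: Etrans Ev _; rewrite -catA; apply: Ecat => //.
    apply: far_cat; first by lia.
    by apply/allP => l; rewrite mem_desc; lia.
  exists w, i; split=> //; first by lia.
  by rewrite (@desc_rcons _ i) ?eq_i1j -?(cats1 (desc _ _)) //; lia.
(* The run is cut around its letters [i, i.-1]: the appended [i] commutes past the letters below
   [i.-1] and then meets them in a braid. *)
- have eqD : desc n.+1 j = desc n.+1 i.+1 ++ [:: i; i.-1] ++ desc i.-1 j.
    rewrite (@desc_cat _ i.+1); last by lia.
    rewrite (@desc_cons i); last by lia.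
    by case: i lt_ji {lt_in Ev} => // i lt_ji; rewrite (@desc_cons i).
  exists (w ++ [:: i.-1]), j; split=> //; first by rewrite all_cat wn /= andbT; lia.
  apply: Etrans Ev _; rewrite -catA; apply: Ecat => //.
  rewrite eqD -!catA.
  apply: (@Etrans _ (desc n.+1 i.+1 ++ [:: i; i.-1; i] ++ desc i.-1 j)).
    apply: Ecat => //; rewrite -[[:: i; i.-1; i]]/([:: i; i.-1] ++ [:: i]) -catA.
    apply: Ecat => //; apply: far_cat; first by lia.
    by apply/allP => l; rewrite mem_desc; lia.
  apply: (@Etrans _ (desc n.+1 i.+1 ++ [:: i.-1; i; i.-1] ++ desc i.-1 j)).
    apply: Ecat => //; apply: Ecat => //.
    by case: i lt_ji lt_in {eqD} => // i _ lt_in; apply: Ebraid; lia.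
  rewrite -[[:: i.-1; i; i.-1]]/([:: i.-1] ++ [:: i; i.-1]) -!catA catA [X in E _ X]catA.
  apply: Ecat => //; apply: far_cat; first by lia.
  by apply/allP => l; rewrite mem_desc; lia.
- exists w, j.+1; split=> //; first by lia.
  apply: Etrans Ev _; apply: Ecat => //.
  rewrite eq_ij desc_rcons; last by lia.
  rewrite -cats1 -catA -[X in E _ X]cats0; apply: Ecat => //; apply: Ess; lia.
Qed.

End CoxeterWords.

(** * Normal forms of permutations *)

Section SymmetricGroupWords.
Variable r : nat.

(** Letters are plain numbers, so that words can be cut and shifted without bound proofs; a letter
    out of range stands for the identity. *)
Definition simple_perm (i : nat) : 'S_r :=
  oapp (fun k : 'I_r.-1 => tperm (ord_lo k) (ord_hi k)) 1%g (insub i).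

Definition nword_perm (v : seq nat) : 'S_r := (\prod_(i <- v) simple_perm i)%g.

Lemma simple_permE (i : 'I_r.-1) : simple_perm i = tperm (ord_lo i) (ord_hi i).
Proof. by rewrite /simple_perm valK. Qed.

Lemma simple_perm_val i (x : 'I_r) : (i < r.-1)%N ->
  simple_perm i x = (if x == i :> nat then i.+1 else if x == i.+1 :> nat then i else x) :> nat.
Proof.
move=> lti; rewrite -[i]/(val (Ordinal lti)) simple_permE.
case: tpermP => [->|->|/eqP ne1 /eqP ne2] /=; rewrite ?eqxx //.
  by rewrite gtn_eqF.
by rewrite -!val_eqE /= in ne1 ne2; rewrite (negPf ne1) (negPf ne2).
Qed.

Lemma nword_perm_cat v w : nword_perm (v ++ w) = (nword_perm v * nword_perm w)%g.
Proof. by rewrite /nword_perm big_cat. Qed.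

Lemma nword_perm_map (v : seq 'I_r.-1) : nword_perm (map val v) = word_perm v.
Proof. by rewrite /nword_perm big_map; apply: eq_bigr => i _; rewrite simple_permE. Qed.

Lemma nword_perm_fix n (v : seq nat) (x : 'I_r) : (n <= r.-1)%N -> (n < x)%N ->
  all (fun i => i < n)%N v -> nword_perm v x = x.
Proof.
move=> nr nx; elim: v => [|i v IHv] /=; first by rewrite /nword_perm big_nil perm1.
move=> /andP[lt_in /IHv e]; rewrite /nword_perm big_cons permM.
suff -> : simple_perm i x = x by [].
apply: val_inj; rewrite /= simple_perm_val; last exact: leq_trans lt_in nr.
by rewrite !gtn_eqF // (leq_ltn_trans _ nx) // ltnW.
Qed.

Lemma nword_perm_desc n j (x : 'I_r) : (n <= r.-1)%N -> (j <= n)%N -> x = n :> nat ->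
  nword_perm (desc n j) x = j :> nat.
Proof.
elim: n x => [|n IHn] x nr jn xn.
  have -> : j = 0%N by case: j jn.
  by rewrite /nword_perm /desc subnn big_nil perm1 xn.
have [jn'|ejn] := leqP j n; last first.
  have -> : j = n.+1 by apply/eqP; rewrite eqn_leq jn.
  by rewrite /nword_perm /desc subnn big_nil perm1 xn.
rewrite desc_cons // /nword_perm big_cons permM; apply: IHn => //; first exact: ltnW.
rewrite simple_perm_val //= xn eqxx.
by rewrite gtn_eqF.
Qed.

Section Matsumoto.
Variables (E : seq nat -> seq nat -> Prop).
Hypothesis Erefl : forall v, E v v.
Hypothesis Esym : forall v w, E v w -> E w v.
Hypothesis Etrans : forall v w x, E v w -> E w x -> E v x.
Hypothesis Ecat : forall v v' w w', E v v' -> E w w' -> E (v ++ w) (v' ++ w').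
Hypothesis Ess : forall i, (i < r.-1)%N -> E [:: i; i] [::].
Hypothesis Efar : forall i j, (i < r.-1)%N -> (j < r.-1)%N ->
  (i.+1 < j)%N || (j.+1 < i)%N -> E [:: i; j] [:: j; i].
Hypothesis Ebraid : forall i, (i.+1 < r.-1)%N ->
  E [:: i.+1; i; i.+1] [:: i; i.+1; i].
Hypothesis Eperm : forall v w, E v w -> nword_perm v = nword_perm w.

(** The normal form of [coxeter_split] can be read off the permutation: letters below [n] fix the
    entry [n.+1], which the descending run then sends to [j]. Equal permutations thus have equal
    runs, which cancel, and induction treats the rest. *)
Lemma coxeter_presentation n (v w : seq nat) : (n <= r.-1)%N ->
  all (fun i => i < n)%N v -> all (fun i => i < n)%N w ->
  nword_perm v = nword_perm w -> E v w.
Proof.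
elim: n v w => [|n IHn] v w nr vn wn evw.
  by case: v vn {evw} => //; case: w wn => //.
have [v' [j [v'n jn Ev]]] := coxeter_split Erefl Etrans Ecat Ess Efar Ebraid nr vn.
have [w' [k [w'n kn Ew]]] := coxeter_split Erefl Etrans Ecat Ess Efar Ebraid nr wn.
have ltn1r : (n.+1 < r)%N by rewrite -ltn_predRL.
pose x := Ordinal ltn1r.
have e : nword_perm (v' ++ desc n.+1 j) = nword_perm (w' ++ desc n.+1 k).
  by rewrite -(Eperm Ev) evw (Eperm Ew).
have ejk : j = k.
  have := congr1 (fun p : 'S_r => nat_of_ord (p x)) e.
  rewrite !nword_perm_cat /= !permM (@nword_perm_fix n v' x) ?(@nword_perm_fix n w' x) ?(ltnW nr) //=.
  by rewrite !nword_perm_desc.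
subst k; have e' : nword_perm v' = nword_perm w'.
  by move: e; rewrite !nword_perm_cat => /mulIg.
apply: Etrans Ev (Etrans _ (Esym Ew)); apply: Ecat => //.
exact: IHn (ltnW nr) _ _ _.
Qed.

End Matsumoto.

End SymmetricGroupWords.

(** * Relations and permutations inside the Hecke algebra *)

Section PresentedTheory.
Variables (R : comPzRingType) (G : Type) (rel : aexpr R G -> aexpr R G -> Prop).
Local Notation A := (presented rel).

Lemma pclassD x y : pclass rel (Add x y) = pclass rel x + pclass rel y.
Proof. by rewrite -paddE. Qed.

Lemma pclassM x y : pclass rel (Mul x y) = pclass rel x * pclass rel y.
Proof. by rewrite -pmulE. Qed.

Lemma pclass_cst a : pclass rel (Cst a) = a *: (1 : A).
Proof.
apply/esym; rewrite -[LHS]/(pscale a (pclass rel (Cst 1))) pscaleE.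
exact/pi_eq/aeq_mul1r.
Qed.

Lemma pclassB x y : pclass rel (Defs.Sub x y) = pclass rel x - pclass rel y.
Proof.
by rewrite pclassD pclassM pclass_cst -presented_scaleAl mul1r scaleN1r.
Qed.

Lemma pclass_rel x y : rel x y -> pclass rel x = pclass rel y.
Proof. by move=> xy; apply/pi_eq/aeq_rel. Qed.

Lemma presented_ind (P : A -> Prop) :
  (forall a, P (a *: (1 : A))) -> (forall g, P (pgen rel g)) ->
  (forall x y, P x -> P y -> P (x + y)) -> (forall x y, P x -> P y -> P (x * y)) ->
  forall x, P x.
Proof.
move=> Pc Pg PD PM; elim/pclass_ind; elim=> [a|g|x Px y Py|x Px y Py].
- by rewrite pclass_cst.
- exact: Pg.
- by rewrite pclassD; apply: PD.
- by rewrite pclassM; apply: PM.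
Qed.

End PresentedTheory.

Section HeckeTheory.
Variables (R : comPzRingType) (r : nat) (u1 u2 : R).
Local Notation H := (hecke r u1 u2).
Local Notation hs := (@Defs.hs R r u1 u2).
Local Notation hy := (@Defs.hy R r u1 u2).
Local Notation T := (@hperm R r u1 u2).

Lemma hecke_scaleAl (a : R) (x y : H) : a *: (x * y) = (a *: x) * y.
Proof. exact: presented_scaleAl. Qed.

Lemma hecke_scaleAr (a : R) (x y : H) : a *: (x * y) = x * (a *: y).
Proof. exact: presented_scaleAr. Qed.

Lemma hecke_ind (P : H -> Prop) :
  (forall a, P (a *: (1 : H))) -> (forall i, P (hs i)) -> (forall j, P (hy j)) ->
  (forall x y, P x -> P y -> P (x + y)) -> (forall x y, P x -> P y -> P (x * y)) ->
  forall x, P x.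
Proof. by move=> Pc Ps Py PD PM; apply: presented_ind => // -[]. Qed.

Local Notation hrel := (pclass_rel (rel := hecke_rel u1 u2)).

Lemma hs_sq i : hs i * hs i = 1.
Proof. by have := hrel (hecke_ss u1 u2 i); rewrite pclassM. Qed.

Lemma hs_far (i j : 'I_r.-1) : (i.+1 < j)%N -> hs i * hs j = hs j * hs i.
Proof. by move=> ij; have := hrel (hecke_far u1 u2 ij); rewrite !pclassM. Qed.

Lemma hs_braid (i j : 'I_r.-1) : j = i.+1 :> nat -> hs i * hs j * hs i = hs j * hs i * hs j.
Proof. by move=> ij; have := hrel (hecke_braid u1 u2 ij); rewrite !pclassM. Qed.

Lemma hyC i j : hy i * hy j = hy j * hy i.
Proof. by have := hrel (hecke_yy u1 u2 i j); rewrite !pclassM. Qed.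

Lemma hs_hy i j : j <> ord_lo i -> j <> ord_hi i -> hs i * hy j = hy j * hs i.
Proof. by move=> ne1 ne2; have := hrel (hecke_sy u1 u2 ne1 ne2); rewrite !pclassM. Qed.

Lemma hs_hy_lo i : hs i * hy (ord_lo i) = hy (ord_hi i) * hs i - 1.
Proof.
have := hrel (hecke_sy_lo u1 u2 i); rewrite pclassB !pclassM pclass_cst scaleN1r.
by move=> /(canRL (subrK _)) ->; rewrite addrC.
Qed.

Lemma hy_hs_lo i : hy (ord_lo i) * hs i = hs i * hy (ord_hi i) - 1.
Proof.
have := hrel (hecke_ys_lo u1 u2 i); rewrite pclassB !pclassM pclass_cst scaleN1r.
by move=> /(canRL (subrK _)) ->; rewrite addrC.
Qed.

Lemma hy_quadratic (j : 'I_r) : j = 0%N :> nat ->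
  (hy j - u1 *: (1 : H)) * (hy j - u2 *: (1 : H)) = 0.
Proof.
by move=> j0; have := hrel (hecke_y1 u1 u2 j0); rewrite pclassM !pclassB !pclass_cst scale0r.
Qed.

Definition nhs (v : seq nat) : H :=
  \prod_(i <- v) oapp hs 1 (insub i).

Lemma nhs_cat v w : nhs (v ++ w) = nhs v * nhs w.
Proof. exact: big_cat. Qed.

Lemma nhs1 (i : 'I_r.-1) : nhs [:: val i] = hs i.
Proof. by rewrite /nhs big_seq1 valK. Qed.

Lemma nhs_map (v : seq 'I_r.-1) : nhs (map val v) = \prod_(i <- v) hs i.
Proof. by rewrite /nhs big_map; apply: eq_bigr => i _; rewrite valK. Qed.

Lemma nword_perm1 (i : 'I_r.-1) : nword_perm r [:: val i] = tperm (ord_lo i) (ord_hi i).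
Proof. by rewrite /nword_perm big_seq1 simple_permE. Qed.

Lemma nhs_nword_perm (v w : seq nat) : all (fun i => i < r.-1)%N v ->
  all (fun i => i < r.-1)%N w -> nword_perm r v = nword_perm r w -> nhs v = nhs w.
Proof.
move=> vr wr evw.
(* The relation records both equalities, so that [Eperm] holds by definition. *)
pose E (v w : seq nat) := nword_perm r v = nword_perm r w /\ nhs v = nhs w.
suff [] : E v w by [].
apply: (@coxeter_presentation r E) (leqnn _) vr wr evw.
- by [].
- by move=> ? ? [].
- by move=> x y z [e1 e2] [e3 e4]; rewrite /E e1 e2 e3 e4.
- by move=> x x' y y' [e1 e2] [e3 e4]; rewrite /E !nword_perm_cat !nhs_cat e1 e2 e3 e4.
- move=> i lti; pose k := Ordinal lti; rewrite /E -[[:: i; i]]/([:: val k] ++ [:: val k]).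
  rewrite nword_perm_cat nword_perm1 tperm2 nhs_cat nhs1 hs_sq /nhs /nword_perm.
  by rewrite !big_nil.
- move=> i j lti ltj; pose k := Ordinal lti; pose l := Ordinal ltj.
  rewrite /E -[[:: i; j]]/([:: val k] ++ [:: val l]) -[[:: j; i]]/([:: val l] ++ [:: val k]).
  rewrite !nword_perm_cat !nhs_cat !nhs1 => ij; split.
    apply/permP => x; apply: val_inj; rewrite /= !permM -!/(nat_of_ord _).
    rewrite /nword_perm !big_seq1 !simple_perm_val //= .
    by case/orP: ij; repeat case: ifP; lia.
  by case/orP: ij => ij; [exact: (@hs_far k l) | exact/esym/(@hs_far l k)].
- move=> i lti; pose k := Ordinal (ltnW lti); pose l := Ordinal lti.
  rewrite /E -[[:: i.+1; i; i.+1]]/([:: val l] ++ [:: val k] ++ [:: val l]).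
  rewrite -[[:: i; i.+1; i]]/([:: val k] ++ [:: val l] ++ [:: val k]).
  rewrite !nword_perm_cat !nhs_cat !nhs1 !mulrA (@hs_braid k l) //; split=> //.
  apply/permP => x; apply: val_inj; rewrite /= !permM.
  rewrite /nword_perm !big_seq1 !simple_perm_val ?(ltnW lti) //=.
  by repeat case: ifP; lia.
- by move=> ? ? [].
Qed.

Lemma hperm_word (v : seq 'I_r.-1) : \prod_(i <- v) hs i = T (word_perm v).
Proof.
rewrite /hperm -!nhs_map; apply: nhs_nword_perm.
- by apply/allP => _ /mapP[i _ ->]; apply: ltn_ord.
- by apply/allP => _ /mapP[i _ ->]; apply: ltn_ord.
- by rewrite !nword_perm_map reduced_wordK.
Qed.

(** The two reduced words concatenate to a word for [v * w], in general not reduced; [hperm_word]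
    makes every word equally good. *)
Lemma hpermM v w : T (v * w)%g = T v * T w.
Proof.
rewrite -{1}[v]reduced_wordK -{1}[w]reduced_wordK /word_perm -big_cat.
by rewrite -/(word_perm _) -hperm_word big_cat.
Qed.

Lemma hperm1 : T 1%g = 1.
Proof.
by have := hperm_word [::]; rewrite big_nil /word_perm big_nil => ->.
Qed.

Lemma hperm_simple (i : 'I_r.-1) : T (tperm (ord_lo i) (ord_hi i)) = hs i.
Proof.
by have := hperm_word [:: i]; rewrite /word_perm !big_seq1.
Qed.

Lemma hpermVK w : T w * T w^-1%g = 1.
Proof. by rewrite -hpermM mulgV hperm1. Qed.

End HeckeTheory.

(** * Transpositions and sets of entries *)

Section Blocks.
Variable r : nat.

Definition initial_set (a : nat) : {set 'I_r} := [set i : 'I_r | (i < a)%N].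

Lemma mem_initial_set a i : (i \in initial_set a) = (i < a)%N.
Proof. by rewrite inE. Qed.

Lemma card_initial_set a : (a <= r)%N -> #|initial_set a| = a.
Proof.
move=> ar; rewrite -sum1dep_card -(big_ord_widen r (fun=> 1%N) ar).
by rewrite sum1_card card_ord.
Qed.

Lemma tperm_conj (v : 'S_r) a b : (v * tperm (v a) (v b) = tperm a b * v)%g.
Proof. by rewrite -tpermJ /conjg !mulgA mulgV mul1g. Qed.

(** A Young subgroup is generated by its transpositions: multiplying by [tperm (w i) i] fixes a
    moved point [i] and moves no new one. *)
Lemma block_perm_ind a (P : 'S_r -> Prop) : P 1%g ->
    (forall (w : 'S_r) (i j : 'I_r), (i < a)%N = (j < a)%N -> P w -> P (w * tperm i j)%g) ->
  forall w : 'S_r, (forall i : 'I_r, (w i < a)%N = (i < a)%N) -> P w.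
Proof.
move=> P1 Pt w; have [n le_n] := ubnP #|[set i | w i != i]|.
elim: n => // n IHn in w le_n * => wa.
have [/eqP w1|[i]] := set_0Vmem [set i | w i != i].
  suff -> : w = 1%g by [].
  by apply/permP => i; rewrite perm1; have := in_set0 i; rewrite -(eqP w1) inE => /negbFE/eqP.
rewrite inE => wi; rewrite -(mulgKV (tperm (w i) i) w) tpermV; apply: Pt; first exact: wa.
apply: IHn => [|j]; last first.
  by rewrite permM; case: tpermP => [/perm_inj->|e|_ _] //; rewrite wa // -e wa.
rewrite ltnS in le_n; apply: leq_trans _ le_n; apply: proper_card; apply/properP; split.
  apply/subsetP => j; rewrite !inE permM; apply: contraNneq => wj.
  rewrite wj tpermD //.
    by apply: contraNneq wi => e; rewrite -{2}(perm_inj (etrans wj (esym e))) e.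
  by apply: contraNneq wi => ->; rewrite wj.
by exists i; rewrite ?inE // permM tpermL eqxx.
Qed.

Lemma set_perm_exists (A : {set 'I_r}) : exists p : 'S_r, p @: initial_set #|A| == A.
Proof.
move: {2}#|A| (leqnn #|A|) => n; elim: n A => [|n IHn] A.
  rewrite leqn0 cards_eq0 => /eqP->; exists 1%g.
  rewrite cards0 (_ : initial_set 0 = set0) ?imset0 //.
have [->|[k kA]] := set_0Vmem A; first by move=> _; apply: IHn; rewrite cards0.
move=> leA; have cA := cardsD1 k A; rewrite kA add1n in cA.
have [p /eqP pA] : exists p : 'S_r, p @: initial_set #|A :\ k| == A :\ k by apply: IHn; lia.
have a_lt : (#|A :\ k| < r)%N.
  by have := max_card A; rewrite card_ord cA.
set a := #|A :\ k| in pA cA a_lt *; pose j := Ordinal a_lt.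
have pj : p j \notin A :\ k.
  by rewrite -pA mem_imset ?inE ?ltnn //; apply: perm_inj.
exists (p * tperm (p j) k)%g; rewrite cA; apply/eqP.
have -> : initial_set a.+1 = j |: initial_set a.
  by apply/setP => i; rewrite !inE ltnS leq_eqVlt -val_eqE.
rewrite imsetU1 permM tpermL -[RHS](setD1K kA) -pA; congr (_ |: _).
apply: eq_in_imset => i; rewrite inE => ia; rewrite permM tpermD //.
  by apply: contraNneq pj => ->; rewrite -pA mem_imset ?inE //; apply: perm_inj.
apply: contraTneq ia => e; have := setD11 k A; rewrite -pA e mem_imset; last exact: perm_inj.
by rewrite inE => ->.
Qed.

(** An arbitrary choice; [hpisE] shows that the conjugate built from it depends only on the image of
    the initial set. *)
Definition set_perm (A : {set 'I_r}) : 'S_r := xchoose (set_perm_exists A).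

Lemma set_permP (A : {set 'I_r}) : set_perm A @: initial_set #|A| = A.
Proof. exact/eqP/(xchooseP (set_perm_exists A)). Qed.

End Blocks.

(** * Multiplication rules for the spanning set *)

Section HeckeStructure.
Variables (R : comPzRingType) (r : nat) (u1 u2 : R).
Local Notation H := (hecke r u1 u2).
Local Notation hs := (@Defs.hs R r u1 u2).
Local Notation hy := (@Defs.hy R r u1 u2).
Local Notation T := (@hperm R r u1 u2).

Lemma hperm_tperm_conj (v : 'S_r) a b : T v * T (tperm (v a) (v b)) = T (tperm a b) * T v.
Proof. by rewrite -!hpermM tperm_conj. Qed.

(* The Jucys-Murphy sum is subtracted so that conjugation permutes these elements. *)
Definition hz (k : 'I_r) : H := hy k - \sum_(l < r | (l < k)%N) T (tperm l k).

(** The sum for [ord_hi i] has one term more than the conjugated sum for [ord_lo i], the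
    transposition of the two. Multiplied by [hs i] it gives 1, which absorbs the constant of the
    mixed relation. *)
Lemma hs_hz_lo i : hs i * hz (ord_lo i) = hz (ord_hi i) * hs i.
Proof.
rewrite /hz mulrBr mulrBl hs_hy_lo -addrA -opprD; congr (_ - _).
rewrite [in RHS](bigD1 (ord_lo i)) //= mulrDl hperm_simple hs_sq; congr (_ + _).
rewrite mulr_sumr mulr_suml; apply: eq_big => [l|l lti].
  by rewrite ltnS ltn_neqAle andbC.
have := hperm_tperm_conj (tperm (ord_lo i) (ord_hi i)) l (ord_hi i).
rewrite hperm_simple tpermR tpermD //.
  by apply/eqP => /(congr1 val)/= e; move: lti; rewrite -e; lia.
by apply/eqP => /(congr1 val)/= e; move: lti; rewrite -e; lia.
Qed.

Lemma hs_hz i k : hs i * hz (tperm (ord_lo i) (ord_hi i) k) = hz k * hs i.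
Proof.
case: tpermP => [->|->|/eqP ne1 /eqP ne2].
- rewrite -[LHS]mulr1 -(hs_sq u1 u2 i) mulrA -[hs i * _ * _]mulrA -hs_hz_lo.
  by rewrite mulrA hs_sq mul1r.
- exact: hs_hz_lo.
rewrite /hz mulrBr mulrBl hs_hy //; try exact/eqP.
congr (_ - _); rewrite mulr_sumr mulr_suml.
rewrite (reindex_inj (@perm_inj _ (tperm (ord_lo i) (ord_hi i)))) /=.
apply: eq_big => [l|l _]; last first.
  have := hperm_tperm_conj (tperm (ord_lo i) (ord_hi i)) l k.
  by rewrite hperm_simple (tpermD (z := k)) // eq_sym.
by case: tpermP => [->|->|//] /=; move: ne1 ne2; rewrite -!val_eqE /=; lia.
Qed.

Lemma hperm_hz (v : 'S_r) k : T v * hz (v k) = hz k * T v.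
Proof.
rewrite -(reduced_wordK v); elim: (reduced_word v) k => [|i w IHw] k.
  by rewrite /word_perm big_nil perm1 hperm1 mulr1 mul1r.
rewrite /word_perm big_cons permM hpermM -mulrA -/(word_perm w) IHw.
by rewrite mulrA hperm_simple hs_hz mulrA.
Qed.

Section Cyclotomic.
Variables (v1 v2 : R).
Hypothesis v12 : (v1 = u1 /\ v2 = u2) \/ (v1 = u2 /\ v2 = u1).

Local Notation fac j := (hy j - v2 *: (1 : H)).

Definition hpi0 (a : nat) : H := \prod_(i < r | (i < a)%N) fac i.

Lemma hy_hpi0 j a : hy j * hpi0 a = hpi0 a * hy j.
Proof.
apply: commr_prod => i _; rewrite /GRing.comm mulrBr mulrBl hyC.
by rewrite -hecke_scaleAl -hecke_scaleAr mulr1 mul1r.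
Qed.

Lemma hpi0_nat a : (a <= r)%N ->
  hpi0 a = \prod_(i < a) oapp (fun j => fac j) 0 (insub (i : nat)).
Proof.
move=> ar; rewrite (big_ord_widen _ (fun i => oapp (fun j => fac j) 0 (insub i)) ar).
by apply: eq_bigr => i _; rewrite valK.
Qed.

Lemma hpi0_0 : hpi0 0 = 1.
Proof. by rewrite hpi0_nat // big_ord0. Qed.

Lemma hpi0_S (k : 'I_r) : hpi0 k.+1 = hpi0 k * fac k.
Proof.
rewrite !hpi0_nat ?(ltnW (ltn_ord k)) ?ltn_ord // big_ord_recr /=.
by rewrite [insub (k : nat)]valK.
Qed.

Lemma comm_scale1 (x : H) a : GRing.comm x (a *: (1 : H)).
Proof. by rewrite /GRing.comm -hecke_scaleAl -hecke_scaleAr mulr1 mul1r. Qed.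

Lemma quadratic_v (j : 'I_r) : j = 0%N :> nat ->
  hy j * fac j = v1 *: fac j.
Proof.
move=> j0; apply/eqP; rewrite -subr_eq0 -{2}[fac j]mul1r hecke_scaleAl -mulrBl; apply/eqP.
have e := hy_quadratic u1 u2 j0; case: v12 => -[-> ->] //.
rewrite -[RHS]e; apply: commrB; last exact: comm_scale1.
apply: commr_sym; apply: commrB => //; exact: comm_scale1.
Qed.

Lemma hy_hpi0_first (j : 'I_r) a : j = 0%N :> nat -> (0 < a <= r)%N ->
  hy j * hpi0 a = v1 *: hpi0 a.
Proof.
move=> j0 /andP[a0 ar]; rewrite hpi0_nat //; case: a a0 ar => // a _ ar.
rewrite big_ord_recl /= (_ : insub 0%N = Some j); last by rewrite -j0 [insub _]valK.
by rewrite /= mulrA quadratic_v // -hecke_scaleAl.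
Qed.

Lemma hs_hy_comm (i : 'I_r.-1) (j : 'I_r) : (j < i)%N || (i.+1 < j)%N -> GRing.comm (hs i) (hy j).
Proof. by move=> ij; apply: hs_hy => /(congr1 val) /= e; move: ij; rewrite e; lia. Qed.

Lemma comm_fac (x : H) j : GRing.comm x (hy j) -> GRing.comm x (fac j).
Proof. by move=> xj; apply: commrB => //; apply: comm_scale1. Qed.

(** Factors away from [i] commute with [hs i]. The two factors at [i] and [i.+1] occur together
    unless [a] separates them, and for their product the corrections -1 and +1 of [e1] and [e2]
    cancel. *)
Lemma hs_hpi0 (i : 'I_r.-1) a : (a <= r)%N -> i.+1 != a -> GRing.comm (hs i) (hpi0 a).
Proof.
move=> ar ia; have [le_ai|lt_ia] := leqP a i.
  by apply: commr_prod => j ja; apply/comm_fac/hs_hy_comm; rewrite (leq_trans ja).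
elim: a ar ia lt_ia => // a IHa ar ia lt_ia.
have -> : hpi0 a.+1 = hpi0 a * fac (Ordinal ar) by rewrite -(hpi0_S (Ordinal ar)).
have [ea|ne_a] := eqVneq i.+1 a; last first.
  apply: commrM; first by apply: IHa => //; lia.
  by apply/comm_fac/hs_hy_comm => /=; lia.
subst a; have -> : Ordinal ar = ord_hi i by apply: val_inj.
rewrite -[i.+1]/((ord_lo i).+1) hpi0_S -mulrA; apply: commrM.
  by apply: commr_prod => j ja; apply/comm_fac/hs_hy_comm; rewrite ja.
have e1 : hs i * fac (ord_lo i) = fac (ord_hi i) * hs i - 1.
  by rewrite mulrBr mulrBl hs_hy_lo addrAC [hs i * (_ *: _)]comm_scale1.
have e2 : hs i * fac (ord_hi i) = fac (ord_lo i) * hs i + 1.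
  by rewrite mulrBr mulrBl hy_hs_lo addrAC subrK [hs i * (_ *: _)]comm_scale1.
rewrite /GRing.comm mulrA e1 (mulrBl _ _ 1) mul1r -(mulrA _ (hs i)) e2 mulrDr mulr1 addrK mulrA.
by congr (_ * _); apply: comm_fac; apply: commr_sym; apply: comm_fac; apply: hyC.
Qed.

(** Induction on the distance: conjugation by the simple transposition ending at [j] brings [j]
    closer to [i]. As [i] and [j] lie on the same side of [a], no simple transposition met on the
    way crosses the boundary. *)
Lemma hperm_tperm_hpi0 (i j : 'I_r) a : (a <= r)%N -> (i < a)%N = (j < a)%N ->
  GRing.comm (T (tperm i j)) (hpi0 a).
Proof.
move=> ar; wlog lt_ij : i j / (i < j)%N => [hwlog|].
  have [ij|ji|/val_inj->] := ltngtP i j; first exact: hwlog.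
    by rewrite tpermC => e; apply: hwlog.
  by rewrite tperm1 hperm1 => _; apply/commr_sym/commr1.
have [n le_n] := ubnP (j - i)%N; elim: n => // n IHn in i j lt_ij le_n *.
move=> ija; have lt_j : (j.-1 < r.-1)%N by have := ltn_ord j; lia.
pose k := Ordinal lt_j; have ehi : ord_hi k = j by apply: val_inj => /=; lia.
have sk : GRing.comm (hs k) (hpi0 a) by apply: hs_hpi0 => //=; lia.
have [e|ne] := eqVneq i (ord_lo k).
  by rewrite e -ehi hperm_simple.
have lt_ik : (i < ord_lo k)%N by move: ne; rewrite -val_eqE /=; lia.
have -> : tperm i j = (tperm (ord_lo k) (ord_hi k) * tperm i (ord_lo k) *
    tperm (ord_lo k) (ord_hi k))%g.
  have := tperm_conj (tperm (ord_lo k) (ord_hi k)) i (ord_hi k).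
  rewrite tpermR tpermD; first by move=> ->; rewrite -mulgA tperm2 mulg1 ehi.
    by rewrite eq_sym.
  by rewrite ehi -val_eqE /=; lia.
rewrite !hpermM hperm_simple; apply: commr_sym; apply: commrM; last exact: commr_sym.
apply: commrM; first exact: commr_sym.
by apply: commr_sym; apply: IHn => //=; move: lt_ik le_n ija => /=; lia.
Qed.

Lemma hperm_hpi0 (w : 'S_r) a : (a <= r)%N ->
  (forall i : 'I_r, (w i < a)%N = (i < a)%N) -> GRing.comm (T w) (hpi0 a).
Proof.
move=> ar; move: w; apply: block_perm_ind => [|w i j ija comm_w].
  by rewrite hperm1; apply/commr_sym/commr1.
rewrite hpermM; apply: commr_sym; apply: commrM; first exact: commr_sym.
by apply: commr_sym; apply: hperm_tperm_hpi0.
Qed.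

Definition hpis (A : {set 'I_r}) : H := T (set_perm A)^-1%g * hpi0 #|A| * T (set_perm A).

Lemma card_le_r (A : {set 'I_r}) : (#|A| <= r)%N.
Proof. by rewrite -[leqRHS]card_ord max_card. Qed.

(** Two permutations with the same image of the initial set differ by one that preserves this set,
    and such a permutation commutes with [hpi0 a]. *)
Lemma hpisE (p : 'S_r) a : (a <= r)%N ->
  hpis (p @: initial_set r a) = T p^-1%g * hpi0 a * T p.
Proof.
move=> ar; rewrite /hpis; set A := p @: _.
have cA : #|A| = a by rewrite card_imset ?card_initial_set //; apply: perm_inj.
have := set_permP A; rewrite cA; set q := set_perm A => qA.
have c : GRing.comm (T (p * q^-1)%g) (hpi0 a).
  apply: hperm_hpi0 => // i; rewrite permM.
  rewrite -!(mem_initial_set a) -(mem_imset _ _ (@perm_inj _ q)) permKV qA.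
  by rewrite mem_imset //; apply: perm_inj.
have e : T p = T (p * q^-1)%g * T q by rewrite -hpermM mulgKV.
by rewrite [T p]e -[RHS]mulrA (mulrA (hpi0 a)) -c !mulrA -hpermM mulKg.
Qed.

Lemma hperm_hpis (v : 'S_r) (A : {set 'I_r}) : T v * hpis (v @: A) = hpis A * T v.
Proof.
have := set_permP A; set q := set_perm A => qA.
rewrite -{1}qA -imset_comp (eq_imset (g := (q * v)%g)); last by move=> i; rewrite permM.
rewrite hpisE ?card_le_r // /hpis -/q invMg !hpermM !mulrA.
by rewrite hpermVK mul1r.
Qed.

(** For [k] in [A] the conjugating permutation may start at [k]. Then [hz k] is conjugate to [hz] at
    0, which is [hy] at 0, and the quadratic relation applies. *)
Lemma set_perm_at (A : {set 'I_r}) (k : 'I_r) : k \in A ->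
  exists p : 'S_r, exists j : 'I_r, [/\ j = 0%N :> nat, p @: initial_set r #|A| = A & p j = k].
Proof.
move=> kA; have := set_permP A; set q := set_perm A => qA.
have A0 : (0 < #|A|)%N by apply/card_gt0P; exists k.
pose j := Ordinal (leq_trans A0 (card_le_r A)).
exists (tperm j (q^-1%g k) * q)%g, j; split=> //; last by rewrite permM tpermL permKV.
have jq i : i \in initial_set r #|A| -> tperm j (q^-1%g k) i \in initial_set r #|A|.
  case: tpermP => // _ _; last by rewrite inE.
  by rewrite -(mem_imset _ _ (@perm_inj _ q)) permKV qA.
apply/eqP; rewrite eqEcard; apply/andP; split; last first.
  by rewrite card_imset ?card_initial_set ?card_le_r //; apply: perm_inj.
apply/subsetP => _ /imsetP[i ia ->]; rewrite permM -qA.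
by rewrite mem_imset ?jq //; apply: perm_inj.
Qed.

(** For [k] outside [A] the permutation may send the first position after the block to [k], so that
    the next factor of the product is the one that adds [k]. *)
Lemma set_perm_after (A : {set 'I_r}) (k : 'I_r) : k \notin A ->
  exists p : 'S_r, exists j : 'I_r, [/\ j = #|A| :> nat, p @: initial_set r #|A| = A & p j = k].
Proof.
move=> kA; have := set_permP A; set q := set_perm A => qA.
have Ar : (#|A| < r)%N.
  have : A \proper [set: 'I_r] by apply/properP; split; [apply: subsetT | exists k].
  by move/proper_card; rewrite cardsT card_ord.
pose j := Ordinal Ar.
exists (q * tperm (q j) k)%g, j; split=> //; last by rewrite permM tpermL.
rewrite -[RHS]qA; apply: eq_in_imset => i iA; rewrite permM tpermD //.
  by apply: contraTneq iA => /perm_inj <-; rewrite inE ltnn.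
by apply: contraNneq kA => ->; rewrite -qA mem_imset //; apply: perm_inj.
Qed.

Lemma hz_first (j : 'I_r) : j = 0%N :> nat -> hz j = hy j.
Proof. by move=> j0; rewrite /hz big_pred0 ?subr0 // => l; rewrite j0. Qed.

Lemma hz_hpis_in (A : {set 'I_r}) k : k \in A -> hz k * hpis A = v1 *: hpis A.
Proof.
move=> kA; have [p [j [j0 pA <-]]] := set_perm_at kA.
rewrite -pA hpisE ?card_le_r // -mulrA mulrA.
have := hperm_hz p^-1%g (p j); rewrite permK => <-.
rewrite hz_first // -[LHS]mulrA [hy j * _]mulrA hy_hpi0_first //; last first.
  by rewrite card_le_r andbT; apply/card_gt0P; exists k.
by rewrite -hecke_scaleAl -hecke_scaleAr !mulrA.
Qed.

(** After conjugation [k] sits at position [j = #|A|]. There [hy j] is [v2] plus the next factor of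
    the product, and the Jucys-Murphy sum runs over exactly the positions of [A]. *)
Lemma hz_hpis_notin (A : {set 'I_r}) k : k \notin A ->
  hz k * hpis A = v2 *: hpis A + hpis (k |: A) - \sum_(l in A) T (tperm l k) * hpis A.
Proof.
move=> kA; have [p [j [ja pA pj]]] := set_perm_after kA.
have cA := card_le_r A.
have -> : hpis (k |: A) = T p^-1%g * hpi0 j.+1 * T p.
  rewrite -(hpisE p (ltn_ord j)); congr hpis.
  have -> : initial_set r j.+1 = j |: initial_set r #|A|.
    by apply/setP => i; rewrite !inE ltnS leq_eqVlt -val_eqE /= ja.
  by rewrite imsetU1 pA pj.
have eA : hpis A = T p^-1%g * hpi0 j * T p by rewrite -{1}pA hpisE // ja.
have e1 : hz k * T p^-1%g = T p^-1%g * hz j.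
  by have := hperm_hz p^-1%g (p j); rewrite permK pj => ->.
rewrite eA -mulrA mulrA e1 hpi0_S /hz mulrBr mulrBl; congr (_ - _); last first.
  rewrite mulr_sumr mulr_suml; apply/esym; rewrite -[in LHS]pA big_imset /=; last first.
    by move=> ? ? _ _; apply: perm_inj.
  apply: eq_big => [l|l _]; first by rewrite inE ja.
  have := hperm_tperm_conj p^-1%g (p l) (p j); rewrite !permK pj => h.
  by rewrite !mulrA -h.
rewrite -[LHS]mulrA [hy j * _]mulrA hy_hpi0.
rewrite [hpi0 j * fac j]mulrBr -hecke_scaleAr mulr1 [T _ * (_ - _)]mulrBr -hecke_scaleAr.
by rewrite [(_ - _) * _]mulrBl -hecke_scaleAl !mulrA [RHS]addrC subrK.
Qed.

End Cyclotomic.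
End HeckeStructure.

(** * The anti-involution *)

Section Star.
Variables (R : comPzRingType) (r : nat) (u1 u2 : R).
Local Notation H := (hecke r u1 u2).
Local Notation hs := (@Defs.hs R r u1 u2).
Local Notation hy := (@Defs.hy R r u1 u2).
Local Notation T := (@hperm R r u1 u2).

Fixpoint rev_eval (x : aexpr R (hgen r)) : H :=
  match x with
  | Cst a => a *: (1 : H)
  | Gen g => pgen _ g
  | Add x y => rev_eval x + rev_eval y
  | Mul x y => rev_eval y * rev_eval x
  end.

(** Reversal respects the presentation: the two mixed relations at each [i] are exchanged, and the
    others are their own reversals up to commutation or reassociation. *)
Lemma rev_eval_aeq x y : aeq (hecke_rel u1 u2) x y -> rev_eval x = rev_eval y.
Proof.
elim=> {x y} /=.
- move=> _ _ [] /=.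
  + by move=> i; rewrite scale1r; apply: hs_sq.
  + by move=> i j ij; apply/esym/hs_far.
  + by move=> i j ij; rewrite !mulrA; apply: hs_braid.
  + by move=> i j; apply: hyC.
  + by move=> i j ne1 ne2; apply/esym/hs_hy.
  + move=> i; rewrite comm_scale1 -hecke_scaleAl mul1r !scaleN1r.
    by apply/eqP; rewrite subr_eq [X in _ == X]addrC; apply/eqP/hy_hs_lo.
  + move=> i; rewrite comm_scale1 -hecke_scaleAl mul1r !scaleN1r.
    by apply/eqP; rewrite subr_eq [X in _ == X]addrC; apply/eqP/hs_hy_lo.
  + move=> j j0; rewrite scale0r.
    have eN b : (b *: (1 : H)) * (-1 *: (1 : H)) = - (b *: (1 : H)).
      by rewrite comm_scale1 -hecke_scaleAl mul1r scaleN1r.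
    rewrite !eN.
    rewrite -[RHS](hy_quadratic u1 u2 j0); apply: commrB; last exact: comm_scale1.
    by apply: commr_sym; apply: commrB => //; apply: comm_scale1.
- by [].
- by [].
- by move=> x y z _ -> _ ->.
- by move=> x x' y y' _ -> _ ->.
- by move=> x x' y y' _ -> _ ->.
- by move=> x y z; rewrite addrA.
- by move=> x y; rewrite addrC.
- by move=> x; rewrite scale0r add0r.
- by move=> x; rewrite comm_scale1 -hecke_scaleAl mul1r scaleN1r addNr scale0r.
- by move=> x y z; rewrite mulrA.
- by move=> x; rewrite scale1r mulr1.
- by move=> x; rewrite scale1r mul1r.
- by move=> x y z; rewrite mulrDr.
- by move=> x y z; rewrite mulrDl.
- by move=> a b; rewrite scalerDl.
- by move=> a b; rewrite -hecke_scaleAl mul1r scalerA mulrC.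
- by move=> a x; rewrite comm_scale1.
Qed.

Definition star (h : H) : H := rev_eval (generic_quotient.repr h).

Lemma star_pclass x : star (pclass _ x) = rev_eval x.
Proof. by apply: rev_eval_aeq; apply: repr_pi. Qed.

Lemma starD x y : star (x + y) = star x + star y.
Proof.
elim/pclass_ind: x => x; elim/pclass_ind: y => y.
by rewrite -pclassD !star_pclass.
Qed.

Lemma starM x y : star (x * y) = star y * star x.
Proof.
elim/pclass_ind: x => x; elim/pclass_ind: y => y.
by rewrite -pclassM !star_pclass.
Qed.

Lemma star_scale1 a : star (a *: (1 : H)) = a *: (1 : H).
Proof. by have := star_pclass (Cst a); rewrite pclass_cst. Qed.

Lemma star1 : star 1 = 1.
Proof. by rewrite -[X in star X]scale1r star_scale1 scale1r. Qed.

Lemma starZ a x : star (a *: x) = a *: star x.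
Proof.
by rewrite -[x in LHS]mul1r hecke_scaleAl starM star_scale1 comm_scale1 -hecke_scaleAl mul1r.
Qed.

Lemma star_hs i : star (hs i) = hs i.
Proof. exact: star_pclass. Qed.

Lemma star_hy j : star (hy j) = hy j.
Proof. exact: star_pclass. Qed.

Lemma starK : involutive star.
Proof.
elim/hecke_ind => [a|i|j|x y ex ey|x y ex ey].
- by rewrite !star_scale1.
- by rewrite !star_hs.
- by rewrite !star_hy.
- by rewrite !starD ex ey.
- by rewrite !starM ex ey.
Qed.

Lemma star_anti_involution : anti_involution star.
Proof. by split; [exact: starD | exact: starZ | exact: starM | exact: starK]. Qed.

Lemma star0 : star 0 = 0.
Proof. by rewrite -(scale0r (1 : H)) star_scale1. Qed.

Lemma starB x y : star (x - y) = star x - star y.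
Proof. by rewrite -[- y]scaleN1r starD starZ scaleN1r. Qed.

Lemma star_sum I (s : seq I) (P : pred I) (F : I -> H) :
  star (\sum_(i <- s | P i) F i) = \sum_(i <- s | P i) star (F i).
Proof. exact: (big_morph star starD star0). Qed.

Lemma star_hperm w : star (T w) = T w^-1%g.
Proof.
rewrite -(reduced_wordK w); elim: (reduced_word w) => [|i v IHv].
  by rewrite /word_perm big_nil hperm1 invg1 hperm1 star1.
rewrite /word_perm big_cons invMg !hpermM starM -/(word_perm v) IHv.
by rewrite hperm_simple star_hs tpermV hperm_simple.
Qed.

Lemma star_hz k : star (hz u1 u2 k) = hz u1 u2 k.
Proof.
rewrite /hz starB star_hy star_sum; congr (_ - _).
by apply: eq_bigr => l _; rewrite star_hperm tpermV.
Qed.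

Lemma star_hpi0 v2 a : (a <= r)%N -> star (@hpi0 R r u1 u2 v2 a) = @hpi0 R r u1 u2 v2 a.
Proof.
elim: a => [|a IHa] ar; first by rewrite hpi0_0 star1.
rewrite -[a]/(nat_of_ord (Ordinal ar)) hpi0_S starM starB star_hy star_scale1 IHa 1?ltnW //=.
by rewrite mulrBl mulrBr hy_hpi0 [in RHS]comm_scale1.
Qed.

Lemma star_hpis v2 A : star (@hpis R r u1 u2 v2 A) = @hpis R r u1 u2 v2 A.
Proof.
by rewrite /hpis !starM !star_hperm star_hpi0 ?card_le_r // invgK mulrA.
Qed.

End Star.

(** * The regular module *)

Section Model.
Variables (R : comPzRingType) (r : nat) (v1 v2 : R).

(* (A, w) indexes the basis element pi_A w *)
Definition marked_perm : finType := ({set 'I_r} * 'S_r)%type.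
Local Notation J := marked_perm.
Local Notation M := {ffun J -> R^o}.

(** Left multiplication by [T v] sends the basis element at [(B, w)] to the one at [(v^-1 B, v w)];
    so the coefficient of a product at [x] is the old coefficient at [marked_act v x]. *)
Definition marked_act (v : 'S_r) (x : J) : J := (v @: x.1, v^-1 * x.2)%g.

Lemma marked_act1 x : marked_act 1 x = x.
Proof.
rewrite /marked_act invg1 mul1g (eq_imset (g := id)) ?imset_id -?surjective_pairing //.
by move=> i; rewrite perm1.
Qed.

Lemma marked_actM v w x : marked_act v (marked_act w x) = marked_act (w * v)%g x.
Proof.
rewrite /marked_act /= -imset_comp invMg mulgA; congr (_, _).
by apply: eq_imset => i; rewrite /= permM.
Qed.

Definition mT (v : 'S_r) (f : M) : M := [ffun x => f (marked_act v x)].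

(** Vectors are coordinate functions, so this is the transpose of the rule for [hz k * hpis A]: it
    collects what arrives at [x]. New terms arrive only at sets containing [k], and a transposition
    term comes from a set that holds [l] instead of [k]. *)
Definition mz (k : 'I_r) (f : M) : M := [ffun x : J =>
  if k \in x.1 then
    v1 * f x + f (x.1 :\ k, x.2) - \sum_(l | l \notin x.1) f (marked_act (tperm k l) x)
  else v2 * f x].

Lemma mT1 f : mT 1 f = f.
Proof. by apply/ffunP => x; rewrite ffunE marked_act1. Qed.

Lemma mTM v w f : mT (v * w)%g f = mT v (mT w f).
Proof. by apply/ffunP => x; rewrite !ffunE marked_actM. Qed.

Lemma mT_lin v a f g : mT v (a *: f + g) = a *: mT v f + mT v g.
Proof. by apply/ffunP => x; rewrite !ffunE. Qed.

Lemma mz_lin k a f g : mz k (a *: f + g) = a *: mz k f + mz k g.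
Proof.
apply/ffunP => x; rewrite !ffunE; case: ifP => _.
  under eq_bigr => l do rewrite !ffunE.
  rewrite big_split /= -mulr_sumr /GRing.scale /=.
  ring.
rewrite /GRing.scale /=; ring.
Qed.


Lemma mem_imset_tperm (i j l : 'I_r) (A : {set 'I_r}) : (l \in tperm i j @: A) = (tperm i j l \in A).
Proof. by rewrite -{1}(tpermK i j l) mem_imset //; apply: perm_inj. Qed.

Lemma mT_mz v k f : mT v (mz (v k) f) = mz k (mT v f).
Proof.
have memv (l : 'I_r) (A : {set 'I_r}) : (v l \in v @: A) = (l \in A).
  by rewrite mem_imset //; apply: perm_inj.
apply/ffunP => x; rewrite !ffunE /= memv; case: ifP => // _.
congr (_ + _ - _).
  rewrite /marked_act /=; congr (f (_, _)); apply/setP => i.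
  rewrite -(permKV v i) !inE !memv !inE.
  by rewrite (inj_eq (@perm_inj _ v)).
rewrite (reindex_inj (@perm_inj _ v)) /=; apply: eq_big => [l|l _]; first by rewrite memv.
by rewrite ffunE !marked_actM tperm_conj.
Qed.

Lemma mT_mz_tperm i j k f : k != i -> k != j ->
  mT (tperm i j) (mz k f) = mz k (mT (tperm i j) f).
Proof. by move=> ki kj; rewrite -mT_mz tpermD // eq_sym. Qed.

(** The terms are grouped into parts symmetric in [i] and [j], so that in the commutator only the
    terms with [tperm i j] survive. *)
Lemma mz_mz_in f i j (A : {set 'I_r}) w : i != j -> i \in A -> j \in A ->
  mz i (mz j f) (A, w) =
    v1 * v1 * f (A, w) + (v1 * f (A :\ j, w) + v1 * f (A :\ i, w)) + f (A :\ i :\ j, w)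
    - (v1 * (\sum_(l | l \notin A) f (marked_act (tperm j l) (A, w)))
       + v1 * (\sum_(l | l \notin A) f (marked_act (tperm i l) (A, w))))
    - f (A :\ j, tperm i j * w)%g
    - ((\sum_(l | l \notin A) f (tperm j l @: (A :\ i), tperm j l * w)%g) +
       (\sum_(l | l \notin A) f (tperm i l @: (A :\ j), tperm i l * w)%g))
    + (\sum_(l | l \notin A) f (marked_act (tperm i l * tperm i j) (A, w)))
    + \sum_(l | l \notin A) \sum_(m | (m \notin A) && (m != l))
         f (marked_act (tperm i l * tperm j m) (A, w)).
Proof.
move=> ij iA jA; rewrite ffunE /= iA.
have -> : mz j f (A, w) = v1 * f (A, w) + f (A :\ j, w)
    - \sum_(l | l \notin A) f (marked_act (tperm j l) (A, w)) by rewrite ffunE /= jA.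
have -> : mz j f (A :\ i, w) = v1 * f (A :\ i, w) + f (A :\ i :\ j, w)
    - (f (A :\ j, tperm i j * w)%g
       + \sum_(l | l \notin A) f (tperm j l @: (A :\ i), tperm j l * w)%g).
  rewrite ffunE /= !inE jA eq_sym ij /=; congr (_ - _).
  (* Once removed, [i] is one of the outside entries over which [mz j] sums; its term is the one
     that brings in [tperm i j]. *)
  rewrite (bigD1 i) /=; last by rewrite !inE eqxx.
  congr (_ + _).
    rewrite /marked_act /= tpermV tpermC; congr (f (_, _)); apply/setP => l.
    rewrite mem_imset_tperm !inE; case: tpermP => [->|->|/eqP nli /eqP nlj].
    - by rewrite iA jA ij eq_sym ij.
    - by rewrite !eqxx.
    - by rewrite nli nlj.
  apply: eq_big => [l|l _]; last by rewrite /marked_act /= tpermV.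
  rewrite !inE negb_and negbK; case: eqP => [->|_] /=; first by rewrite iA.
  by rewrite andbT.
have -> : \sum_(l | l \notin A) mz j f (marked_act (tperm i l) (A, w)) =
    \sum_(l | l \notin A) (v1 * f (marked_act (tperm i l) (A, w))
      + f (tperm i l @: (A :\ j), tperm i l * w)%g
      - (f (marked_act (tperm i l * tperm i j) (A, w))
         + \sum_(m | (m \notin A) && (m != l)) f (marked_act (tperm i l * tperm j m) (A, w)))).
  apply: eq_bigr => l lA.
  have nlj : l != j by apply: contraNneq lA => ->.
  have nli : l != i by apply: contraNneq lA => ->.
  rewrite ffunE /= mem_imset_tperm tpermD // jA; congr (_ + _ - _).
    rewrite tpermV; congr (f (_, _)); apply/setP => m.
    by rewrite !(inE, mem_imset_tperm) -{2}[j](tpermD (x := i) (y := l)) // (inj_eq (@perm_inj _ _)).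
  rewrite (bigD1 i) /=; last by rewrite mem_imset_tperm tpermL.
  congr (_ + _); first by rewrite marked_actM tpermC (tpermC j i).
  apply: eq_big => [m|m _]; last by rewrite marked_actM.
  rewrite mem_imset_tperm; case: tpermP => [->|->|/eqP nmi /eqP nml].
  - by rewrite eqxx andbF iA.
  - by rewrite iA eqxx andbF.
  - by rewrite nmi nml.
rewrite sumrB !big_split /= -mulr_sumr; ring.
Qed.

(** Commutation of the [y]'s, expressed through the [z]'s. At sets without [i] and [j] both sides
    vanish; with one of them inside, only the summand exchanging the two remains; with both inside,
    [mz_mz_in] is compared with its mirror image. *)
Lemma mz_comm f i j : i != j ->
  mz i (mz j f) - mz j (mz i f) = mT (tperm i j) (mz i f - mz j f).
Proof.
move=> ij; apply/ffunP => -[A w].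
have one_in k l : k != l -> k \in A -> l \notin A ->
    (mz k (mz l f) - mz l (mz k f)) (A, w) = mT (tperm k l) (mz k f - mz l f) (A, w).
  move=> kl kA lA; rewrite !ffunE /= !mem_imset_tperm tpermL tpermR kA (negPf lA).
  rewrite !inE (negPf lA) andbF /=.
  rewrite (bigD1 l) //= [X in v2 * (_ - X)](bigD1 l) //=.
  have -> : \sum_(m | (m \notin A) && (m != l)) mz l f (marked_act (tperm k m) (A, w)) =
      \sum_(m | (m \notin A) && (m != l)) v2 * f (marked_act (tperm k m) (A, w)).
    apply: eq_bigr => m /andP[mA ml]; rewrite ffunE /= mem_imset_tperm.
    by rewrite tpermD ?(negPf lA) // eq_sym; apply: contraNneq lA => ->.
  rewrite -mulr_sumr ffunE /= mem_imset_tperm tpermR kA; ring.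
have [iA|iA] := boolP (i \in A); have [jA|jA] := boolP (j \in A).
- have sA : tperm i j @: A = A.
    by apply/setP => l; rewrite mem_imset_tperm; case: tpermP => [->|->|]; rewrite ?iA ?jA.
  rewrite [LHS]ffunE [X in _ + X]ffunE !mz_mz_in // 1?eq_sym //.
  have e1 : \sum_(l | l \notin A) f (marked_act (tperm i l * tperm i j) (A, w)) =
      \sum_(l | l \notin A) f (marked_act (tperm i j * tperm j l) (A, w)).
    apply: eq_bigr => l lA; have := tperm_conj (tperm i j) i l.
    by rewrite tpermL tpermD => [<-//||]; apply: contraNneq lA => <-.
  have e2 : \sum_(l | l \notin A) f (marked_act (tperm j l * tperm j i) (A, w)) =
      \sum_(l | l \notin A) f (marked_act (tperm i j * tperm i l) (A, w)).
    apply: eq_bigr => l lA; rewrite (tpermC j i); have := tperm_conj (tperm i j) j l.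
    by rewrite tpermR tpermD => [<-//||]; apply: contraNneq lA => <-.
  (* For distinct [l] and [m] the two transpositions are disjoint and commute, so renaming the
     indices exchanges the double sums. *)
  have e3 : \sum_(l | l \notin A) \sum_(m | (m \notin A) && (m != l))
         f (marked_act (tperm j l * tperm i m) (A, w)) =
     \sum_(l | l \notin A) \sum_(m | (m \notin A) && (m != l))
         f (marked_act (tperm i l * tperm j m) (A, w)).
    rewrite (exchange_big_dep (fun m => m \notin A)) /=; last by move=> l m _ /andP[].
    apply: eq_bigr => l lA; apply: eq_big => [m|m].
      by rewrite lA eq_sym.
    move=> /andP[mA]; rewrite lA => lm.
    have lj : l != j by apply: contraNneq lA => ->.
    have im : i != m by apply: contraNneq mA => <-.
    have := tperm_conj (tperm i l) j m; rewrite (tpermD ij lj) (tpermD im lm).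
    by move=> ->.
  rewrite e2 e3 e1 (tpermC j i) [A :\ j :\ i]setDDl [_ |: _]setUC -setDDl.
  have es k : \sum_(l | l \notin A) f (marked_act (tperm k l) (marked_act (tperm i j) (A, w))) =
     \sum_(l | l \notin A) f (marked_act (tperm i j * tperm k l) (A, w)).
    by apply: eq_bigr => l _; rewrite marked_actM.
  rewrite !ffunE /= sA iA jA tpermV !es; ring.
- exact: one_in.
- have := one_in j i; rewrite eq_sym => /(_ ij jA iA).
  rewrite -[in X in _ -> X]opprB => e; rewrite [LHS]ffunE e tpermC.
  rewrite [X in - X]ffunE [RHS]ffunE -(opprB (mz j f)); rewrite [RHS]ffunE; congr (- _).
- rewrite !ffunE /= !mem_imset_tperm tpermL tpermR (negPf iA) (negPf jA).
  by rewrite !subrr.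
Qed.

End Model.

(** * The action of the algebra on the module and the basis of the [pi_A w] *)

Section ModelAction.
Variables (R : comPzRingType) (r : nat) (u1 u2 v1 v2 : R).
Hypothesis v12 : (v1 = u1 /\ v2 = u2) \/ (v1 = u2 /\ v2 = u1).
Local Notation J := (marked_perm r).
Local Notation M := {ffun J -> R^o}.
Local Notation H := (hecke r u1 u2).
Local Notation hy := (@Defs.hy R r u1 u2).
Local Notation T := (@hperm R r u1 u2).
Local Notation hz := (@hz R r u1 u2).
Local Notation hpis := (@hpis R r u1 u2 v2).
Local Notation mT := (@mT R r).
Local Notation mz := (@mz R r v1 v2).

Definition my (k : 'I_r) (f : M) : M := mz k f + \sum_(l < r | (l < k)%N) mT (tperm l k) f.

Lemma mzD k f g : mz k (f + g) = mz k f + mz k g.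
Proof. by have := mz_lin v1 v2 k 1 f g; rewrite !scale1r. Qed.

Lemma mTD v f g : mT v (f + g) = mT v f + mT v g.
Proof. by have := mT_lin v 1 f g; rewrite !scale1r. Qed.

Lemma mz0 k : mz k 0 = 0.
Proof. by apply: (addrI (mz k 0)); rewrite -mzD !addr0. Qed.

Lemma mT0 v : mT v 0 = 0.
Proof. by apply: (addrI (mT v 0)); rewrite -mTD !addr0. Qed.

Lemma mT_sum v I (s : seq I) P (F : I -> M) :
  mT v (\sum_(i <- s | P i) F i) = \sum_(i <- s | P i) mT v (F i).
Proof. exact: (big_morph (mT v) (mTD v) (mT0 v)). Qed.

Lemma mz_sum k I (s : seq I) P (F : I -> M) :
  mz k (\sum_(i <- s | P i) F i) = \sum_(i <- s | P i) mz k (F i).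
Proof. exact: (big_morph (mz k) (mzD k) (mz0 k)). Qed.

(** [mz k f - v2 f] vanishes at sets without [k], and on such functions [mz k] is multiplication by
    [v1], because its correction terms are evaluated at sets without [k]. *)
Lemma mz_quadratic k f : mz k (mz k f) = (v1 + v2) *: mz k f - (v1 * v2) *: f.
Proof.
apply/ffunP => x; rewrite !ffunE /= /GRing.scale /=; case: ifP => [kx|kx]; last by rewrite kx; ring.
rewrite kx !inE eqxx /=.
have -> : \sum_(l | l \notin x.1) mz k f (marked_act (tperm k l) x) =
    \sum_(l | l \notin x.1) v2 * f (marked_act (tperm k l) x).
  apply: eq_bigr => l lx; rewrite ffunE /= mem_imset_tperm tpermL (negPf lx) //.
rewrite -mulr_sumr; ring.
Qed.

Lemma my_lin k a f g : my k (a *: f + g) = a *: my k f + my k g.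
Proof.
rewrite /my mz_lin scalerDr -!addrA; congr (_ + _); rewrite addrCA; congr (_ + _).
by rewrite scaler_sumr -big_split /=; apply: eq_bigr => l _; rewrite mT_lin.
Qed.

(** For [i < j] the Jucys-Murphy sums commute with each other, and [mz] commutes with transpositions
    avoiding its index; what is left over is the relation [mz_comm]. *)
Lemma myC i j f : my i (my j f) = my j (my i f).
Proof.
wlog ij : i j / (i < j)%N => [hwlog|].
  have [ij|ji|/val_inj->//] := ltngtP i j; first exact: hwlog.
  by apply/esym/hwlog.
have neij : i != j by rewrite -val_eqE /= neq_ltn ij.
rewrite /my !mzD !mz_sum.
rewrite [\sum_(l < r | _) mz i _](bigD1 i) //=.
have -> : \sum_(l < r | (l < j)%N && (l != i)) mz i (mT (tperm l j) f) =
          \sum_(l < r | (l < j)%N && (l != i)) mT (tperm l j) (mz i f).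
  by apply: eq_bigr => l /andP[lj li]; rewrite mT_mz_tperm // eq_sym.
have -> : \sum_(l < r | (l < i)%N) mz j (mT (tperm l i) f) =
          \sum_(l < r | (l < i)%N) mT (tperm l i) (mz j f).
  apply: eq_bigr => l li; rewrite mT_mz_tperm // 1?eq_sym //.
  by rewrite -val_eqE /= neq_ltn (ltn_trans li ij).
have -> : \sum_(l < r | (l < i)%N) mT (tperm l i) (mz j f + \sum_(m < r | (m < j)%N) mT (tperm m j) f) =
   \sum_(l < r | (l < i)%N) mT (tperm l i) (mz j f) +
   \sum_(m < r | (m < j)%N) mT (tperm m j) (\sum_(l < r | (l < i)%N) mT (tperm l i) f).
  under eq_bigr => l _ do rewrite mTD.
  rewrite big_split /=; congr (_ + _).
  under eq_bigr => l _ do rewrite mT_sum.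
  under [RHS]eq_bigr => l _ do rewrite mT_sum.
  rewrite [RHS]exchange_big /=; apply: eq_bigr => l li.
  (* As [l < i < j], conjugation by [tperm l i] permutes the transpositions [tperm m j] with
     [m < j]. *)
  rewrite [RHS](reindex_inj (@perm_inj _ (tperm l i))) /=; apply: eq_big => [m|m mj].
    case: tpermP => [->|->|//]; last by rewrite ij (ltn_trans li ij).
    by rewrite ij (ltn_trans li ij).
  rewrite -!mTM; congr (mT _ f).
  have := tperm_conj (tperm l i) (tperm l i m) j; rewrite tpermK (tpermD (z := j)) //.
    by rewrite -val_eqE /= neq_ltn (ltn_trans li ij).
have -> : \sum_(l < r | (l < j)%N) mT (tperm l j) (mz i f + \sum_(m < r | (m < i)%N) mT (tperm m i) f) =
   mT (tperm i j) (mz i f) + \sum_(l < r | (l < j)%N && (l != i)) mT (tperm l j) (mz i f) +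
   \sum_(m < r | (m < j)%N) mT (tperm m j) (\sum_(l < r | (l < i)%N) mT (tperm l i) f).
  under eq_bigr => l _ do rewrite mTD.
  by rewrite big_split /=; congr (_ + _); rewrite (bigD1 i).
have -> : mz i (mT (tperm i j) f) = mT (tperm i j) (mz j f).
  by rewrite -mT_mz tpermL.
have := mz_comm v1 v2 f neij.
have mTB v g h : mT v (g - h) = mT v g - mT v h.
  by apply/eqP; rewrite eq_sym subr_eq -mTD subrK.
rewrite mTB => /(canRL (subrK _)) ->.
move: (mz j (mz i f)) (mT _ (mz i f)) (mT _ (mz j f)) (\sum_(l < r | (l < i)%N) mT _ (mz j f)).
move: (\sum_(l < r | (l < j)%N && _) _) (\sum_(l < r | (l < j)%N) _) => c1 c2 c3 c4 c5 c6.
apply/ffunP => x; rewrite !ffunE; ring.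
Qed.

(** Both mixed relations follow from this one identity, since the transposition squares to 1. *)
Lemma my_hi (i : 'I_r.-1) f :
  my (ord_hi i) f = mT (tperm (ord_lo i) (ord_hi i)) (my (ord_lo i) (mT (tperm (ord_lo i) (ord_hi i)) f))
     + mT (tperm (ord_lo i) (ord_hi i)) f.
Proof.
set s := tperm _ _; rewrite /my mTD -mT_mz /s tpermL -/s mT_sum -mTM tperm2 mT1 -addrA; congr (_ + _).
rewrite (bigD1 (ord_lo i)) //= -/s addrC; congr (_ + _).
apply: eq_big => [l|l]; first by rewrite ltnS ltn_neqAle andbC -val_eqE.
move=> /andP[lti nel]; rewrite -!mTM; congr (mT _ f).
have := tperm_conj s l (ord_hi i).
rewrite /s tpermR tpermD -/s; first by move=> ->; rewrite -mulgA tperm2 mulg1.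
  by rewrite eq_sym.
by apply/eqP => e; move: lti; rewrite -e ltnn.
Qed.

Lemma mT_my i (j : 'I_r) f : j <> ord_lo i -> j <> ord_hi i ->
  mT (tperm (ord_lo i) (ord_hi i)) (my j f) = my j (mT (tperm (ord_lo i) (ord_hi i)) f).
Proof.
move=> /eqP ne1 /eqP ne2; rewrite /my mTD mT_mz_tperm // mT_sum; congr (_ + _).
rewrite [RHS](reindex_inj (@perm_inj _ (tperm (ord_lo i) (ord_hi i)))) /=.
apply: eq_big => [l|l _].
  by case: tpermP => [->|->|//] /=; move: ne1 ne2; rewrite -!val_eqE /=; lia.
rewrite -!mTM; have := tperm_conj (tperm (ord_lo i) (ord_hi i)) (tperm (ord_lo i) (ord_hi i) l) j.
by rewrite tpermK (tpermD (z := j)) 1?eq_sym // => ->.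
Qed.

Definition mgen (g : hgen r) : M -> M :=
  match g with inl i => mT (tperm (ord_lo i) (ord_hi i)) | inr j => my j end.

Fixpoint meval (x : aexpr R (hgen r)) (f : M) : M :=
  match x with
  | Cst a => a *: f
  | Gen g => mgen g f
  | Add x y => meval x f + meval y f
  | Mul x y => meval x (meval y f)
  end.

Lemma meval_lin x a f g : meval x (a *: f + g) = a *: meval x f + meval x g.
Proof.
elim: x f g => [b|[i|j]|x IHx y IHy|x IHx y IHy] f g /=.
- by rewrite scalerDr !scalerA mulrC.
- exact: mT_lin.
- exact: my_lin.
- by rewrite IHx IHy scalerDr addrACA.
- by rewrite IHy IHx.
Qed.

Lemma mevalD x f g : meval x (f + g) = meval x f + meval x g.
Proof. by have := meval_lin x 1 f g; rewrite !scale1r. Qed.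

Lemma meval0 x : meval x 0 = 0.
Proof. by apply: (addrI (meval x 0)); rewrite -mevalD !addr0. Qed.

Lemma mevalZ x a f : meval x (a *: f) = a *: meval x f.
Proof. by have := meval_lin x a f 0; rewrite meval0 !addr0. Qed.

Lemma meval_aeq x y : aeq (hecke_rel u1 u2) x y -> meval x =1 meval y.
Proof.
elim=> {x y} //=.
- move=> _ _ [] /=.
  + by move=> i f; rewrite -mTM tperm2 mT1 scale1r.
  + move=> i j ij f; rewrite -!mTM; congr (mT _ f).
    have := tperm_conj (tperm (ord_lo i) (ord_hi i)) (ord_lo j) (ord_hi j).
    by rewrite !tpermD // -val_eqE /=; lia.
  + move=> i j ij f; rewrite -!mTM; congr (mT _ f).
    have -> : ord_lo j = ord_hi i by apply: val_inj => /=; lia.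
    have neij : ord_lo i != ord_hi j by rewrite -val_eqE /=; lia.
    have nij2 : ord_hi i != ord_hi j by rewrite -val_eqE /=; lia.
    have nij3 : ord_lo i != ord_hi i by rewrite -val_eqE /=; lia.
    have e1 := tperm_conj (tperm (ord_lo i) (ord_hi i)) (ord_lo i) (ord_hi j).
    rewrite tpermL (tpermD neij nij2) in e1; rewrite e1 -mulgA tperm2 mulg1.
    have e2 := tperm_conj (tperm (ord_hi i) (ord_hi j)) (ord_lo i) (ord_hi j).
    rewrite tpermR tpermD 1?eq_sym // in e2; rewrite e2 -mulgA tperm2 mulg1 //.
  + by move=> i j f; rewrite myC.
  + by move=> i j ne1 ne2 f; rewrite mT_my.
  + by move=> i f; rewrite my_hi -!mTM tperm2 mT1 scalerDr addrA scaleN1r subrr add0r.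
  + move=> i f; rewrite my_hi mTD -!mTM tperm2 !mT1.
    by rewrite scalerDr addrA scaleN1r subrr add0r.
  + move=> j j0 f.
    have myE g : my j g = mz j g by rewrite /my big_pred0 ?addr0 // => l; rewrite j0.
    have -> : my j (my j f + -1 *: (u2 *: f)) = my j (my j f) - u2 *: my j f.
      by rewrite addrC scaleN1r -scaleNr my_lin scaleNr addrC.
    rewrite !myE mz_quadratic; move: (mz j f) => g.
    apply/ffunP => x; rewrite !ffunE /GRing.scale /=.
    by case: v12 => -[-> ->]; ring.
- by move=> x y _ e f; rewrite e.
- by move=> x y z _ e1 _ e2 f; rewrite e1 e2.
- by move=> x x' y y' _ e1 _ e2 f; rewrite e1 e2.
- by move=> x x' y y' _ e1 _ e2 f; rewrite e1 e2.
- by move=> x y z f; rewrite addrA.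
- by move=> x y f; rewrite addrC.
- by move=> x f; rewrite scale0r add0r.
- by move=> x f; rewrite scaleN1r addNr scale0r.
- by move=> x f; rewrite scale1r.
- by move=> x f; rewrite scale1r.
- by move=> x y z f; rewrite mevalD.
- by move=> a b f; rewrite scalerDl.
- by move=> a b f; rewrite scalerA.
- by move=> a x f; rewrite mevalZ.
Qed.

Definition hact (h : H) : M -> M := meval (generic_quotient.repr h).

Lemma hact_pclass x : hact (pclass _ x) =1 meval x.
Proof. by apply: meval_aeq; apply: repr_pi. Qed.

Lemma hactD x y f : hact (x + y) f = hact x f + hact y f.
Proof.
elim/pclass_ind: x => x; elim/pclass_ind: y => y.
by rewrite -pclassD !hact_pclass.
Qed.

Lemma hactM x y f : hact (x * y) f = hact x (hact y f).
Proof.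
elim/pclass_ind: x => x; elim/pclass_ind: y => y.
by rewrite -pclassM !hact_pclass.
Qed.

Lemma hact_scale1 a f : hact (a *: (1 : H)) f = a *: f.
Proof. by rewrite -pclass_cst hact_pclass. Qed.

Lemma hact1 f : hact 1 f = f.
Proof. by rewrite -[X in hact X]scale1r hact_scale1 scale1r. Qed.

Lemma hactZ a x f : hact (a *: x) f = a *: hact x f.
Proof. by rewrite -[x in LHS]mul1r hecke_scaleAl hactM hact_scale1. Qed.

Lemma hact0 f : hact 0 f = 0.
Proof. by rewrite -(scale0r (1 : H)) hact_scale1 scale0r. Qed.

Lemma hactB x y f : hact (x - y) f = hact x f - hact y f.
Proof. by rewrite -[- y]scaleN1r hactD hactZ scaleN1r. Qed.

Lemma hact_sum I (s : seq I) (P : pred I) (F : I -> H) f :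
  hact (\sum_(i <- s | P i) F i) f = \sum_(i <- s | P i) hact (F i) f.
Proof. exact: (big_morph (hact^~ f) (fun x y => hactD x y f) (hact0 f)). Qed.

Lemma hact_hperm w f : hact (T w) f = mT w f.
Proof.
rewrite -(reduced_wordK w); elim: (reduced_word w) f => [|i v IHv] f.
  by rewrite /word_perm big_nil hperm1 hact1 mT1.
rewrite /word_perm big_cons hpermM hactM mTM -/(word_perm v) IHv.
by rewrite hperm_simple hact_pclass.
Qed.

Lemma hact_hz k f : hact (hz k) f = mz k f.
Proof.
rewrite /hz hactB hact_sum [hact (hy k) f]hact_pclass /= /my.
by rewrite [X in _ - X](eq_bigr _ (fun l _ => hact_hperm (tperm l k) f)) addrK.
Qed.

Definition mdelta (x : J) : M := [ffun y => (x == y)%:R].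

(** The pair [(set0, 1%g)] stands for the element 1, so letting [h] act on its delta function
    produces the coordinates of [h]. *)
Definition hcoord (h : H) : M := hact h (mdelta (set0, 1%g)).

(** Induction on the size of [A]: [hz_hpis_notin] is solved for [hpis (k |: B)], and in the module
    the transposition terms of [mz k] cancel those added by hand. *)
Lemma hcoord_hpis A : hcoord (hpis A) = mdelta (A, 1%g).
Proof.
have [n] := ubnP #|A|; elim: n => // n IHn in A *; rewrite ltnS => leA.
have [->|[k kA]] := set_0Vmem A.
  have := hpisE u1 u2 v2 1%g (leq0n r); rewrite (_ : _ @: _ = set0).
    by move=> ->; rewrite hpi0_0 invg1 !hperm1 !mulr1 /hcoord hact1.
  by apply/setP => i; rewrite inE; apply/imsetP => -[j]; rewrite inE.
have cA := cardsD1 k A; rewrite kA add1n in cA.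
have [] := (setD1K kA, setD11 k A); move: cA; set B := A :\ k => cA eA /negbT kB.
have IHB : hcoord (hpis B) = mdelta (B, 1%g) by apply: IHn; rewrite -ltnS -cA.
have := hz_hpis_notin u1 u2 v2 kB; rewrite eA => e.
have {e} -> : hpis A = hz k * hpis B - v2 *: hpis B + \sum_(l in B) T (tperm l k) * hpis B.
  by rewrite addrAC e subrK addrC addKr.
rewrite /hcoord hactD hactB hactZ hact_sum hactM -/(hcoord _) IHB hact_hz.
have -> : \sum_(l in B) hact (T (tperm l k) * hpis B) (mdelta (set0, 1%g)) =
    \sum_(l in B) mT (tperm l k) (mdelta (B, 1%g)).
  by apply: eq_bigr => l _; rewrite hactM -/(hcoord _) IHB hact_hperm.
apply/ffunP => -[C w]; rewrite ![in LHS]ffunE sum_ffunE /=.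
have nCB : k \in C -> ((B, 1%g : 'S_r) == (C, w)) = false.
  by move=> kC; apply/eqP => -[eB _]; rewrite eB kC in kB.
case: ifP => kC.
  rewrite nCB // mulr0 add0r scaler0 oppr0 addr0.
  have -> : (((B, 1%g : 'S_r) == (C :\ k, w))%:R : R) = mdelta (A, 1%g) (C, w).
    rewrite ffunE; congr (_%:R); congr nat_of_bool; rewrite !xpair_eqE; congr (_ && _).
    apply/eqP/eqP => [eB|<-]; last by rewrite -/B.
    by rewrite -eA eB setD1K.
  rewrite -[RHS]addr0 -addrA; congr (_ + _); rewrite addrC; apply/eqP; rewrite subr_eq0; apply/eqP.
  rewrite big_mkcond [RHS]big_mkcond; apply: eq_bigr => l _; rewrite !ffunE (tpermC l k).
  have [eBC|] := eqVneq (B, 1%g : 'S_r) (marked_act (tperm k l) (C, w)); last by rewrite !if_same.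
  have memB m : (m \in B) = (tperm k l m \in C) by case: eBC => -> _; rewrite mem_imset_tperm.
  have lB : l \in B by rewrite memB tpermR.
  by move: kB; rewrite lB memB tpermL => ->.
rewrite /GRing.scale /= subrr add0r big1 ?ffunE => [|l lB].
  rewrite xpair_eqE (_ : (A == C) = false) //.
  by apply/eqP => eAC; rewrite -eAC kA in kC.
rewrite !ffunE; case: eqP => // -[eB _].
by rewrite eB mem_imset_tperm tpermL kC in lB.
Qed.

Lemma mdelta_mT v x : mT v (mdelta x) = mdelta (v^-1%g @: x.1, v * x.2)%g.
Proof.
apply/ffunP => y; rewrite !ffunE; congr (_%:R); congr nat_of_bool.
case: x y => [A w] [B w'] /=; rewrite /marked_act /= !xpair_eqE; congr (_ && _).
  apply/eqP/eqP => [->|<-].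
    by rewrite -imset_comp -[RHS]imset_id; apply: eq_imset => i /=; rewrite permK.
  by rewrite -imset_comp -[LHS]imset_id; apply: eq_imset => i /=; rewrite permKV.
by apply/eqP/eqP => [->|<-]; rewrite ?mulKVg ?mulKg.
Qed.

Definition hbasis (x : J) : H := hpis x.1 * T x.2.

Lemma hcoord_hbasis x : hcoord (hbasis x) = mdelta x.
Proof.
case: x => A w; rewrite /hbasis -hperm_hpis /hcoord hactM -/(hcoord _) hcoord_hpis /= hact_hperm.
rewrite mdelta_mT /= mulg1 -imset_comp; congr (mdelta (_, _)).
by rewrite -[RHS]imset_id; apply: eq_imset => i /=; rewrite permK.
Qed.

Lemma hcoord_lin (f : J -> R) : hcoord (\sum_x f x *: hbasis x) = [ffun x => f x].
Proof.
rewrite /hcoord hact_sum; apply/ffunP => y; rewrite sum_ffunE ffunE (bigD1 y) //=.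
rewrite hactZ -/(hcoord _) hcoord_hbasis big1 => [|x xy].
  by rewrite addr0 !ffunE eqxx /GRing.scale /= mulr1.
by rewrite hactZ -/(hcoord _) hcoord_hbasis !ffunE (negPf xy) /GRing.scale /= mulr0.
Qed.

Definition hspan (h : H) := exists f : J -> R, h = \sum_x f x *: hbasis x.

Lemma hspanD x y : hspan x -> hspan y -> hspan (x + y).
Proof.
move=> [f ->] [g ->]; exists (fun x => f x + g x).
by rewrite -big_split; apply: eq_bigr => i _; rewrite scalerDl.
Qed.

Lemma hspanZ a x : hspan x -> hspan (a *: x).
Proof.
move=> [f ->]; exists (fun x => a * f x).
by rewrite scaler_sumr; apply: eq_bigr => i _; rewrite scalerA.
Qed.

Lemma hspan0 : hspan 0.
Proof. by exists (fun=> 0); rewrite big1 // => i _; rewrite scale0r. Qed.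

Lemma hspan_sum I (s : seq I) (P : pred I) (F : I -> H) :
  (forall i, P i -> hspan (F i)) -> hspan (\sum_(i <- s | P i) F i).
Proof. by move=> PF; apply: big_ind => //; [apply: hspan0 | apply: hspanD]. Qed.

Lemma hspanB x y : hspan x -> hspan y -> hspan (x - y).
Proof. by move=> sx sy; apply: hspanD => //; rewrite -scaleN1r; apply: hspanZ. Qed.

Lemma hspan_hbasis x : hspan (hbasis x).
Proof.
exists (fun y => (y == x)%:R); rewrite (bigD1 x) //= eqxx scale1r big1 ?addr0 // => y /negPf->.
by rewrite scale0r.
Qed.

Lemma hspan_mulT v x : hspan x -> hspan (T v * x).
Proof.
move=> [f ->]; rewrite mulr_sumr; apply: hspan_sum => -[A w] _.
rewrite -hecke_scaleAr; apply: hspanZ; rewrite /hbasis mulrA /=.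
have -> : A = v @: (v^-1%g @: A).
  by rewrite -imset_comp -[LHS]imset_id; apply: eq_imset => i /=; rewrite permKV.
by rewrite hperm_hpis -mulrA -hpermM; apply: (hspan_hbasis (_, _)).
Qed.

Lemma hspan_mulz k x : hspan x -> hspan (hz k * x).
Proof.
move=> [f ->]; rewrite mulr_sumr; apply: hspan_sum => -[A w] _.
rewrite -hecke_scaleAr; apply: hspanZ; rewrite /hbasis mulrA /=.
have [kA|kA] := boolP (k \in A).
  rewrite (hz_hpis_in v12) // -hecke_scaleAl; apply: hspanZ; apply: (hspan_hbasis (_, _)).
rewrite hz_hpis_notin // mulrBl mulrDl -hecke_scaleAl; apply: hspanB; first apply: hspanD.
- by apply: hspanZ; apply: (hspan_hbasis (_, _)).
- by apply: (hspan_hbasis (_, _)).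
rewrite mulr_suml; apply: hspan_sum => l _; rewrite -mulrA; apply: hspan_mulT.
exact: (hspan_hbasis (_, _)).
Qed.

(** The span contains 1, and that it is a left ideal need only be checked on generators; [hy j] is
    split into [hz j] and transpositions. *)
Lemma hspanT h : hspan h.
Proof.
suff : forall x, hspan x -> hspan (h * x).
  move/(_ 1); rewrite mulr1; apply.
  have -> : (1 : H) = hbasis (set0, 1%g).
    rewrite /hbasis /= hperm1 mulr1 /hpis cards0 hpi0_0 mulr1 -hpermM mulVg.
    by rewrite hperm1.
  exact: hspan_hbasis.
elim/hecke_ind: h => [a|i|j|x y sx sy|x y sx sy] z sz.
- by rewrite -hecke_scaleAl mul1r; apply: hspanZ.
- by rewrite -hperm_simple; apply: hspan_mulT.
- rewrite -[hy j](subrK (\sum_(l < r | (l < j)%N) T (tperm l j))) mulrDl.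
  apply: hspanD; first exact: (hspan_mulz j).
  by rewrite mulr_suml; apply: hspan_sum => l _; apply: hspan_mulT.
- by rewrite mulrDl; apply: hspanD; [apply: sx | apply: sy].
- by rewrite -mulrA; apply: sx; apply: sy.
Qed.

Lemma hcoordK h : h = \sum_x (hcoord h x : R) *: hbasis x.
Proof.
have [f e] := hspanT h; rewrite {1}e; apply: eq_bigr => x _.
by rewrite e hcoord_lin ffunE.
Qed.

Lemma hcoord_inj : injective hcoord.
Proof. by move=> x y e; rewrite (hcoordK x) (hcoordK y) e. Qed.

Lemma hcoordZ a x : hcoord (a *: x) = a *: hcoord x.
Proof. exact: hactZ. Qed.

Lemma hcoord_sum I (s : seq I) (P : pred I) (F : I -> H) :
  hcoord (\sum_(i <- s | P i) F i) = \sum_(i <- s | P i) hcoord (F i).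
Proof. exact: hact_sum. Qed.

Lemma hcoord_mulTl v h x : hcoord (T v * h) x = hcoord h (marked_act v x).
Proof. by rewrite /hcoord hactM hact_hperm ffunE. Qed.

Lemma hcoord_mulTr v h A w : hcoord (h * T v) (A, w) = hcoord h (A, w * v^-1)%g.
Proof.
rewrite {1}[h]hcoordK mulr_suml.
have -> : \sum_x (hcoord h x : R) *: hbasis x * T v =
    \sum_x (hcoord h (x.1, x.2 * v^-1)%g : R) *: hbasis x.
  have bijf : bijective (fun x : J => (x.1, x.2 * v)%g).
    by exists (fun x : J => (x.1, x.2 * v^-1)%g) => -[B w'] /=; rewrite ?mulgK ?mulgKV.
  rewrite [RHS](reindex _ (onW_bij _ bijf)) /=; apply: eq_bigr => -[B w'] _ /=.
  by rewrite mulgK -hecke_scaleAl /hbasis -mulrA -hpermM.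
by rewrite hcoord_lin ffunE.
Qed.

End ModelAction.

(** * Cell elements and dual functionals *)

Section Positions.
Variables (r : nat) (l : bipart r).

Lemma part_le k (i j : 'I_r) : (i <= j)%N -> (part l k j <= part l k i)%N.
Proof.
case: (l) => p pP ij; rewrite /part /=; move/andP: pP => [/forallP/(_ k)/forallP/(_ i)/forallP/(_ j)].
by rewrite ij.
Qed.

Lemma card_box_rows c (i : nat) :
  #|[set b : box l | (bcomp b == c) && (brow b < i)%N]| = psum l c i.
Proof.
rewrite -(card_imset _ val_inj) -sum1_card.
transitivity (\sum_(x : bool * 'I_r | (x.1 == c) && (x.2 < i)%N)
    \sum_(j < r | (j < part l x.1 x.2)%N) 1)%N.
  rewrite pair_big_dep; apply: eq_bigl => -[[k i'] j] /=; apply/imsetP/andP.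
    by move=> [[x dx]]; rewrite inE /bcomp /brow /= => bP e; rewrite -e in dx bP.
  move=> [ci dj]; have d : in_diagram l (k, i', j) by [].
  by exists (Sub (k, i', j) d : box l); rewrite ?inE ?SubK.
have ltr (x : bool * 'I_r) : (part l x.1 x.2 <= r)%N by rewrite -ltnS ltn_ord.
under eq_bigr => x _ do rewrite -(big_ord_widen r (fun=> 1%N) (ltr x)) sum1_card card_ord.
by rewrite -(pair_big (pred1 c) (fun j : 'I_r => j < i)%N (part l)) big_pred1_eq.
Qed.

Lemma card_box : #|{: box l}| = r.
Proof.
rewrite -cardsT -[RHS](bipart_size l) -!psum_full -!card_box_rows.
rewrite -cardsUI (_ : _ :&: _ = set0) ?cards0 ?addn0.
  by apply: eq_card => b; rewrite !inE !ltn_ord !andbT; case: (bcomp b).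
by apply/setP => b; rewrite !inE; case: (bcomp b); rewrite //= andbF.
Qed.

Lemma initial_tab_inj : injective (initial_tab l).
Proof. by move=> b b'; rewrite !ffunE => /(congr1 val)/= /initial_entry_inj. Qed.

Lemma initial_tab_codom n : n \in codom (initial_tab l).
Proof.
by apply: inj_card_onto; [apply: initial_tab_inj | rewrite card_box card_ord].
Qed.

(** The box of [n] in [t^lambda]. A tableau with permutation [q] holds [n] in the box
    [pos_box (q^-1 n)], which is how rows and columns are expressed from here on. *)
Definition pos_box (n : 'I_r) : box l := iinv (initial_tab_codom n).

Lemma initial_pos_box n : initial_tab l (pos_box n) = n.
Proof. exact: f_iinv. Qed.

Lemma pos_box_initial b : pos_box (initial_tab l b) = b.
Proof. by apply: initial_tab_inj; rewrite initial_pos_box. Qed.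

Lemma pos_box_inj : injective pos_box.
Proof. exact: can_inj initial_pos_box. Qed.

Definition pos_row (n : 'I_r) : bool * 'I_r := (bcomp (pos_box n), brow (pos_box n)).
Definition pos_col (n : 'I_r) : bool * 'I_r := (bcomp (pos_box n), bcol (pos_box n)).

Lemma pos_comp n : bcomp (pos_box n) = ~~ (n < comp_size l false)%N.
Proof.
have := initial_entry_row (pos_box n).
have -> : initial_entry (pos_box n) = n by have := congr1 val (initial_pos_box n); rewrite ffunE.
case e : (bcomp _) => le_n; apply/esym; last first.
  rewrite add0n in le_n; apply/negbF/(leq_trans le_n).
  by rewrite -psum_full; apply: psum_mono.
apply/negP => lt_n; have := congr1 val (initial_pos_box n); rewrite ffunE /= /initial_entry e.
by move=> en; move: lt_n; rewrite -en -!addnA ltnNge leq_addr.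
Qed.

Lemma box_eq (b b' : box l) : bcomp b = bcomp b' -> brow b = brow b' -> bcol b = bcol b' -> b = b'.
Proof.
move=> ek ei ej; apply: val_inj; move: ek ei ej; rewrite /bcomp /brow /bcol.
by case: (val b) => [[? ?] ?]; case: (val b') => [[? ?] ?] /= -> -> ->.
Qed.

Lemma pos_row_col n m : pos_row n = pos_row m -> pos_col n = pos_col m -> n = m.
Proof. by case=> e1 e2 [_ e3]; apply: pos_box_inj; apply: box_eq. Qed.

Lemma card_pos_rows c (i : nat) :
  #|[set n | ((pos_row n).1 == c) && ((pos_row n).2 < i)%N]| = psum l c i.
Proof.
rewrite -card_box_rows -(card_imset _ pos_box_inj); apply: eq_card => b; rewrite inE.
apply/imsetP/idP => [[n]|bP]; first by rewrite inE => nP ->.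
by exists (initial_tab l b); rewrite ?inE /pos_row ?pos_box_initial.
Qed.

Lemma row_entriesE k i : row_entries l k i = [set n | pos_row n == (k, i)].
Proof.
apply/setP => n; rewrite inE; apply/imsetP/eqP => [[b] | [<- <-]].
  by rewrite inE /pos_row => /andP[/eqP<- /eqP<-] ->; rewrite pos_box_initial.
by exists (pos_box n); rewrite ?inE ?eqxx ?initial_pos_box.
Qed.

Definition block (k : bool) : {set 'I_r} := [set n | bcomp (pos_box n) == k].

Lemma row_entries_cover k : \bigcup_i row_entries l k i = block k.
Proof.
apply/setP => n; rewrite inE; apply/bigcupP/eqP => [[i _]|e].
  by rewrite row_entriesE inE => /eqP[].
by exists (brow (pos_box n)) => //; rewrite row_entriesE inE /pos_row e.
Qed.

Definition row_group (w : 'S_r) : bool := [forall n, pos_row (w n) == pos_row n].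
Definition col_group (w : 'S_r) : bool := [forall n, pos_col (w n) == pos_col n].

Lemma row_groupP (w : 'S_r) : reflect (forall n, pos_row (w n) = pos_row n) (row_group w).
Proof. by apply: (iffP forallP) => h n; apply/eqP. Qed.

Lemma col_groupP (w : 'S_r) : reflect (forall n, pos_col (w n) = pos_col n) (col_group w).
Proof. by apply: (iffP forallP) => h n; apply/eqP. Qed.

Lemma row_stabE k (w : 'S_r) : (w \in row_stab l k) = perm_on (block k) w && row_group w.
Proof.
rewrite inE row_entries_cover; case wk: (perm_on _ w) => //=.
apply/forallP/row_groupP => [h n | h i].
  have [nk|nk] := boolP (n \in block k); last by rewrite (out_perm wk).
  move: nk; rewrite inE => /eqP nk.
  have /eqP/setP/(_ (w n)) := h (brow (pos_box n)).
  rewrite row_entriesE mem_imset; last exact: perm_inj.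
  by rewrite !inE /pos_row nk eqxx => /esym/eqP.
rewrite eqEcard; apply/andP; split; last by rewrite (card_imset _ (@perm_inj _ w)).
by apply/subsetP => x /imsetP[n]; rewrite row_entriesE !inE => /eqP nP ->; rewrite h nP.
Qed.

Lemma row_group_comp (w : 'S_r) n : row_group w -> bcomp (pos_box (w n)) = bcomp (pos_box n).
Proof. by move/row_groupP/(_ n) => -[]. Qed.

Lemma col_group_comp (w : 'S_r) n : col_group w -> bcomp (pos_box (w n)) = bcomp (pos_box n).
Proof. by move/col_groupP/(_ n) => -[]. Qed.

Lemma row_group1 : row_group 1.
Proof. by apply/row_groupP => n; rewrite perm1. Qed.

Lemma col_group1 : col_group 1.
Proof. by apply/col_groupP => n; rewrite perm1. Qed.

Lemma row_groupM v w : row_group w -> row_group (v * w)%g = row_group v.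
Proof.
move/row_groupP => hw; apply/row_groupP/row_groupP => h n.
  by rewrite -(hw (v n)) -permM h.
by rewrite permM hw h.
Qed.

Lemma col_groupM v w : col_group w -> col_group (v * w)%g = col_group v.
Proof.
move/col_groupP => hw; apply/col_groupP/col_groupP => h n.
  by rewrite -(hw (v n)) -permM h.
by rewrite permM hw h.
Qed.

Lemma row_groupV w : row_group w -> row_group w^-1%g.
Proof. by move/row_groupP => h; apply/row_groupP => n; rewrite -[in RHS](permKV w n) h. Qed.

Lemma col_groupV w : col_group w -> col_group w^-1%g.
Proof. by move/col_groupP => h; apply/col_groupP => n; rewrite -[in RHS](permKV w n) h. Qed.

Lemma row_groupMl v w : row_group v -> row_group (v * w)%g = row_group w.
Proof.
move=> hv; apply/idP/idP => [h|hw]; last by rewrite row_groupM.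
by rewrite -(mulKg v w) row_groupM // row_groupV.
Qed.

Lemma col_groupMl v w : col_group v -> col_group (v * w)%g = col_group w.
Proof.
move=> hv; apply/idP/idP => [h|hw]; last by rewrite col_groupM.
by rewrite -(mulKg v w) col_groupM // col_groupV.
Qed.

Lemma row_group_tperm i j : pos_row i = pos_row j -> row_group (tperm i j).
Proof. by move=> e; apply/row_groupP => n; case: tpermP => [->|->|]. Qed.

Lemma col_group_tperm i j : pos_col i = pos_col j -> col_group (tperm i j).
Proof. by move=> e; apply/col_groupP => n; case: tpermP => [->|->|]. Qed.

Lemma row_col_trivial w : row_group w -> col_group w -> w = 1%g.
Proof.
move=> /row_groupP hr /col_groupP hc; apply/permP => n; rewrite perm1.
exact: pos_row_col.
Qed.

End Positions.

(** * Sign characters of the two components *)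

Section Signs.
Variables (R : comPzRingType) (r : nat).

Lemma odd_perm_length (w : 'S_r) : odd (coxeter_length w) = w.
Proof.
have [v /eqP vw] := reduced_word_exists w.
rewrite -[in RHS]vw -[in LHS](size_tuple v) /word_perm.
elim: (tval v) => [|i s IHs]; first by rewrite big_nil odd_perm1.
rewrite big_cons odd_permM /= IHs odd_tperm.
by have -> : ord_lo i != ord_hi i by rewrite -val_eqE /=; lia.
Qed.

(** The sign of the restriction to one component only, since the components may carry different
    characters; it is multiplicative on permutations that preserve [S]. *)
Definition sgn_on (b : bool) (S : {set 'I_r}) (w : 'S_r) : R :=
  if b then (-1) ^+ (restr_perm S w : bool) else 1.

Lemma restr_permM (S : {set 'I_r}) v w : v \in 'N(S | 'P)%g -> w \in 'N(S | 'P)%g ->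
  restr_perm S (v * w)%g = (restr_perm S v * restr_perm S w)%g.
Proof. exact: morphM. Qed.

Lemma sgn_onM b S v w : v \in 'N(S | 'P)%g -> w \in 'N(S | 'P)%g ->
  sgn_on b S (v * w)%g = sgn_on b S v * sgn_on b S w.
Proof.
case: b => vS wS; last by rewrite /sgn_on mulr1.
by rewrite /sgn_on morphM // odd_permM signr_addb.
Qed.

Lemma sgn_on1 b S : sgn_on b S 1 = 1.
Proof. by case: b; rewrite // /sgn_on morph1 odd_perm1. Qed.

Lemma restr_perm_id (S : {set 'I_r}) (w : 'S_r) : perm_on S w -> restr_perm S w = w.
Proof.
move=> wS; apply/permP => n; have [nS|nS] := boolP (n \in S).
  by rewrite restr_permE //; apply/astabsP => m; rewrite /= apermE (perm_closed _ wS).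
by rewrite (out_perm (restr_perm_on _ _)) // (out_perm wS).
Qed.

Lemma restr_perm_disjoint (S : {set 'I_r}) (w : 'S_r) : perm_on (~: S) w -> restr_perm S w = 1%g.
Proof.
move=> wS; apply/permP => n; rewrite perm1; have [nS|nS] := boolP (n \in S).
  rewrite restr_permE //; first by rewrite (out_perm wS) // inE nS.
  apply/astabsP => m /=; rewrite apermE.
  by have := perm_closed m wS; rewrite !inE => /(congr1 negb); rewrite !negbK.
by rewrite (out_perm (restr_perm_on _ _)).
Qed.

Lemma tperm_on_set (S : {set 'I_r}) i j : i \in S -> j \in S -> perm_on S (tperm i j).
Proof.
move=> iS jS; apply/subsetP => n; rewrite inE; case: tpermP => [->|->|] //.
by rewrite eqxx.
Qed.

Lemma sgn_on_tperm b (S : {set 'I_r}) i j : i != j -> i \in S -> j \in S ->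
  sgn_on b S (tperm i j) = (-1) ^+ b.
Proof.
move=> ij iS jS; rewrite /sgn_on; case: b => //.
by rewrite restr_perm_id ?odd_tperm ?ij //; apply: tperm_on_set.
Qed.

Lemma sgn_on_tperm_out b (S : {set 'I_r}) i j : i \notin S -> j \notin S ->
  sgn_on b S (tperm i j) = 1.
Proof.
move=> iS jS; rewrite /sgn_on; case: b => //.
by rewrite restr_perm_disjoint ?odd_perm1 //; apply: tperm_on_set; rewrite inE.
Qed.

Variables (e : bool -> bool) (l : bipart r).

Definition block_preserving (w : 'S_r) :=
  forall n, bcomp (pos_box l (w n)) = bcomp (pos_box l n).

Lemma block_preservingM v w : block_preserving v -> block_preserving w -> block_preserving (v * w)%g.
Proof. by move=> hv hw n; rewrite permM hw hv. Qed.

Lemma block_preserving_stab w k : block_preserving w -> w \in 'N(block l k | 'P)%g.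
Proof. by move=> wl; apply/astabsP => n; rewrite !inE /= apermE wl. Qed.

Definition sgn_char (w : 'S_r) : R :=
  sgn_on (e false) (block l false) w * sgn_on (e true) (block l true) w.

Lemma sgn_charM v w : block_preserving v -> block_preserving w ->
  sgn_char (v * w)%g = sgn_char v * sgn_char w.
Proof.
move=> hv hw; rewrite /sgn_char !sgn_onM ?block_preserving_stab //.
by rewrite mulrACA.
Qed.

Lemma sgn_char1 : sgn_char 1 = 1.
Proof. by rewrite /sgn_char !sgn_on1 mulr1. Qed.

Lemma sgn_char_tperm i j : i != j -> bcomp (pos_box l i) = bcomp (pos_box l j) ->
  sgn_char (tperm i j) = (-1) ^+ e (bcomp (pos_box l i)).
Proof.
move=> ij eij; rewrite /sgn_char.
case ei : (bcomp (pos_box l i)).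
  by rewrite sgn_on_tperm_out ?sgn_on_tperm ?mul1r // inE -?eij ei.
by rewrite sgn_on_tperm ?sgn_on_tperm_out ?mulr1 // inE -?eij ei.
Qed.

Lemma row_group_block w : row_group l w -> block_preserving w.
Proof. by move=> hw n; apply: row_group_comp. Qed.

Lemma col_group_block w : col_group l w -> block_preserving w.
Proof. by move=> hw n; apply: col_group_comp. Qed.

Lemma block_setC k : ~: block l k = block l (~~ k).
Proof. by apply/setP => n; rewrite !inE; case: k; case: bcomp. Qed.

Lemma row_stab_restr w : row_group l w ->
  [/\ restr_perm (block l false) w \in row_stab l false,
      restr_perm (block l true) w \in row_stab l true &
      (restr_perm (block l false) w * restr_perm (block l true) w)%g = w].
Proof.
move=> hw; have hb := row_group_block hw; have /row_groupP hr := hw.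
have fixN k n : n \in block l k -> restr_perm (block l k) w n = w n.
  by move=> nk; rewrite restr_permE // block_preserving_stab.
have fixO k n : n \notin block l k -> restr_perm (block l k) w n = n.
  by move=> nk; rewrite (out_perm (restr_perm_on _ _)).
have in_stab k : restr_perm (block l k) w \in row_stab l k.
  rewrite row_stabE restr_perm_on; apply/row_groupP => n.
  have [nk|nk] := boolP (n \in block l k); last by rewrite fixO.
  by rewrite fixN // hr.
split=> //; apply/permP => n; rewrite permM.
have [n0|n0] := boolP (n \in block l false).
  by rewrite (fixN false) // (fixO true) // inE hb; move: n0; rewrite inE => /eqP->.
rewrite (fixO false) // (fixN true) //; move: n0; rewrite !inE; case: bcomp => //.
Qed.

End Signs.

Section CellElements.
Variables (R : comPzRingType) (r : nat) (u1 u2 v1 v2 : R).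
Hypothesis v12 : (v1 = u1 /\ v2 = u2) \/ (v1 = u2 /\ v2 = u1).
Variable e : bool -> bool.
Local Notation H := (hecke r u1 u2).
Local Notation T := (@hperm R r u1 u2).
Local Notation hpi0 := (@hpi0 R r u1 u2 v2).
Local Notation hpis := (@hpis R r u1 u2 v2).
Local Notation hbasis := (@hbasis R r u1 u2 v2).
Local Notation hcoord := (@hcoord R r u1 u2 v1 v2).
Local Notation chi := (sgn_char R e).

Definition hrow (b : bool) (l : bipart r) (k : bool) : H :=
  \sum_(w in row_stab l k) (if b then (-1) ^+ coxeter_length w else 1 : R) *: T w.

Lemma hrow_hx l k : hx u1 u2 l k = hrow false l k.
Proof. by apply: eq_bigr => w _; rewrite scale1r. Qed.

Lemma hrow_hxsgn l k : hxsgn u1 u2 l k = hrow true l k.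
Proof. by []. Qed.

Definition hrows (l : bipart r) : H := \sum_(w | row_group l w) chi l w *: T w.

(** A row-preserving permutation is uniquely the product of its restrictions to the two components,
    and on each the sign is the parity of [coxeter_length]. *)
Lemma hrow_mul l : hrow (e false) l false * hrow (e true) l true = hrows l.
Proof.
have sgE b k (w : 'S_r) : w \in row_stab l k ->
    (if b then (-1) ^+ coxeter_length w else 1 : R) = sgn_on R b (block l k) w.
  rewrite row_stabE => /andP[wk _]; rewrite /sgn_on; case: b => //.
  by rewrite restr_perm_id // -odd_perm_length signr_odd.
rewrite /hrow mulr_suml; under eq_bigr => w _ do rewrite mulr_sumr.
rewrite pair_big /=.
pose h (w : 'S_r) := (restr_perm (block l false) w, restr_perm (block l true) w).
pose h' (p : 'S_r * 'S_r) := (p.1 * p.2)%g.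
rewrite (reindex_onto h h') /=; last first.
  move=> [w1 w2] /= /andP[]; rewrite !row_stabE => /andP[w1k r1] /andP[w2k r2].
  have hb : block_preserving l (w1 * w2)%g.
    by apply: block_preservingM; apply: row_group_block.
  have b1 := row_group_block r1; have b2 := row_group_block r2.
  rewrite /h /h' /= !restr_permM ?block_preserving_stab //.
  rewrite (restr_perm_id w1k) (restr_perm_id w2k) !restr_perm_disjoint ?mulg1 ?mul1g //.
    by rewrite block_setC.
  by rewrite block_setC.
apply: eq_big => [w|w /andP[/andP[w1 w2] /eqP ew]].
  apply/idP/idP => [/andP[/andP[w1 w2] /eqP <-]|hw].
    move: w1 w2; rewrite !row_stabE => /andP[_ r1] /andP[_ r2].
    by rewrite /h' row_groupM.
  by have [-> -> ew] := row_stab_restr hw; rewrite /h' /h /= ew eqxx.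
rewrite (sgE _ _ _ w1) (sgE _ _ _ w2) -hecke_scaleAl -hecke_scaleAr scalerA -hpermM.
rewrite -[X in T X]/(h' (h w)) ew; congr (_ *: _).
by rewrite /sgn_char /sgn_on !(restr_perm_id (restr_perm_on _ _)).
Qed.

Definition hcell (l : bipart r) (p q : 'S_r) : H :=
  T p^-1%g * hpi0 (comp_size l false) * hrows l * T q.

Lemma comp_size_le (l : bipart r) : (comp_size l false <= r)%N.
Proof. by apply: leq_trans (leq_addr (comp_size l true) _) _; rewrite bipart_size. Qed.

Lemma hpis_initial a : (a <= r)%N -> hpis (initial_set r a) = hpi0 a.
Proof.
move=> ar; have := hpisE u1 u2 v2 1%g ar; rewrite invg1 hperm1 mul1r mulr1 => <-.
by congr hpis; rewrite (eq_imset (g := id)) ?imset_id // => i; rewrite perm1.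
Qed.

Lemma hcoord_sum_hbasis (P : pred 'S_r) (A : 'S_r -> {set 'I_r}) (c : 'S_r -> R) B w :
  hcoord (\sum_(v | P v) c v *: hbasis (A v, v)) (B, w) = (if P w && (A w == B) then c w else 0).
Proof.
rewrite (hcoord_sum v12) sum_ffunE.
have [Pw|nPw] := boolP (P w) => /=; last first.
  rewrite big1 // => v Pv; rewrite (hcoordZ v12) (hcoord_hbasis v12) !ffunE.
  rewrite xpair_eqE (_ : (v == w) = false) ?andbF /GRing.scale /= ?mulr0 //.
  by apply: contraNF nPw => /eqP <-.
rewrite (bigD1 w) //= big1 => [|v /andP[Pv vw]]; last first.
  by rewrite (hcoordZ v12) (hcoord_hbasis v12) !ffunE xpair_eqE (negPf vw) andbF /GRing.scale /= mulr0.
rewrite addr0 (hcoordZ v12) (hcoord_hbasis v12) !ffunE xpair_eqE eqxx andbT /GRing.scale /=.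
by case: ifP; rewrite ?mulr1 ?mulr0.
Qed.

Lemma hcoord_hcell l p q A w : hcoord (hcell l p q) (A, w) =
  (if row_group l (p * w * q^-1)%g && (p @: initial_set r (comp_size l false) == A)
   then chi l (p * w * q^-1)%g else 0).
Proof.
rewrite /hcell (hcoord_mulTr v12) -mulrA -(hpis_initial (comp_size_le l)) (hcoord_mulTl v12).
have -> : hpis (initial_set r (comp_size l false)) * hrows l =
   \sum_(v | row_group l v) chi l v *: hbasis (initial_set r (comp_size l false), v).
  by rewrite mulr_sumr; apply: eq_bigr => v _; rewrite -hecke_scaleAr.
rewrite /marked_act invgK hcoord_sum_hbasis /= !mulgA; congr (if _ && _ then _ else _).
apply/eqP/eqP => [->|<-]; rewrite -imset_comp.
  by rewrite -[RHS]imset_id; apply: eq_imset => i /=; rewrite permKV.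
by rewrite -[LHS]imset_id; apply: eq_imset => i /=; rewrite permK.
Qed.

(* the part of x_lambda y_m with a new box m in the first component *)
Definition hcell_up (l : bipart r) (m : 'I_r) : H :=
  hrows l * hpis (m |: initial_set r (comp_size l false)).

Lemma hcoord_hcell_up l m A w : hcoord (hcell_up l m) (A, w) =
  (if row_group l w && (w @: A == m |: initial_set r (comp_size l false)) then chi l w else 0).
Proof.
set B := _ |: _.
have -> : hcell_up l m = \sum_(v | row_group l v) chi l v *: hbasis (v^-1%g @: B, v).
  rewrite /hcell_up mulr_suml; apply: eq_bigr => v _; rewrite -hecke_scaleAl /hbasis /=.
  congr (_ *: _); rewrite -hperm_hpis -/B; congr (_ * hpis _).
  by rewrite -imset_comp -[LHS]imset_id; apply: eq_imset => i /=; rewrite permKV.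
rewrite hcoord_sum_hbasis; congr (if _ && _ then _ else _).
apply/eqP/eqP => [<-|<-]; rewrite -imset_comp.
  by rewrite -[RHS]imset_id; apply: eq_imset => i /=; rewrite permKV.
by rewrite -[RHS]imset_id; apply: eq_imset => i /=; rewrite permK.
Qed.

End CellElements.

(** * Column functionals and cancellation *)

Section DualFunctionals.
Variables (R : comPzRingType) (r : nat) (e : bool -> bool).
Local Notation J := (marked_perm r).
Local Notation M := {ffun J -> R^o}.
Local Notation chiN := (sgn_char R (fun k => ~~ e k)).

Definition dual (l : bipart r) (p q : 'S_r) (f : M) : R :=
  \sum_(w | col_group l (p * w * q^-1)%g)
     chiN l (p * w * q^-1)%g * f (p @: initial_set r (comp_size l false), w).

(** That the sum equals its own negative would not suffice when 2 is a zero divisor; the terms are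
    paired off by which of [i] and [j] has the smaller preimage. *)
Lemma sum_flip_r (i j : 'I_r) (G : 'S_r -> R) : i != j ->
  (forall w, G (w * tperm i j)%g = - G w) -> \sum_w G w = 0.
Proof.
move=> ij Gt; rewrite (bigID (fun w : 'S_r => (w^-1%g i < w^-1%g j)%N)) /=.
rewrite [X in _ + X](reindex_inj (mulIg (tperm i j))) /=.
rewrite [X in _ + X](eq_bigl (fun w : 'S_r => (w^-1%g i < w^-1%g j)%N)); last first.
  move=> w; rewrite invMg tpermV !permM tpermL tpermR -leqNgt leq_eqVlt.
  by rewrite (inj_eq val_inj) (inj_eq perm_inj) (negPf ij).
by rewrite (eq_bigr _ (fun w _ => Gt w)) sumrN subrr.
Qed.

Lemma sum_flip_l (i j : 'I_r) (G : 'S_r -> R) : i != j ->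
  (forall w, G (tperm i j * w)%g = - G w) -> \sum_w G w = 0.
Proof.
move=> ij Gt; rewrite (reindex_inj invg_inj) /=; apply: (sum_flip_r ij) => w.
by rewrite invMg tpermV Gt.
Qed.

Lemma conj_tperm (q : 'S_r) i j : (q * tperm i j * q^-1 = tperm (q^-1 i) (q^-1 j))%g.
Proof. by rewrite -tpermJ /conjg invgK mulgA. Qed.

Lemma sign_flip (b : bool) (x y : R) :
  x * (-1) ^+ (~~ b) * ((-1) ^+ b * y) = - (x * y).
Proof. by case: b; rewrite /= !expr0 !expr1; ring. Qed.

(** Exchanging two entries of one column multiplies the column sign by [(-1) ^+ (~~ e k)] and, by
    hypothesis, the values of [f] by [(-1) ^+ e k]. The product is -1 for either value of [e k],
    which is the purpose of the negated pattern. *)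
Lemma dual_flip_r l (p q : 'S_r) (f : M) (i j : 'I_r) : i != j ->
    pos_col l (q^-1%g i) = pos_col l (q^-1%g j) ->
    (forall w, col_group l (p * w * q^-1)%g ->
       f (p @: initial_set r (comp_size l false), w * tperm i j)%g =
       (-1) ^+ e (bcomp (pos_box l (q^-1%g i))) *
       f (p @: initial_set r (comp_size l false), w)) ->
  dual l p q f = 0.
Proof.
move=> ij eij ft; rewrite /dual big_mkcond; apply: (sum_flip_r ij) => w.
have -> : (p * (w * tperm i j) * q^-1 = p * w * q^-1 * tperm (q^-1 i) (q^-1 j))%g.
  by rewrite -conj_tperm !mulgA mulgKV.
have ct := col_group_tperm eij.
rewrite col_groupM //; case: ifP => cw; last by rewrite oppr0.
rewrite sgn_charM; [|exact: col_group_block|exact: col_group_block].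
rewrite ft // sgn_char_tperm ?(inj_eq perm_inj) //; last by case: eij.
exact: sign_flip.
Qed.

Lemma dual_flip_l l (p q : 'S_r) (f : M) (i j : 'I_r) : i != j ->
    pos_col l (p^-1%g i) = pos_col l (p^-1%g j) ->
    (forall w, col_group l (p * w * q^-1)%g ->
       f (p @: initial_set r (comp_size l false), tperm i j * w)%g =
       (-1) ^+ e (bcomp (pos_box l (p^-1%g i))) *
       f (p @: initial_set r (comp_size l false), w)) ->
  dual l p q f = 0.
Proof.
move=> ij eij ft; rewrite /dual big_mkcond; apply: (sum_flip_l ij) => w.
have -> : (p * (tperm i j * w) * q^-1 = tperm (p^-1 i) (p^-1 j) * (p * w * q^-1))%g.
  by rewrite -conj_tperm !mulgA mulgKV.
have ct := col_group_tperm eij.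
rewrite col_groupMl //; case: ifP => cw; last by rewrite oppr0.
rewrite sgn_charM; [|exact: col_group_block|exact: col_group_block].
rewrite ft // sgn_char_tperm ?(inj_eq perm_inj) //; last by case: eij.
by rewrite [X in X * _]mulrC; apply: sign_flip.
Qed.

End DualFunctionals.

Section Separation.
Variables (R : comPzRingType) (r : nat) (u1 u2 v1 v2 : R).
Hypothesis v12 : (v1 = u1 /\ v2 = u2) \/ (v1 = u2 /\ v2 = u1).
Variable e : bool -> bool.
Local Notation M := {ffun marked_perm r -> R^o}.
Local Notation hcoord := (@hcoord R r u1 u2 v1 v2).
Local Notation hcell := (@hcell R r u1 u2 v2 e).
Local Notation hcell_up := (@hcell_up R r u1 u2 v2 e).
Local Notation dual := (@dual R r e).

Lemma mem_block_image (l : bipart r) (p : 'S_r) n :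
  (n \in p @: initial_set r (comp_size l false)) = ~~ bcomp (pos_box l (p^-1%g n)).
Proof.
by rewrite -{1}(permKV p n) mem_imset ?mem_initial_set ?pos_comp ?negbK //; apply: perm_inj.
Qed.

Lemma dual_neq0 l (p q : 'S_r) (f : M) : dual l p q f != 0 ->
  exists2 w, col_group l (p * w * q^-1)%g & f (p @: initial_set r (comp_size l false), w) != 0.
Proof.
move=> nz; suff /existsP[w /andP[cw fw]] : [exists w : 'S_r, col_group l (p * w * q^-1)%g
    && (f (p @: initial_set r (comp_size l false), w) != 0)] by exists w.
apply: contraNT nz; rewrite negb_exists => /forallP h; apply/eqP.
rewrite /dual big1 // => w cw; have := h w; rewrite cw /= negbK => /eqP ->.
by rewrite mulr0.
Qed.

Definition separated l' (q' : 'S_r) l (q : 'S_r) := forall i j,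
  pos_row l' (q'^-1%g i) = pos_row l' (q'^-1%g j) ->
  pos_col l (q^-1%g i) = pos_col l (q^-1%g j) -> i = j.

Lemma dual_hcell l' (p' q' : 'S_r) l (p q : 'S_r) : dual l p q (hcoord (hcell l' p' q')) != 0 ->
  [/\ forall n, bcomp (pos_box l' (p'^-1%g n)) = bcomp (pos_box l (p^-1%g n)),
      forall n, bcomp (pos_box l' (q'^-1%g n)) = bcomp (pos_box l (q^-1%g n)),
      separated l' p' l p & separated l' q' l q].
Proof.
move=> nz; have [w cw] := dual_neq0 nz.
rewrite (hcoord_hcell v12); case: ifP => [/andP[rw /eqP eA] _|]; last by rewrite eqxx.
(* A common set component forces agreement on the left; it passes to the right through [w], which
   respects the components for both shapes. *)
have hp n : bcomp (pos_box l' (p'^-1%g n)) = bcomp (pos_box l (p^-1%g n)).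
  by apply: negb_inj; rewrite -!mem_block_image eA.
have hq n : bcomp (pos_box l' (q'^-1%g n)) = bcomp (pos_box l (q^-1%g n)).
  have := row_group_comp (p'^-1%g (w^-1%g n)) rw.
  have := col_group_comp (p^-1%g (w^-1%g n)) cw.
  by rewrite !permM !permKV => -> ->; apply: hp.
split=> // i j er ec; apply/eqP; apply: contraNT nz => ij; apply/eqP.
  apply: (dual_flip_l ij ec) => w' cw'; rewrite !(hcoord_hcell v12) eA eqxx !andbT.
  have -> : (p' * (tperm i j * w') * q'^-1 = tperm (p'^-1 i) (p'^-1 j) * (p' * w' * q'^-1))%g.
    by rewrite -conj_tperm !mulgA mulgKV.
  have rt := row_group_tperm er; rewrite row_groupMl //; case: ifP => rw'; last by rewrite mulr0.
  rewrite sgn_charM; [|exact: row_group_block|exact: row_group_block].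
  by rewrite sgn_char_tperm ?(inj_eq perm_inj) ?hp //; case: er; rewrite !hp.
apply: (dual_flip_r ij ec) => w' cw'; rewrite !(hcoord_hcell v12) eA eqxx !andbT.
have -> : (p' * (w' * tperm i j) * q'^-1 = p' * w' * q'^-1 * tperm (q'^-1 i) (q'^-1 j))%g.
  by rewrite -conj_tperm !mulgA mulgKV.
have rt := row_group_tperm er; rewrite row_groupM //; case: ifP => rw'; last by rewrite mulr0.
rewrite sgn_charM; [|exact: row_group_block|exact: row_group_block].
by rewrite mulrC sgn_char_tperm ?(inj_eq perm_inj) ?hq //; case: er; rewrite !hq.
Qed.

(** The enlarged set moves the entry [m] from the second component to the first. Only the right-hand
    index is compared, which is enough to compare shapes. *)
Lemma dual_hcell_up l' (m : 'I_r) l (p q : 'S_r) : (comp_size l' false <= m)%N ->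
  dual l p q (hcoord (hcell_up l' m)) != 0 ->
  (forall n, ~~ bcomp (pos_box l (q^-1%g n)) = (n == m) || (n < comp_size l' false)%N) /\
  separated l' 1 l q.
Proof.
move=> am nz; have [w cw] := dual_neq0 nz.
rewrite (hcoord_hcell_up v12); case: ifP => [/andP[rw /eqP eA] _|]; last by rewrite eqxx.
set B := m |: initial_set r (comp_size l' false) in eA.
have hB n : ~~ bcomp (pos_box l (q^-1%g n)) = (n == m) || (n < comp_size l' false)%N.
  have := col_group_comp (p^-1%g (w^-1%g n)) cw; rewrite !permM !permKV => ->.
  rewrite -mem_block_image -(mem_imset _ _ (@perm_inj _ w)) permKV eA !inE.
  by [].
split=> // i j; rewrite invg1 !perm1 => er ec; apply/eqP; apply: contraNT nz => ij; apply/eqP.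
have ecl : bcomp (pos_box l (q^-1%g i)) = bcomp (pos_box l (q^-1%g j)) by case: ec.
have ecr : bcomp (pos_box l' i) = bcomp (pos_box l' j) by case: er.
(* The components could differ only for the moved entry [m]; since [j] lies in the same components
   as [i], it would then be [m] too. *)
have hi : bcomp (pos_box l' i) = bcomp (pos_box l (q^-1%g i)).
  have hBi := hB i; have hBj := hB j; rewrite -ecl in hBj.
  have ci := pos_comp l' i; have cj := pos_comp l' j; rewrite -ecr in cj.
  rewrite ci; rewrite ci in cj; apply/negb_inj; rewrite negbK hBi.
  move: hBj; rewrite hBi; rewrite -(negb_inj cj).
  case: (i < _)%N; rewrite ?orbT ?orbF //.
  case: eqP => // im; case: eqP => // jm _.
  by rewrite im jm eqxx in ij.
have tB : tperm i j @: B = B.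
  apply/setP => n; rewrite mem_imset_tperm !inE -!hB; case: tpermP => [->|->|] //.
    by rewrite ecl.
  by rewrite ecl.
apply: (dual_flip_r ij ec) => w' cw'; rewrite !(hcoord_hcell_up v12) -/B.
have rt := row_group_tperm er; rewrite row_groupM //.
have -> : ((w' * tperm i j)%g @: (p @: initial_set r (comp_size l false)) == B) =
          (w' @: (p @: initial_set r (comp_size l false)) == B).
  rewrite -{1}tB (eq_imset (g := tperm i j \o w')); last by move=> n; rewrite permM.
  by rewrite imset_comp (inj_eq (imset_inj (@perm_inj _ _))).
case: ifP => [/andP[rw' _]|]; last by rewrite mulr0.
rewrite sgn_charM; [|exact: row_group_block|exact: row_group_block].
by rewrite mulrC sgn_char_tperm // hi.
Qed.

End Separation.

(** * Dominance *)

Section Counting.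
Variable r : nat.

Definition row_at (l : bipart r) (p : 'S_r) (n : 'I_r) : bool * 'I_r := pos_row l (p^-1%g n).

(** Partial sums of the shape formed by the entries below [k], one component at a time; comparing
    them for all arguments is a strong form of dominance of tableaux. *)
Definition rows_count (g : 'I_r -> bool * 'I_r) (k : nat) (c : bool) (i : nat) :=
  #|[set n : 'I_r | [&& (n < k)%N, (g n).1 == c & ((g n).2 < i)%N]]|.

Lemma rows_count_psum l p c i : rows_count (row_at l p) r c i = psum l c i.
Proof.
rewrite -card_pos_rows -(card_imset _ (@perm_inj _ p)); apply: eq_card => n.
rewrite -(permKV p n) mem_imset; last exact: perm_inj.
by rewrite !inE ltn_ord /row_at permK.
Qed.

Variable l : bipart r.

Section Standard.
Variable v : stdtab l.

Definition tbox (n : 'I_r) : box l := pos_box l ((tab_perm v)^-1%g n).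

Lemma tab_tbox n : val v (tbox n) = n.
Proof. by rewrite -(tab_permP v) ffunE initial_pos_box permKV. Qed.

Lemma tbox_tab b : tbox (val v b) = b.
Proof. by rewrite /tbox -(tab_permP v) ffunE permK pos_box_initial. Qed.

Lemma tab_row_lt b b' : bcomp b = bcomp b' -> brow b = brow b' -> (bcol b < bcol b')%N ->
  (val v b < val v b')%N.
Proof.
move=> e1 e2 lt_b; have /and3P[_ /forallP/(_ b)/forallP/(_ b')/implyP h _] := valP v.
by apply: h; rewrite e1 e2 !eqxx.
Qed.

Lemma tab_col_lt b b' : bcomp b = bcomp b' -> bcol b = bcol b' -> (brow b < brow b')%N ->
  (val v b < val v b')%N.
Proof.
move=> e1 e2 lt_b; have /and3P[_ _ /forallP/(_ b)/forallP/(_ b')/implyP h] := valP v.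
by apply: h; rewrite e1 e2 !eqxx.
Qed.

Lemma box_above (b : box l) (i : 'I_r) : (i <= brow b)%N ->
  exists b' : box l, [/\ bcomp b' = bcomp b, brow b' = i & bcol b' = bcol b].
Proof.
move=> le_i; have d : in_diagram l (bcomp b, i, bcol b).
  by apply: leq_trans (part_le l _ le_i); apply: (valP b).
by exists (Sub (bcomp b, i, bcol b) d : box l).
Qed.

(** Work column by column. If some [n] of the set lies at row [i] or further down, standardness puts
    entries below [k] in all boxes above it, and sending each [n] of that column to the entry in row
    [rho n] is injective by hypothesis. Otherwise the column can stay as it is. *)
Lemma std_count (S : {set 'I_r}) (rho : 'I_r -> 'I_r) k c i :
    (forall n, n \in S -> [/\ (n < k)%N, bcomp (tbox n) = c & (rho n < i)%N]) ->
    (forall n m, n \in S -> m \in S -> rho n = rho m -> bcol (tbox n) = bcol (tbox m) -> n = m) ->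
  (#|S| <= rows_count (row_at l (tab_perm v)) k c i)%N.
Proof.
move=> hS injS; rewrite /rows_count; set V := [set n | _].
rewrite -!sum1_card (partition_big (fun n => bcol (tbox n)) predT) //=.
rewrite [leqRHS](partition_big (fun n => bcol (tbox n)) predT) //=.
apply: leq_sum => j _; rewrite !sum1dep_card.
set Sj := [set n | (n \in S) && _]; set Vj := [set n | (n \in V) && _].
have [sub|/subsetPn[n0]] := boolP (Sj \subset Vj); first exact: subset_leq_card.
rewrite !inE => /andP[n0S /eqP n0j]; rewrite n0j eqxx andbT.
have [n0k n0c _] := hS _ n0S; rewrite n0k -/(tbox n0) /= n0c eqxx /= -leqNgt => le_i.
have above n : n \in Sj -> exists2 m, m \in Vj & brow (tbox m) = rho n.
  rewrite !inE => /andP[nS nj]; have [_ _ lt_i] := hS _ nS.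
  have lt0 := leq_trans lt_i le_i.
  have [b [bc br bj]] := box_above (ltnW lt0).
  exists (val v b); last by rewrite tbox_tab.
  have bk : (val v b < k)%N.
    apply: ltn_trans n0k; rewrite -(tab_tbox n0).
    by apply: tab_col_lt => //; rewrite br.
  by rewrite !inE bk /row_at /pos_row -/(tbox _) tbox_tab /= bc br bj n0c n0j !eqxx lt_i.
pose phi n := odflt n [pick m | (m \in Vj) && (brow (tbox m) == rho n)].
have phiP n : n \in Sj -> phi n \in Vj /\ brow (tbox (phi n)) = rho n.
  move=> nS; rewrite /phi; case: pickP => [m /andP[mV /eqP]|no] //=.
  by have [m mV mr] := above n nS; have := no m; rewrite mV mr eqxx.
have injphi : {in Sj &, injective phi}.
  move=> n m nS mS ephi; have [_ en] := phiP n nS; have [_ em] := phiP m mS.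
  move: nS mS; rewrite !inE => /andP[nS /eqP nj] /andP[mS /eqP mj].
  by apply: injS; rewrite ?nj ?mj // -en -em ephi.
rewrite -(card_in_image injphi); apply/subset_leq_card/subsetP => m /imageP[n nS ->].
by have [] := phiP n nS.
Qed.

End Standard.

End Counting.

(** * The order on pairs of standard tableaux *)

Section TableauOrder.
Variable r : nat.

Lemma rows_countS (g : 'I_r -> bool * 'I_r) (n : 'I_r) c i :
  rows_count g n.+1 c i = (rows_count g n c i + (((g n).1 == c) && ((g n).2 < i)%N))%N.
Proof.
rewrite /rows_count (cardsD1 n) !inE ltnSn /= addnC; congr (_ + _)%N.
apply: eq_card => m; rewrite !inE ltnS [in RHS]ltn_neqAle -val_eqE.
by case: (val m == n).
Qed.

Lemma rows_count_inj (g g' : 'I_r -> bool * 'I_r) :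
  (forall k c i, (k <= r)%N -> (i <= r)%N -> rows_count g k c i = rows_count g' k c i) -> g =1 g'.
Proof.
move=> egg n.
have h c i : (i <= r)%N -> ((g n).1 == c) && ((g n).2 < i)%N = ((g' n).1 == c) && ((g' n).2 < i)%N.
  move=> ir; have := egg n.+1 c i (ltn_ord n) ir; rewrite !rows_countS.
  rewrite (egg n c i (ltnW (ltn_ord n)) ir) => /addnI.
  by do 2!case: andP.
have := h (g n).1 (g n).2.+1 (ltn_ord _); rewrite eqxx ltnSn => /esym/andP[/eqP e1 le1].
have := h (g' n).1 (g' n).2.+1 (ltn_ord _); rewrite eqxx ltnSn => /andP[_ le2].
move: e1 le1 le2; case: (g n) (g' n) => [c i] [c' i'] /= -> le1 le2.
by congr (_, _); apply: val_inj; apply/eqP; rewrite eqn_leq; apply/andP; split.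
Qed.

Lemma psum_dominated (l m : bipart r) : (forall c i, (i <= r)%N -> psum l c i <= psum m c i)%N ->
  dominated l m.
Proof.
move=> lm; apply/forallP => i; have ir : (i <= r)%N by rewrite -ltnS.
by rewrite -!psum_full; apply/andP; split; [exact: lm | apply: leq_add; exact: lm].
Qed.

Lemma row_at_shape (l l' : bipart r) (p p' : 'S_r) : row_at l p =1 row_at l' p' -> l = l'.
Proof.
move=> e; have ep c i : psum l c i = psum l' c i.
  rewrite -(rows_count_psum l p) -(rows_count_psum l' p'); apply: eq_card => n.
  by rewrite !inE e.
by apply: dominated_anti; apply/andP; split; apply: psum_dominated => c i _; rewrite ep.
Qed.

Section SameShape.
Variable l : bipart r.

(** Entries increase along a row, so the rows of all entries determine their columns and hence the
    tableau. *)
Lemma tab_col_count (v : stdtab l) n :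
  bcol (tbox v n) = #|[set m : 'I_r | (m < n)%N
    & row_at l (tab_perm v) m == row_at l (tab_perm v) n]| :> nat.
Proof.
set S := [set m | _ & _]; set c := bcol _.
have inj_col : {in S &, injective (fun m => bcol (tbox v m))}.
  move=> m m'; rewrite !inE => /andP[_ /eqP [e1 e2]] /andP[_ /eqP[e1' e2']] em.
  rewrite -(tab_tbox v m) -(tab_tbox v m'); congr (val v _).
  by apply: box_eq => //; rewrite /tbox ?e1 ?e2 ?e1' ?e2'.
rewrite -(card_in_imset inj_col) -[LHS](card_initial_set (ltnW (ltn_ord c))).
apply: eq_card => j; rewrite inE; apply/idP/imsetP => [jc|[m]].
  have d : in_diagram l (bcomp (tbox v n), brow (tbox v n), j).
    by apply: ltn_trans jc _; apply: (valP (tbox v n)).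
  pose b : box l := Sub (bcomp (tbox v n), brow (tbox v n), j) d.
  exists (val v b); last by rewrite tbox_tab.
  rewrite inE /row_at /pos_row -!/(tbox v _) tbox_tab eqxx andbT.
  by rewrite -[X in (_ < X)%N](congr1 val (tab_tbox v n)); apply: tab_row_lt.
rewrite inE => /andP[mn /eqP[e1 e2]] ->; rewrite ltnNge; apply: contraL mn.
rewrite leq_eqVlt => /orP[/eqP ec|lt_c]; rewrite -leqNgt.
  rewrite (_ : n = m) //; rewrite -(tab_tbox v n) -(tab_tbox v m); congr (val v _).
  by apply: box_eq; [rewrite /tbox e1 | rewrite /tbox e2 | apply: val_inj].
have := @tab_row_lt _ _ v (tbox v n) (tbox v m); rewrite !tab_tbox => h.
by apply: ltnW; apply: h => //; rewrite /tbox ?e1 ?e2.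
Qed.

Lemma stdtab_row_inj (v v' : stdtab l) :
  row_at l (tab_perm v) =1 row_at l (tab_perm v') -> v = v'.
Proof.
move=> e; have eb n : tbox v n = tbox v' n.
  apply: box_eq; [by have [] := e n | by have [] := e n |].
  apply: val_inj; rewrite /= !tab_col_count; apply: eq_card => m.
  by rewrite !inE !e.
apply: val_inj; apply/ffunP => b.
by rewrite -[X in val v' X](tbox_tab v b) eb tab_tbox.
Qed.

End SameShape.

Definition std_pair : finType := {l : bipart r & (stdtab l * stdtab l)%type}.

Definition tab_le (l : bipart r) (s : stdtab l) (m : bipart r) (t : stdtab m) : Prop :=
  forall k c i, (rows_count (row_at l (tab_perm s)) k c i <= rows_count (row_at m (tab_perm t)) k c i)%N.

Definition pair_le (x y : std_pair) : Prop :=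
  tab_le (tagged x).1 (tagged y).1 /\ tab_le (tagged x).2 (tagged y).2.

Lemma pair_le_refl x : pair_le x x.
Proof. by split. Qed.

Lemma pair_le_trans y x z : pair_le x y -> pair_le y z -> pair_le x z.
Proof.
move=> [xy1 xy2] [yz1 yz2]; split=> k c i.
  exact: leq_trans (xy1 k c i) (yz1 k c i).
exact: leq_trans (xy2 k c i) (yz2 k c i).
Qed.

(** The sum of all the counts: it is monotone for [tab_le], and equal sums force equal counts, so it
    measures progress in the triangular induction. *)
Definition tab_rank (l : bipart r) (s : stdtab l) : nat :=
  (\sum_(x : 'I_r.+1 * bool * 'I_r.+1) rows_count (row_at l (tab_perm s)) x.1.1 x.1.2 x.2)%N.

Lemma tab_rank_le (l : bipart r) (s : stdtab l) (m : bipart r) (t : stdtab m) :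
  tab_le s t -> (tab_rank s <= tab_rank t)%N.
Proof. by move=> st; apply: leq_sum. Qed.

Lemma tab_rank_eq (l : bipart r) (s : stdtab l) (m : bipart r) (t : stdtab m) :
  tab_le s t -> (tab_rank t <= tab_rank s)%N ->
  row_at l (tab_perm s) =1 row_at m (tab_perm t).
Proof.
move=> st ts; apply: rows_count_inj => k c i kr ir.
have kr' : (k < r.+1)%N by []. have ir' : (i < r.+1)%N by [].
have := leqif_sum (fun (x : 'I_r.+1 * bool * 'I_r.+1) (_ : true) =>
   leqif_eq (st x.1.1 x.1.2 x.2)) => /= -[_].
have -> : (tab_rank s == tab_rank t) by rewrite eqn_leq ts tab_rank_le.
move/esym/forallP => /(_ (Ordinal kr', c, Ordinal ir')) /= /eqP.
by [].
Qed.

Definition pair_rank (x : std_pair) : nat := (tab_rank (tagged x).1 + tab_rank (tagged x).2)%N.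

Lemma pair_rank_lt x y : pair_le x y -> x != y -> (pair_rank x < pair_rank y)%N.
Proof.
move=> [le1 le2] nxy; rewrite ltnNge; apply: contraNN nxy => le_yx; apply/eqP.
have r1 := tab_rank_le le1; have r2 := tab_rank_le le2.
have e1 : row_at (tag x) (tab_perm (tagged x).1) =1 row_at (tag y) (tab_perm (tagged y).1).
  by apply: tab_rank_eq => //; move: le_yx; rewrite /pair_rank; lia.
have e2 : row_at (tag x) (tab_perm (tagged x).2) =1 row_at (tag y) (tab_perm (tagged y).2).
  by apply: tab_rank_eq => //; move: le_yx; rewrite /pair_rank; lia.
have el := row_at_shape e1.
case: x y {le1 le2 le_yx r1 r2} el e1 e2 => [l [s t]] [m [s' t']] /= el; subst m => e1 e2.
by rewrite (stdtab_row_inj e1) (stdtab_row_inj e2).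
Qed.

End TableauOrder.

Section DualOrder.
Variables (R : comPzRingType) (r : nat) (u1 u2 v1 v2 : R).
Hypothesis v12 : (v1 = u1 /\ v2 = u2) \/ (v1 = u2 /\ v2 = u1).
Variable e : bool -> bool.
Local Notation hcoord := (@hcoord R r u1 u2 v1 v2).
Local Notation hcell := (@hcell R r u1 u2 v2 e).
Local Notation hcell_up := (@hcell_up R r u1 u2 v2 e).
Local Notation dual := (@dual R r e).

Lemma separated_count l' (q' : 'S_r) l (u : stdtab l) :
    (forall n, bcomp (pos_box l' (q'^-1%g n)) = bcomp (tbox u n)) ->
    separated l' q' l (tab_perm u) ->
  forall k c i, (rows_count (row_at l' q') k c i <= rows_count (row_at l (tab_perm u)) k c i)%N.
Proof.
move=> hc sep k c i; apply: (@std_count _ _ u _ (fun n => (row_at l' q' n).2)).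
  by move=> n; rewrite inE => /and3P[nk /eqP nc ni]; rewrite -hc.
move=> n m; rewrite !inE => /and3P[_ /eqP nc _] /and3P[_ /eqP mc _] er ec.
apply: sep.
  by move: nc mc er; rewrite /row_at /pos_row /= => -> -> ->.
by rewrite /pos_col -!/(tbox u _) ec -!hc; move: nc mc => /= -> ->.
Qed.

Lemma dual_hcell_le l' (p' q' : 'S_r) l (s t : stdtab l) :
    dual l (tab_perm s) (tab_perm t) (hcoord (hcell l' p' q')) != 0 ->
  forall k c i, (rows_count (row_at l' p') k c i <= rows_count (row_at l (tab_perm s)) k c i)%N /\
    (rows_count (row_at l' q') k c i <= rows_count (row_at l (tab_perm t)) k c i)%N.
Proof.
move=> /(dual_hcell v12)[hp hq sp sq] k c i.
by split; apply: separated_count.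
Qed.

Lemma dual_hcell_shape l' (p' q' : 'S_r) l (s t : stdtab l) :
  dual l (tab_perm s) (tab_perm t) (hcoord (hcell l' p' q')) != 0 -> dominated l' l.
Proof.
move=> /dual_hcell_le h; apply: psum_dominated => c i _.
by have [_] := h r c i; rewrite !rows_count_psum.
Qed.

Lemma card_comp (l : bipart r) c (p : 'S_r) :
  #|[set n | bcomp (pos_box l (p^-1%g n)) == c]| = comp_size l c.
Proof.
rewrite -psum_full -(rows_count_psum l p); apply: eq_card => n.
by rewrite !inE /row_at !ltn_ord andbT.
Qed.

(** The first component of [l] has one box more. A partial sum of the second component can lose only
    the moved entry [m], and the larger first component makes up for it. *)
Lemma dual_hcell_up_lt l' (m : 'I_r) l (p : 'S_r) (t : stdtab l) : (comp_size l' false <= m)%N ->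
  dual l p (tab_perm t) (hcoord (hcell_up l' m)) != 0 -> (l' < l)%O.
Proof.
move=> am /(dual_hcell_up v12 am)[hB sep].
have cl : comp_size l false = (comp_size l' false).+1.
  have := cardsU1 m (initial_set r (comp_size l' false)).
  rewrite mem_initial_set -leqNgt am card_initial_set ?comp_size_le // add1n => <-.
  rewrite -(card_comp l false (tab_perm t)); apply: eq_card => n; rewrite !inE -hB.
  by case: bcomp.
rewrite lt_neqAle; apply/andP; split.
  by apply/eqP => ell; move: cl; rewrite ell; lia.
have hrow c (S : {set 'I_r}) i : {in S, forall n, (pos_row l' n).1 = c /\ ((pos_row l' n).2 < i)%N} ->
    {in S, forall n, bcomp (tbox t n) = c} -> (#|S| <= psum l c i)%N.
  move=> hS hc; rewrite -(rows_count_psum l (tab_perm t)).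
  apply: (@std_count _ _ t _ (fun n => (pos_row l' n).2)) => [n nS|n n' nS n'S er ec].
    by have [_ ni] := hS n nS; split=> //; apply: hc.
  apply: sep; rewrite ?invg1 ?perm1.
    by have [n1 _] := hS n nS; have [n2 _] := hS n' n'S; rewrite [LHS]surjective_pairing n1 -n2 er.
  by rewrite /pos_col -!/(tbox t _) !hc // ec.
have h0 (i : 'I_r.+1) : (psum l' false i <= psum l false i)%N.
  rewrite -(card_pos_rows l'); apply: hrow => n; rewrite inE => /andP[/eqP e1 e2] //.
  apply: negbTE; rewrite /tbox hB; move: e1 => /=; rewrite pos_comp => /negbFE ->.
  by rewrite orbT.
have h1 (i : 'I_r.+1) : (psum l' true i <= (psum l true i).+1)%N.
  rewrite -(card_pos_rows l') (cardsD1 m) -[leqRHS]add1n; apply: leq_add; first by case: (_ \in _).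
  apply: hrow => n; rewrite !inE => /and3P[nm /eqP e1 e2] //.
  apply: negbNE; rewrite hB (negPf nm) /=.
  by move: e1 => /=; rewrite pos_comp.
apply/forallP => i; rewrite h0 /=.
by have := h1 i; rewrite cl; lia.
Qed.

End DualOrder.

(** * Counting pairs of standard tableaux *)

(** Row [j.+1] can receive a box exactly when row [j] can lose one, and row 0 always can; the
    vanishing at the end ensures that no removable row is left unmatched. *)
Lemma count_steps n (g : nat -> nat) : (0 < n)%N -> g n.-1 = 0%N -> g n = 0%N ->
  (\sum_(i < n) ((if nat_of_ord i is j.+1 then g j.+1 < g j else true) : bool) =
   \sum_(i < n) (g i.+1 < g i) + 1)%N.
Proof.
case: n => // n _ /= e0 e1; rewrite big_ord_recl big_ord_recr /= e0 e1 ltnn addn0 addnC.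
by congr (_ + _)%N; apply: eq_bigr.
Qed.

Section UpDown.
Variable r : nat.
Local Notation A := (bool * 'I_r)%type.
Local Notation shape := {ffun A -> nat}.
Local Open Scope nat_scope.

(** Rows past the end read as 0, so that the partition condition compares neighbouring rows without
    bounds. *)
Definition entry (f : shape) (c : bool) (i : nat) : nat :=
  oapp (fun j : 'I_r => f (c, j)) 0 (insub i).

Lemma entry_ord f c (i : 'I_r) : entry f c i = f (c, i).
Proof. by rewrite /entry valK. Qed.

Lemma entry_out f c i : r <= i -> entry f c i = 0.
Proof. by move=> ri; rewrite /entry insubF // ltnNge ri. Qed.

Definition partition_shape (f : shape) : bool :=
  [forall c : bool, forall i : 'I_r, forall j : 'I_r, (i <= j) ==> (f (c, j) <= f (c, i))].

Lemma partition_shapeP f : reflect (forall c i, entry f c i.+1 <= entry f c i) (partition_shape f).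
Proof.
apply: (iffP idP) => [/forallP h c i | h].
  have [ri|ir] := leqP r i.+1; first by rewrite entry_out.
  have := h c => /forallP/(_ (Ordinal (ltnW ir)))/forallP/(_ (Ordinal ir))/implyP.
  by rewrite -!entry_ord /=; apply.
apply/forallP => c; apply/forallP => i; apply/forallP => j; apply/implyP => ij.
rewrite -!entry_ord -(subnKC ij); elim: (j - i) => [|n IHn]; first by rewrite addn0.
by rewrite addnS; apply: leq_trans (h _ _) IHn.
Qed.

Definition add_box (f : shape) (a : A) : shape := [ffun b => f b + (b == a)].
Definition remove_box (f : shape) (a : A) : shape := [ffun b => f b - (b == a)].

(** The number of ways to build [f] from the empty shape in [k] steps through partition shapes;
    [card_stdtab] identifies it with the number of standard tableaux. *)
Fixpoint npaths (k : nat) (f : shape) : nat :=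
  if k is k'.+1 then partition_shape f * \sum_a (0 < f a) * npaths k' (remove_box f a)
  else (f == [ffun=> 0]).

Arguments npaths : simpl never.

Lemma npaths0 f : npaths 0 f = (f == [ffun=> 0]).
Proof. by []. Qed.

Lemma npathsS k f : npaths k.+1 f = partition_shape f * \sum_a (0 < f a) * npaths k (remove_box f a).
Proof. by []. Qed.

Lemma entry_add_box f c i c' i' :
  entry (add_box f (c, i)) c' i' = entry f c' i' + ((c' == c) && (i' == i)).
Proof.
have [ri|ir] := leqP r i'.
  rewrite !entry_out // (_ : (i' == i) = false) ?andbF //.
  by apply/negbTE; rewrite neq_ltn (leq_trans (ltn_ord i) ri) orbT.
by rewrite -[i']/(val (Ordinal ir)) !entry_ord ffunE xpair_eqE -val_eqE.
Qed.

Lemma entry_remove_box f c i c' i' :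
  entry (remove_box f (c, i)) c' i' = entry f c' i' - ((c' == c) && (i' == i)).
Proof.
have [ri|ir] := leqP r i'; first by rewrite !entry_out.
by rewrite -[i']/(val (Ordinal ir)) !entry_ord ffunE xpair_eqE -val_eqE.
Qed.

Lemma partition_add_box f c (i : 'I_r) : partition_shape f -> partition_shape (add_box f (c, i)) =
  if nat_of_ord i is i'.+1 then entry f c i'.+1 < entry f c i' else true.
Proof.
move=> /partition_shapeP hf; apply/partition_shapeP/idP => [h | h c' j].
  case ei : (nat_of_ord i) => [//|i']; have := h c i'; rewrite !entry_add_box -ei !eqxx /=.
  by rewrite (_ : (i' == i) = false); [rewrite addn0 addn1 | rewrite ei ltn_eqF].
rewrite !entry_add_box; have := hf c' j; case: (c' =P c) => [->|_] /=; last by lia.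
move: h; case ei : (nat_of_ord i) => [|i']; first by lia.
case: (j.+1 =P i'.+1) => [[->]|_]; first by lia.
by lia.
Qed.

Lemma partition_remove_box f c i : partition_shape f ->
  (0 < f (c, i)) && partition_shape (remove_box f (c, i)) = (entry f c i.+1 < entry f c i).
Proof.
move=> /partition_shapeP hf; rewrite -entry_ord.
apply/andP/idP => [[f0 /partition_shapeP/(_ c i)] | lt_f].
  by rewrite !entry_remove_box !eqxx; lia.
split; first by lia.
apply/partition_shapeP => c' j; rewrite !entry_remove_box; have := hf c' j.
case: (c' =P c) => [->|_] /=; last by lia.
by case: (j =P i) => [->|_]; lia.
Qed.

(** Off the diagonal the up and down operators commute: if adding [a] and removing another box [b]
    gives a partition shape, both orders stay within partition shapes. *)
Lemma partition_add_remove f a b : partition_shape f -> a != b -> 0 < f b ->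
    partition_shape (remove_box (add_box f a) b) ->
  partition_shape (add_box f a) && partition_shape (remove_box f b).
Proof.
case: a b => [c i] [d j] /partition_shapeP hf ab fb /partition_shapeP hk; rewrite -entry_ord in fb.
apply/andP; split; apply/partition_shapeP => c' m; have := hf c' m; have := hk c' m;
  rewrite !entry_remove_box !entry_add_box.
  move: ab; rewrite xpair_eqE -val_eqE /=.
  by do ![case: eqP => //= ?]; subst; lia.
move: ab; rewrite xpair_eqE -val_eqE /=.
by do ![case: eqP => //= ?]; subst; lia.
Qed.

Lemma count_add_remove (f : shape) : partition_shape f -> \sum_a f a < r ->
  \sum_a partition_shape (add_box f a) = \sum_a ((0 < f a) && partition_shape (remove_box f a)) + 2.
Proof.
move=> hf sf.
have split_sum (G : A -> nat) : \sum_a G a = \sum_i G (true, i) + \sum_i G (false, i).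
  transitivity (\sum_c \sum_i G (c, i)); last by rewrite big_bool.
  by rewrite pair_bigA; apply: eq_bigr => -[].
suff hc c : \sum_i partition_shape (add_box f (c, i)) =
    \sum_i ((0 < f (c, i)) && partition_shape (remove_box f (c, i))) + 1.
  by rewrite !split_sum !hc; lia.
(* The limit of [r] rows is not felt: a box in the last row would force [r] boxes in the
   component. *)
have last0 : entry f c r.-1 = 0.
  apply/eqP; rewrite -leqn0 leqNgt; apply/negP => pos.
  suff : r <= \sum_a f a by lia.
  have : r <= \sum_i f (c, i).
    rewrite -[X in X <= _]card_ord -sum1_card; apply: leq_sum => i _.
    rewrite -entry_ord; apply: leq_trans pos _.
    have /forallP/(_ c)/forallP/(_ i) := hf.
    have ltr : r.-1 < r by have := ltn_ord i; lia.
    move=> /forallP/(_ (Ordinal ltr))/implyP; rewrite -!entry_ord /=; apply.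
    by have := ltn_ord i; lia.
  by rewrite split_sum; case: c {pos} => /=; lia.
under eq_bigr => i _ do rewrite partition_add_box //.
under [in RHS]eq_bigr => i _ do rewrite partition_remove_box //.
by apply: count_steps => //; [apply: leq_ltn_trans sf | apply: entry_out].
Qed.

Lemma sum_add_box (f : shape) a : \sum_b add_box f a b = (\sum_b f b).+1.
Proof.
under eq_bigr => b _ do rewrite ffunE.
by rewrite big_split /= -big_mkcond big_pred1_eq addn1.
Qed.

Lemma remove_boxK (f : shape) a : 0 < f a -> add_box (remove_box f a) a = f.
Proof.
move=> fa; apply/ffunP => b; rewrite !ffunE.
by case: eqP => [->|_] /=; rewrite ?subn0 ?addn0 ?subnK.
Qed.

Lemma add_boxK (f : shape) a : remove_box (add_box f a) a = f.
Proof. by apply/ffunP => b; rewrite !ffunE addnK. Qed.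

Lemma add_remove_boxC (f : shape) a b : a != b ->
  remove_box (add_box f a) b = add_box (remove_box f b) a.
Proof.
move=> ab; apply/ffunP => c; rewrite !ffunE.
by case: (c =P a) => [->|_]; [rewrite (negPf ab); lia | lia].
Qed.

Lemma sum_remove_box (f : shape) a : 0 < f a -> \sum_b f b = (\sum_b remove_box f a b).+1.
Proof. by move=> fa; rewrite -(sum_add_box _ a) remove_boxK. Qed.

Lemma partition_shape0 : partition_shape [ffun=> 0].
Proof.
by apply/forallP => c; apply/forallP => i; apply/forallP => j; rewrite !ffunE implybT.
Qed.

Lemma npaths_partition k (f : shape) : ~~ partition_shape f -> npaths k f = 0.
Proof.
case: k => [|k] /negbTE; last by rewrite npathsS => ->.
rewrite npaths0.
by move=> nf; case: eqP => // e; rewrite e partition_shape0 in nf.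
Qed.

(** The coefficient at [f] of [D U^(k+1) = 2 (k+1) U^k] applied to the empty shape. In the induction
    the off-diagonal terms of [up1] and [down1] coincide, and the diagonals differ by the surplus of
    two addable boxes. *)
Lemma npaths_up k (f : shape) : k < r -> partition_shape f -> \sum_a f a = k ->
  \sum_a npaths k.+1 (add_box f a) = 2 * k.+1 * npaths k f.
Proof.
elim: k f => [|k IHk] f kr hf sf.
  have f0 a : f a = 0.
    by apply/eqP; move/eqP: sf; rewrite sum_nat_eq0 => /forallP/(_ a).
  have e0 : f == [ffun=> 0] by apply/eqP/ffunP => a; rewrite ffunE f0.
  have := count_add_remove hf; rewrite sf => /(_ kr).
  rewrite [X in _ = X + _]big1 => [|a _]; last by rewrite f0.
  rewrite npaths0 e0 add0n !muln1 => <-; apply: eq_bigr => a _.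
  rewrite npathsS (bigD1 a) //= ffunE eqxx addn1 mul1n add_boxK npaths0 e0 big1 => [|b ba]; first by lia.
  by rewrite ffunE f0 (negPf ba).
have up1 : \sum_a npaths k.+2 (add_box f a) = (\sum_a partition_shape (add_box f a)) * npaths k.+1 f +
    \sum_a \sum_(b | b != a) partition_shape (add_box f a) *
      ((0 < f b) * npaths k.+1 (remove_box (add_box f a) b)).
  rewrite big_distrl -big_split /=; apply: eq_bigr => a _.
  rewrite npathsS (bigD1 a) //= mulnDr; congr (_ + _).
    by rewrite add_boxK ffunE eqxx addn1 mul1n.
  rewrite big_distrr /=; apply: eq_bigr => b ba.
  by rewrite ffunE (negPf ba) addn0.
have down1 : 2 * k.+1 * npaths k.+1 f =
    (\sum_a ((0 < f a) && partition_shape (remove_box f a))) * npaths k.+1 f +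
    \sum_a \sum_(b | b != a) partition_shape (add_box f a) *
      ((0 < f b) * npaths k.+1 (remove_box (add_box f a) b)).
  rewrite {1}npathsS hf mul1n big_distrr /=.
  have -> : \sum_a \sum_(b | b != a) partition_shape (add_box f a) *
        ((0 < f b) * npaths k.+1 (remove_box (add_box f a) b)) =
      \sum_b \sum_(a | a != b) ((0 < f b) && partition_shape (remove_box f b)) *
        npaths k.+1 (remove_box (add_box f a) b).
    rewrite (exchange_big_dep predT) //=; apply: eq_bigr => b _.
    apply: eq_big => [a|a ba]; first by rewrite eq_sym.
    have [fb|] := posnP (f b); first by rewrite muln0.
    move=> fb; rewrite mul1n /=.
    have [hk|nk] := boolP (partition_shape (remove_box (add_box f a) b)); last first.
      by rewrite (npaths_partition k.+1 nk) !muln0.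
    rewrite eq_sym in ba.
    by have /andP[-> ->] := partition_add_remove hf ba fb hk.
  rewrite big_distrl -big_split /=; apply: eq_bigr => b _.
  have [fb|fb] := posnP (f b); first by rewrite mul0n muln0 big1.
  rewrite mul1n /=.
  have [hd|nd] := boolP (partition_shape (remove_box f b)); last first.
    by rewrite npaths_partition // muln0 mul0n big1.
  rewrite -IHk //; [|exact: ltnW|by move: sf; rewrite (sum_remove_box fb) => -[]].
  rewrite (bigD1 b) //= remove_boxK // mul1n; congr (_ + _).
  by apply: eq_bigr => a ab; rewrite mul1n add_remove_boxC.
rewrite up1 count_add_remove ?sf // mulnDl -addnA addnCA -down1.
by rewrite -mulnDl; congr (_ * _); lia.
Qed.

Definition content (w : seq A) : shape := [ffun a => count_mem a w].

Lemma content_nil : content [::] = [ffun=> 0].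
Proof. by apply/ffunP => a; rewrite !ffunE. Qed.

Lemma content_cons a w : content (a :: w) = add_box (content w) a.
Proof. by apply/ffunP => b; rewrite !ffunE /= addnC eq_sym. Qed.

Lemma sum_content w : \sum_a content w a = size w.
Proof.
elim: w => [|a w IHw]; last by rewrite content_cons sum_add_box IHw.
by rewrite big1 // => a _; rewrite ffunE.
Qed.

(* a tableau is recorded by the row of each entry; the largest entry comes first *)
Fixpoint std_words (k : nat) : seq (seq A) :=
  if k is k'.+1 then
    [seq w <- [seq a :: w | a <- enum {: A}, w <- std_words k'] | partition_shape (content w)]
  else [:: [::]].

Lemma mem_std_words k a w :
  (a :: w \in std_words k.+1) = (w \in std_words k) && partition_shape (content (a :: w)).
Proof.
rewrite /= mem_filter andbC; congr (_ && _); apply/allpairsP/idP => [[[b w'] /= [_ ww [_ ->]]]|ww] //.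
by exists (a, w); rewrite mem_enum.
Qed.

Lemma std_wordsP k w : w \in std_words k -> size w = k /\ partition_shape (content w).
Proof.
elim: k w => [|k IHk] w.
  rewrite inE => /eqP->; by rewrite content_nil partition_shape0.
case: w => [|a w]; first by rewrite /= mem_filter => /andP[_ /allpairsP[[? ?] [_ _]]].
by rewrite mem_std_words => /andP[/IHk[<- _] ?].
Qed.

Lemma uniq_std_words k : uniq (std_words k).
Proof.
elim: k => // k IHk; apply/filter_uniq/allpairs_uniq => //; first exact: enum_uniq.
by move=> [a w] [b w'] _ _ /= [-> ->].
Qed.

Lemma count_std_words k f : count (fun w => content w == f) (std_words k) = npaths k f.
Proof.
elim: k f => [|k IHk] f; rewrite ?npaths0 ?npathsS /=.
  by rewrite addn0 content_nil eq_sym.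
rewrite count_filter -sum1_count big_mkcond big_allpairs_dep /=.
have [hf|nf] := boolP (partition_shape f); last first.
  rewrite big1 // => a _; rewrite big1 // => w _.
  by case: eqP => // ->; rewrite (negPf nf).
rewrite mul1n big_enum /=; apply: eq_bigr => a _; rewrite -IHk -sum1_count [in RHS]big_mkcond.
rewrite big_distrr /=; apply: eq_bigr => w _; rewrite content_cons.
have [fa|fa] := posnP (f a).
  case: eqP => //= e; move: fa; rewrite -e ffunE eqxx; lia.
rewrite mul1n; case: eqP => [e|ne] /=; first by rewrite -e add_boxK eqxx e hf.
by case: eqP => // e; case: ne; rewrite e remove_boxK.
Qed.

(** Grouped by content this is the sum of the squares of the tableau numbers. Summing over words
    lets the last letter run over all added boxes, so that [npaths_up] supplies the factor
    [2 * k.+1]. *)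
Lemma sum_npaths_std_words k : k <= r -> \sum_(w <- std_words k) npaths k (content w) = 2 ^ k * k`!.
Proof.
elim: k => [|k IHk] kr.
  by rewrite /= big_seq1 npaths0 content_nil eqxx.
rewrite [std_words _]/= big_filter big_mkcond big_allpairs_dep exchange_big /=.
rewrite (eq_big_seq (fun w => 2 * k.+1 * npaths k (content w))).
  by rewrite -big_distrr /= IHk 1?ltnW // expnS factS; lia.
move=> w /std_wordsP[sw hw]; rewrite -npaths_up //; last by rewrite sum_content.
rewrite big_enum; apply: eq_bigr => a _; rewrite content_cons.
by case: ifP => // /negbT/npaths_partition ->.
Qed.

End UpDown.

(** * Standard tableaux as words *)

Section TableauWords.
Variable r : nat.
Local Notation A := (bool * 'I_r)%type.
Local Notation shape := {ffun A -> nat}.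
Local Open Scope nat_scope.

Definition row_count (g : 'I_r -> A) (k : nat) (a : A) := #|[set n : 'I_r | (n < k) && (g n == a)]|.

Lemma row_countS (g : 'I_r -> A) (n : 'I_r) a : row_count g n.+1 a = row_count g n a + (g n == a).
Proof.
rewrite /row_count (cardsD1 n) !inE ltnSn /= addnC; congr (_ + _)%N.
apply: eq_card => m; rewrite !inE ltnS [in RHS]ltn_neqAle -val_eqE.
by case: (val m == n).
Qed.

Lemma row_count_le (g : 'I_r -> A) k k' a : k <= k' -> row_count g k a <= row_count g k' a.
Proof.
move=> kk; apply/subset_leq_card/subsetP => n; rewrite !inE => /andP[nk ->].
by rewrite (leq_trans nk kk).
Qed.

Definition prefix_word (g : 'I_r -> A) k : seq A := rev (map g (take k (enum 'I_r))).

Lemma prefix_wordS g (n : 'I_r) : prefix_word g n.+1 = g n :: prefix_word g n.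
Proof.
rewrite /prefix_word (take_nth n) ?size_enum_ord // map_rcons rev_rcons.
by rewrite nth_ord_enum.
Qed.

Lemma content_prefix g k : k <= r -> content (prefix_word g k) = [ffun a => row_count g k a].
Proof.
elim: k => [|k IHk] kr.
  rewrite /prefix_word take0 content_nil; apply/ffunP => a; rewrite !ffunE.
  by rewrite /row_count (eq_card0 (A := [set n | _])) // => n; rewrite inE.
rewrite -[k]/(val (Ordinal kr)) prefix_wordS content_cons IHk 1?ltnW //.
by apply/ffunP => a; rewrite !ffunE row_countS eq_sym.
Qed.

Lemma prefix_word_std g : (forall k, k <= r -> partition_shape [ffun a => row_count g k a]) ->
  forall k, k <= r -> prefix_word g k \in std_words r k.
Proof.
move=> hg; elim=> [|k IHk] kr; first by rewrite /prefix_word take0 inE.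
rewrite -[k]/(val (Ordinal kr)) prefix_wordS mem_std_words -prefix_wordS IHk 1?ltnW //=.
by rewrite content_prefix // hg.
Qed.

Lemma drop_std_words k j w : w \in std_words r k -> j <= k -> drop j w \in std_words r (k - j).
Proof.
elim: j k w => [|j IHj] k w wk jk; first by rewrite drop0 subn0.
case: k wk jk => // k; case: w => [|a w] wk jk.
  by have [] := std_wordsP wk.
by rewrite /= subSS; apply: IHj => //; move: wk; rewrite mem_std_words => /andP[].
Qed.

Section Shape.
Variable l : bipart r.

Definition shape_of : shape := [ffun a => part l a.1 a.2].

Lemma row_count_part (p : 'S_r) a : row_count (row_at l p) r a = part l a.1 a.2.
Proof.
apply/eqP; rewrite -(eqn_add2l (psum l a.1 a.2)) -psumS -!(rows_count_psum l p).
rewrite /rows_count /row_count.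
set S := [set n | _]; set S1 := [set n | _ && (_ == a)]; set S2 := [set n | _].
have -> : S2 = S :|: S1.
  apply/setP => n; rewrite !inE ltn_ord; case: (row_at l p n) => c i /=; rewrite ltnS leq_eqVlt.
  have -> : ((c, i) == a) = (c == a.1) && (i == a.2) by case: (a).
  by rewrite -andb_orr orbC.
rewrite -cardsUI (_ : S :&: S1 = set0) ?cards0 ?addn0 //.
apply/setP => n; rewrite !inE; case: (row_at l p n =P a) => [->|_]; last by rewrite !andbF.
by rewrite ltnn !andbF.
Qed.

Definition word_of (v : stdtab l) : seq A := prefix_word (row_at l (tab_perm v)) r.

(** Moving up within a column from row [j] to row [i] decreases entries, which injects the entries
    below [k] of row [j] into those of row [i]. *)
Lemma std_prefix (v : stdtab l) k : partition_shape [ffun a => row_count (row_at l (tab_perm v)) k a].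
Proof.
apply/forallP => c; apply/forallP => i; apply/forallP => j; apply/implyP => ij; rewrite !ffunE.
rewrite /row_count; set Sj := [set n | _]; set Si := [set n | _].
pose phi n := odflt n [pick m | (m \in Si) && (bcol (tbox v m) == bcol (tbox v n))].
have phiP n : n \in Sj -> phi n \in Si /\ bcol (tbox v (phi n)) = bcol (tbox v n).
  rewrite inE => /andP[nk /eqP nj]; rewrite /phi; case: pickP => [m /andP[mV /eqP]|no] //=.
  have [bc br] : bcomp (tbox v n) = c /\ brow (tbox v n) = j by case: nj.
  have [] := @box_above _ _ (tbox v n) i; first by rewrite br.
  move=> b [b1 b2 b3]; have := no (val v b).
  rewrite tbox_tab b3 eqxx andbT inE /row_at /pos_row -/(tbox v _) tbox_tab b1 b2 bc eqxx andbT.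
  move=> /negbT; rewrite -leqNgt => kb; exfalso.
  have [ij'|/val_inj eij] : (i < j) \/ i = j :> nat by lia.
    have := @tab_col_lt _ _ v b (tbox v n); rewrite tab_tbox b2 br => /(_ b1 b3 ij').
    by lia.
  suff eb : b = tbox v n by move: kb nk; rewrite eb tab_tbox; lia.
  by apply: box_eq; rewrite ?b1 ?b2 ?b3 ?br.
have injphi : {in Sj &, injective phi}.
  move=> n m nS mS ephi; have [_ en] := phiP n nS; have [_ em] := phiP m mS.
  rewrite ephi em in en; move: nS mS; rewrite !inE => /andP[_ /eqP [n1 n2]] /andP[_ /eqP [m1 m2]].
  rewrite -(tab_tbox v n) -(tab_tbox v m); congr (val v _).
  by apply: box_eq; rewrite ?en // /tbox ?n1 ?n2 ?m1 ?m2.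
rewrite -(card_in_image injphi); apply/subset_leq_card/subsetP => m /imageP[n nS ->].
by have [] := phiP n nS.
Qed.

Lemma word_of_std v : word_of v \in std_words r r.
Proof. by apply: prefix_word_std => // k _; apply: std_prefix. Qed.

Lemma content_word_of v : content (word_of v) = shape_of.
Proof. by rewrite content_prefix //; apply/ffunP => a; rewrite !ffunE row_count_part. Qed.

Lemma prefix_word_full g g' : prefix_word g r = prefix_word g' r -> g =1 g'.
Proof.
move=> /(congr1 rev); rewrite !revK !take_oversize ?size_enum_ord // => /eq_in_map e n.
by apply: e; rewrite mem_enum.
Qed.

Lemma word_of_inj : injective word_of.
Proof. by move=> v v' /prefix_word_full e; apply: stdtab_row_inj. Qed.

Section FromWord.
Variable g : 'I_r -> A.
Hypothesis g_std : forall k, k <= r -> partition_shape [ffun a => row_count g k a].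
Hypothesis g_shape : [ffun a => row_count g r a] = shape_of.

Lemma word_col_lt (n : 'I_r) : row_count g n (g n) < part l (g n).1 (g n).2.
Proof.
have := congr1 (fun f : shape => f (g n)) g_shape; rewrite !ffunE => <-.
have := row_count_le g (g n) (ltn_ord n); rewrite row_countS eqxx addn1.
by [].
Qed.

Lemma word_col_ltr (n : 'I_r) : row_count g n (g n) < r.
Proof. by apply: leq_trans (word_col_lt n) _; rewrite -ltnS; apply: ltn_ord. Qed.

(** Entry [n] is put at the end of its row: its column is the number of earlier entries there. *)
Definition word_box (n : 'I_r) : box l :=
  Sub (g n, Ordinal (word_col_ltr n)) (word_col_lt n : in_diagram l (g n, Ordinal (word_col_ltr n))).

Lemma word_box_inj : injective word_box.
Proof.
suff lt_inj (n m : 'I_r) : n < m -> word_box n <> word_box m.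
  move=> n m e; apply: val_inj; case: (ltngtP n m) => // lt; first by case: (lt_inj n m).
  by case: (lt_inj m n).
move=> nm /(congr1 val)/= [eg ec].
have := row_count_le g (g n) nm; rewrite row_countS eqxx {2}eg -ec; lia.
Qed.

Lemma word_box_onto b : b \in codom word_box.
Proof. by apply: inj_card_onto; [apply: word_box_inj | rewrite card_box card_ord]. Qed.

Definition word_tab : {ffun box l -> 'I_r} := [ffun b => iinv (word_box_onto b)].

Lemma word_tabK b : word_box (word_tab b) = b.
Proof. by rewrite ffunE f_iinv. Qed.

Lemma word_tab_std : is_std word_tab.
Proof.
have eg b : g (word_tab b) = (bcomp b, brow b).
  by rewrite -[in RHS](word_tabK b) /bcomp /brow /=; case: (g _).
have ec b : row_count g (word_tab b) (bcomp b, brow b) = bcol b.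
  by rewrite -eg -[in RHS](word_tabK b).
apply/and3P; split.
- apply/forallP => n; apply/cards1P; exists (word_box n); apply/setP => b; rewrite !inE.
  apply/eqP/eqP => [<-|->]; first by rewrite word_tabK.
  by apply: word_box_inj; rewrite word_tabK.
- apply/forallP => b; apply/forallP => b'; apply/implyP => /and3P[/eqP e1 /eqP e2 lt_b].
  rewrite ltnNge; apply: contraL lt_b => le; rewrite -leqNgt -!ec -e1 -e2.
  exact: row_count_le.
- apply/forallP => b; apply/forallP => b'; apply/implyP => /and3P[/eqP e1 /eqP e2 lt_b].
  rewrite ltnNge; apply: contraL lt_b => le; rewrite -leqNgt.
  move: le; rewrite leq_eqVlt => /orP[/eqP/val_inj e|lt_t].
    by move: (eg b) (eg b'); rewrite e => -> [_ ->].
  (* If the lower box [b'] were filled before [b], then right after filling it the lower row would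
     be longer than the upper one, against [g_std]. *)
  rewrite leqNgt; apply/negP => lt_b.
  have := row_count_le g (bcomp b, brow b) lt_t; rewrite ec.
  have := row_countS g (word_tab b') (bcomp b', brow b'); rewrite eg eqxx ec -e2.
  have /forallP/(_ (bcomp b))/forallP/(_ (brow b))/forallP/(_ (brow b')) :=
    g_std (ltn_ord (word_tab b')).
  rewrite (ltnW lt_b) /= !ffunE -e1; lia.
Qed.

Definition word_stdtab : stdtab l := exist _ word_tab word_tab_std.

Lemma word_of_stdtab : word_of word_stdtab = prefix_word g r.
Proof.
rewrite /word_of /prefix_word; congr (rev _); apply: eq_map => n.
have -> : row_at l (tab_perm word_stdtab) n =
  (bcomp (tbox word_stdtab n), brow (tbox word_stdtab n)) by [].
have -> : tbox word_stdtab n = word_box n.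
  by rewrite -[RHS](tbox_tab word_stdtab); congr tbox; apply: word_box_inj; rewrite word_tabK.
by rewrite /bcomp /brow /=; case: (g n).
Qed.

End FromWord.

Lemma word_of_onto w : w \in std_words r r -> content w = shape_of -> exists v, word_of v = w.
Proof.
move=> wr wl; have [sw _] := std_wordsP wr.
(* The default [(false, n)] is never reached, as [w] has length [r]. The reversal makes the prefixes
   of [g] the tails of [w]. *)
pose g (n : 'I_r) := nth (false, n) (rev w) n.
have egw : map g (enum 'I_r) = rev w.
  have szg : size (map g (enum 'I_r)) = size (rev w) by rewrite size_map size_enum_ord size_rev sw.
  case ew: (rev w) => [|a0 s]; first by apply: size0nil; rewrite szg ew.
  apply: (@eq_from_nth _ a0); first by rewrite szg ew.
  rewrite -ew size_map size_enum_ord => i ir.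
  rewrite (nth_map (Ordinal ir)) ?size_enum_ord // -[i]/(val (Ordinal ir)) nth_ord_enum.
  by apply: set_nth_default; rewrite size_rev sw.
have eg k : k <= r -> prefix_word g k = drop (r - k) w.
  by move=> kr; rewrite /prefix_word map_take egw take_rev revK sw.
have gw : prefix_word g r = w by rewrite eg // subnn drop0.
have g_std k : k <= r -> partition_shape [ffun a => row_count g k a].
  move=> kr; rewrite -content_prefix // eg //.
  by have [_] := std_wordsP (drop_std_words wr (leq_subr k r)).
have g_shape : [ffun a => row_count g r a] = shape_of by rewrite -content_prefix // gw.
by exists (word_stdtab g_std g_shape); rewrite word_of_stdtab.
Qed.

Lemma card_stdtab : #|{: stdtab l}| = npaths r shape_of.
Proof.
rewrite -count_std_words -size_filter cardE -(size_map word_of); apply: perm_size.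
apply: uniq_perm => [||w].
- by rewrite map_inj_uniq ?enum_uniq //; apply: word_of_inj.
- exact/filter_uniq/uniq_std_words.
rewrite mem_filter; apply/mapP/andP => [[v _ ->]|[/eqP wl wr]].
  by rewrite content_word_of word_of_std.
by have [v <-] := word_of_onto wr wl; exists v; rewrite ?mem_enum.
Qed.

End Shape.

Lemma shape_of_inj : injective shape_of.
Proof.
move=> l m e; apply/val_inj/ffunP => k; apply/ffunP => i; apply: val_inj.
by have := congr1 (fun f : shape => f (k, i)) e; rewrite !ffunE.
Qed.

Lemma shape_of_onto (f : shape) : partition_shape f -> \sum_a f a = r -> exists l, shape_of l = f.
Proof.
move=> hf sf; have fr a : f a < r.+1.
  by rewrite ltnS -[leqRHS]sf (bigD1 a) //= leq_addr.
pose p : {ffun bool -> {ffun 'I_r -> 'I_r.+1}} := [ffun k => [ffun i => Ordinal (fr (k, i))]].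
have pP : is_bipart p.
  apply/andP; split.
    apply/forallP => k; apply/forallP => i; apply/forallP => j; apply/implyP => ij.
    by rewrite !ffunE /=; have /forallP/(_ k)/forallP/(_ i)/forallP/(_ j)/implyP := hf; apply.
  apply/eqP; rewrite -[RHS]sf pair_bigA; apply: eq_bigr => -[k i] _.
  by rewrite !ffunE.
by exists (Bipart pP); apply/ffunP => -[k i]; rewrite !ffunE /part /= !ffunE.
Qed.

(** For each shape there are as many words as standard tableaux, and each word contributes that same
    number, so the sum over words counts pairs. *)
Lemma card_std_pair : #|{: std_pair r}| = 2 ^ r * r`!.
Proof.
rewrite -(@sum_npaths_std_words r) // card_tagged sumnE big_map big_enum /=.
transitivity (\sum_(w <- std_words r r) \sum_(l : bipart r)
    (content w == shape_of l) * npaths r (content w)); last first.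
  apply: eq_big_seq => w /std_wordsP[sw hw].
  have [l el] : exists l, shape_of l = content w by apply: shape_of_onto; rewrite // sum_content.
  rewrite (bigD1 l) //= el eqxx mul1n big1 ?addn0 // => m ml.
  by rewrite -el (inj_eq shape_of_inj) eq_sym (negPf ml).
rewrite exchange_big /=; apply: eq_bigr => l _; rewrite card_prod card_stdtab.
rewrite -{1}count_std_words -sum1_count big_mkcond big_distrl /=; apply: eq_bigr => w _.
by case: eqP => [->|_].
Qed.

End TableauWords.

(** * Unitriangular Gram matrices *)

Section DualBases.
Variable R : comPzRingType.

Lemma sum_neq0 (I : finType) (F : I -> R) : \sum_i F i != 0 -> exists i, F i != 0.
Proof.
move=> nz; apply/existsP; apply: contraNT nz; rewrite negb_exists => /forallP h.
by rewrite big1 // => i _; apply/eqP; rewrite -[_ == _]negbK.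
Qed.

Lemma mulr_neq0 (x y : R) : x * y != 0 -> x != 0 /\ y != 0.
Proof.
by move=> nz; split; apply: contraNneq nz => ->; rewrite ?mul0r ?mulr0.
Qed.

Lemma sum_deltal (I : finType) (F : I -> R) i : \sum_k (i == k)%:R * F k = F i.
Proof.
rewrite (bigD1 i) //= eqxx mul1r big1 ?addr0 // => k; rewrite eq_sym => /negPf->.
by rewrite mul0r.
Qed.

Lemma sum_deltar (I : finType) (F : I -> R) i : \sum_k F k * (k == i)%:R = F i.
Proof.
rewrite -[RHS](sum_deltal F); apply: eq_bigr => k _; rewrite mulrC eq_sym; by [].
Qed.

(** Over a commutative ring a one-sided inverse of a square matrix is two-sided. This is where
    equality of the two cardinalities enters. *)
Lemma square_inverse (I J : finType) (X : I -> J -> R) (Y : J -> I -> R) : #|I| = #|J| ->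
    (forall i i', \sum_j X i j * Y j i' = (i == i')%:R) ->
  forall j j', \sum_i Y j i * X i j' = (j == j')%:R.
Proof.
move=> cIJ XY j j'.
pose MX := \matrix_(a < #|I|, b < #|I|) X (enum_val a) (enum_val (cast_ord cIJ b)).
pose MY := \matrix_(a < #|I|, b < #|I|) Y (enum_val (cast_ord cIJ a)) (enum_val b).
have bijJ : {on [pred j | true], bijective (fun a : 'I_#|I| => enum_val (cast_ord cIJ a) : J)}.
  exists (fun j => cast_ord (esym cIJ) (enum_rank j)) => [a _|k _].
    by rewrite enum_valK cast_ordK.
  by rewrite cast_ordKV enum_rankK.
have bijI : {on [pred i | true], bijective (fun a : 'I_#|I| => enum_val a : I)}.
  by exists enum_rank => [a _|k _]; rewrite ?enum_valK ?enum_rankK.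
have MXY : MX *m MY = 1%:M.
  apply/matrixP => a b; rewrite !mxE -(inj_eq enum_val_inj) -XY.
  by rewrite [RHS](reindex _ bijJ) /=; apply: eq_bigr => c _; rewrite !mxE.
have /matrixP := mulmx1C MXY.
move=> /(_ (cast_ord (esym cIJ) (enum_rank j)) (cast_ord (esym cIJ) (enum_rank j'))).
rewrite !mxE (inj_eq (@cast_ord_inj _ _ _)) (inj_eq enum_rank_inj) => <-.
rewrite (reindex _ bijI) /=; apply: eq_bigr => c _.
by rewrite !mxE !cast_ordKV !enum_rankK.
Qed.

Section Triangular.
Variables (I : finType) (le : I -> I -> Prop) (rank : I -> nat) (G : I -> I -> R).
Hypothesis le_refl : forall x, le x x.
Hypothesis le_trans : forall y x z, le x y -> le y z -> le x z.
Hypothesis rank_lt : forall x y, le x y -> x != y -> (rank x < rank y)%N.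
Hypothesis G_le : forall x y, G x y != 0 -> le x y.
Hypothesis G_diag : forall x, G x x = 1.

(** Back substitution from the highest rank down: row [x] of the inverse is the delta at [x] minus
    the combination, with coefficients [G x y], of the rows [y] above it. This form also keeps track
    of the support. *)
Lemma triangular_inverse : exists B : I -> I -> R,
  (forall x z, \sum_y B x y * G y z = (x == z)%:R) /\ (forall x y, B x y != 0 -> le x y).
Proof.
suff row x : exists b : I -> R,
    (forall z, \sum_y b y * G y z = (x == z)%:R) /\ (forall y, b y != 0 -> le x y).
  have [B hB] := fin_all_exists row.
  by exists B; split=> x; have [] := hB x.
have [N leN] : exists N, forall y, (rank y < N)%N.
  by exists (\max_y rank y).+1 => y; rewrite ltnS leq_bigmax.
have [n le_n] := ubnP (N - rank x); elim: n => // n IHn in x le_n *.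
(* The conditions on [y] stand inside the existential so that the rows can be chosen for all [y] at
   once; where they fail, the zero row is a dummy. *)
have step y : exists b : I -> R, G x y != 0 -> y != x ->
    (forall z, \sum_k b k * G k z = (y == z)%:R) /\ (forall k, b k != 0 -> le y k).
  have [/andP[gxy yx]|] := boolP ((G x y != 0) && (y != x)); last first.
    by move=> h; exists (fun=> 0) => g1 g2; rewrite g1 g2 in h.
  have lt_xy : (rank x < rank y)%N by apply: rank_lt; rewrite 1?eq_sym //; apply: G_le.
  have [|b hb] := IHn y; last by exists b.
  by have := leN y; lia.
have [b hb] := fin_all_exists step.
pose nz y := (G x y != 0) && (y != x).
exists (fun k => (x == k)%:R - \sum_(y | nz y) G x y * b y k); split=> [z | k].
  under eq_bigr => k _ do rewrite mulrBl mulr_suml.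
  rewrite sumrB sum_deltal exchange_big /=.
  have -> : \sum_(y | nz y) \sum_k G x y * b y k * G k z = \sum_(y | nz y) G x y * (y == z)%:R.
    apply: eq_bigr => y /andP[g1 g2]; have [<- _] := hb y g1 g2.
    by rewrite mulr_sumr; apply: eq_bigr => k _; rewrite mulrA.
  have -> : \sum_(y | nz y) G x y * (y == z)%:R = \sum_(y | y != x) G x y * (y == z)%:R.
    rewrite big_mkcond [RHS]big_mkcond; apply: eq_bigr => y _; rewrite /nz.
    by case: eqP => [->|_] /=; rewrite ?mul0r ?if_same.
  rewrite -[X in X - _](sum_deltar (G x)) (bigD1 x) //= addrK G_diag mul1r; by [].
have [<-//|xk] := eqVneq x k.
rewrite sub0r oppr_eq0 big_mkcond => /sum_neq0[y]; case: ifP => [/andP[g1 g2]|]; last by rewrite eqxx.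
move=> /mulr_neq0[_ byk]; apply: (le_trans (y := y)); first exact: G_le.
by have [_] := hb y g1 g2; apply.
Qed.

Variables (J : finType) (Phi Psi : I -> J -> R).
Hypothesis card_IJ : #|I| = #|J|.
Hypothesis Gram : forall x y, G x y = \sum_j Phi x j * Psi y j.

(** [B] times [Phi] is a left inverse of the transpose of [Psi], hence also a right inverse, and [f]
    is recovered from its pairings with [Psi]. The support of [B] bounds the coefficients. *)
Lemma dual_expansion (f : J -> R) : exists a : I -> R,
  (forall j, f j = \sum_x a x * Phi x j) /\
  (forall x, a x != 0 -> exists2 y, \sum_j f j * Psi y j != 0 & le y x).
Proof.
have [B [BG Ble]] := triangular_inverse.
have inv := square_inverse card_IJ (X := fun i j => \sum_k B i k * Phi k j) (Y := fun j i => Psi i j).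
have {}inv j j' : \sum_i Psi i j * \sum_k B i k * Phi k j' = (j == j')%:R.
  apply: inv => i i'; rewrite -BG.
  under eq_bigr => j0 _ do rewrite mulr_suml.
  rewrite exchange_big /=; apply: eq_bigr => k _; rewrite Gram mulr_sumr.
  by apply: eq_bigr => j0 _; rewrite mulrA.
exists (fun x => \sum_y (\sum_j f j * Psi y j) * B y x); split=> [j'|x /sum_neq0[y /mulr_neq0[h1 h2]]].
  rewrite -[LHS](sum_deltar f).
  under eq_bigr => j _ do rewrite -inv mulr_sumr.
  rewrite exchange_big /=.
  under [RHS]eq_bigr => x _ do rewrite mulr_suml.
  rewrite [RHS]exchange_big /=; apply: eq_bigr => y _.
  under eq_bigr => j _ do rewrite mulrA.
  rewrite -mulr_suml mulr_sumr; apply: eq_bigr => k _.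
  by rewrite mulrA.
by exists y => //; apply: Ble.
Qed.

(** A relation among the [Phi x] gives a relation among the rows of [G], which is invertible. *)
Lemma dual_independent (a : I -> R) : (forall j, \sum_x a x * Phi x j = 0) -> forall x, a x = 0.
Proof.
move=> a0 x; have [B [BG _]] := triangular_inverse.
have GB := square_inverse (erefl #|I|) BG.
rewrite -[LHS](sum_deltar a).
under eq_bigr => k _ do rewrite -GB mulr_sumr.
rewrite exchange_big /= big1 // => z _.
under eq_bigr => k _ do rewrite mulrA Gram.
rewrite -mulr_suml.
suff -> : \sum_i a i * (\sum_j Phi i j * Psi z j) = 0 by rewrite mul0r.
under eq_bigr => k _ do rewrite mulr_sumr.
rewrite exchange_big /= big1 // => j _.
under eq_bigr => k _ do rewrite mulrA.
by rewrite -mulr_suml a0 mul0r.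
Qed.

End Triangular.

End DualBases.

(** * Cellularity *)

Section InitialTableau.
Variables (r : nat) (l : bipart r).

Lemma initial_entry_row_lt (b b' : box l) : bcomp b = bcomp b' -> (brow b < brow b')%N ->
  (initial_entry b < initial_entry b')%N.
Proof.
move=> ek lt_i; apply: leq_trans (initial_entry_row b) _.
by rewrite /initial_entry -addnA ek leq_add2l (leq_trans (psum_mono _ _ lt_i)) ?leq_addr.
Qed.

Lemma initial_tab_std : is_std (initial_tab l).
Proof.
apply/and3P; split.
- apply/forallP => n; apply/cards1P; exists (pos_box l n); apply/setP => b; rewrite !inE.
  apply/eqP/eqP => [<-|->]; first by rewrite pos_box_initial.
  by rewrite initial_pos_box.
- apply/forallP => b; apply/forallP => b'; apply/implyP => /and3P[/eqP e1 /eqP e2 lt_b].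
  by rewrite !ffunE /= /initial_entry e1 e2 ltn_add2l.
- apply/forallP => b; apply/forallP => b'; apply/implyP => /and3P[/eqP e1 _ lt_b].
  by rewrite !ffunE /=; apply: initial_entry_row_lt.
Qed.

Definition initial_std : stdtab l := exist _ (initial_tab l) initial_tab_std.

Lemma initial_std_perm : tab_perm initial_std = 1%g.
Proof.
apply/permP => n; rewrite perm1.
have := congr1 (fun f : {ffun box l -> 'I_r} => f (pos_box l n)) (tab_permP initial_std).
by rewrite ffunE /= initial_pos_box.
Qed.

Lemma pos_row_mono (n m : 'I_r) : (n <= m)%N -> bcomp (pos_box l n) = bcomp (pos_box l m) ->
  (brow (pos_box l n) <= brow (pos_box l m))%N.
Proof.
move=> nm ek; rewrite leqNgt; apply/negP => lt_mn.
have := initial_entry_row_lt (esym ek) lt_mn.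
have e k : initial_entry (pos_box l k) = k.
  by have := congr1 val (initial_pos_box l k); rewrite ffunE.
by rewrite !e ltnNge nm.
Qed.

Lemma rows_count_comp (g : 'I_r -> bool * 'I_r) k :
  (rows_count g k true r + rows_count g k false r = #|[set n : 'I_r | n < k]|)%N.
Proof.
rewrite /rows_count -cardsUI [X in (_ + X)%N](_ : _ = 0%N) ?addn0.
  by apply: eq_card => n; rewrite !inE !ltn_ord !andbT; case: (g n).1; rewrite /= ?andbT ?andbF ?orbF.
apply/eqP; rewrite cards_eq0; apply/eqP/setP => n; rewrite !inE.
by case: (g n).1; rewrite /= ?andbF.
Qed.

Lemma rows_count_mono (g : 'I_r -> bool * 'I_r) k k' c i i' : (k <= k')%N -> (i <= i')%N ->
  (rows_count g k c i <= rows_count g k' c i')%N.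
Proof.
move=> kk ii; apply/subset_leq_card/subsetP => n; rewrite !inE => /and3P[n1 -> n3].
by rewrite (leq_trans n1 kk) (leq_trans n3 ii).
Qed.

(** Maximal but not greatest, since [tab_le] compares components separately. All tableaux have
    equally many entries below [k], so the inequalities for whole components are equalities. In
    [t^lambda] either the first [i] rows of a component hold only entries below [k], or they contain
    all its entries below [k]; so [v] cannot exceed it. *)
Lemma initial_std_max (v : stdtab l) : tab_le initial_std v -> v = initial_std.
Proof.
move=> le_v; apply: stdtab_row_inj; apply/fsym/tab_rank_eq => //.
apply: tab_rank_le => k c i; rewrite initial_std_perm.
have le_1 := le_v; rewrite /tab_le initial_std_perm in le_1.
have [ir|/ltnW ri] := leqP i r; last first.
  apply: (@leq_trans (rows_count (row_at l (tab_perm v)) k c r)).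
    by apply/subset_leq_card/subsetP => n; rewrite !inE ltn_ord => /and3P[-> -> _].
  apply: leq_trans (rows_count_mono _ _ (leqnn k) ri).
  have := rows_count_comp (row_at l (tab_perm v)) k.
  rewrite -(rows_count_comp (row_at l 1%g) k).
  by have := le_1 k true r; have := le_1 k false r; case: c; lia.
have [/forallP all_lt|] := boolP [forall n : 'I_r,
    ((pos_row l n).1 == c) && ((pos_row l n).2 < i)%N ==> (n < k)%N].
  apply: (@leq_trans (psum l c i)).
    have [kr|/ltnW rk] := leqP k r.
      by rewrite -(rows_count_psum l (tab_perm v)); apply: rows_count_mono.
    rewrite -(rows_count_psum l (tab_perm v)); apply/subset_leq_card/subsetP => n.
    by rewrite !inE ltn_ord => /and3P[_ -> ->].
  rewrite -(rows_count_psum l 1%g); apply/subset_leq_card/subsetP => n.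
  rewrite !inE /row_at invg1 perm1 => /and3P[_ n1 n2]; rewrite n1 n2.
  by have /implyP := all_lt n; rewrite n1 n2 => ->.
rewrite negb_forall => /existsP[n0]; rewrite negb_imply -leqNgt => /andP[/andP[/eqP c0 i0] k0].
apply: (@leq_trans (rows_count (row_at l (tab_perm v)) k c r)); first exact: rows_count_mono.
apply: (@leq_trans (rows_count (row_at l 1%g) k c r)).
  have := rows_count_comp (row_at l (tab_perm v)) k.
  rewrite -(rows_count_comp (row_at l 1%g) k).
  by have := le_1 k true r; have := le_1 k false r; case: c {c0}; lia.
apply/subset_leq_card/subsetP => n; rewrite !inE /row_at invg1 perm1 => /and3P[nk n1 _].
rewrite nk n1 /=; apply: leq_ltn_trans i0; apply: pos_row_mono.
  exact: leq_trans (ltnW nk) k0.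
by move: c0 => /= ->; apply/eqP.
Qed.

End InitialTableau.

(** * Basis property and multiplication rule *)

Section CellularBasis.
Variables (R : comPzRingType) (r : nat) (u1 u2 v1 v2 : R).
Hypothesis v12 : (v1 = u1 /\ v2 = u2) \/ (v1 = u2 /\ v2 = u1).
Variable e : bool -> bool.
Local Notation J := (marked_perm r).
Local Notation H := (hecke r u1 u2).
Local Notation hy := (@Defs.hy R r u1 u2).
Local Notation T := (@hperm R r u1 u2).
Local Notation hz := (@hz R r u1 u2).
Local Notation hpi0 := (@hpi0 R r u1 u2 v2).
Local Notation hpis := (@hpis R r u1 u2 v2).
Local Notation hcoord := (@hcoord R r u1 u2 v1 v2).
Local Notation hcell := (@hcell R r u1 u2 v2 e).
Local Notation hrows := (@hrows R r u1 u2 e).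
Local Notation dual := (@dual R r e).
Local Notation star := (@star R r u1 u2).

Definition cell (l : bipart r) (s t : stdtab l) : H := hcell l (tab_perm s) (tab_perm t).

Local Notation cellI x := (cell (tagged x).1 (tagged x).2).
Local Notation dualI x := (dual (tag x) (tab_perm (tagged x).1) (tab_perm (tagged x).2)).

Definition dual_coef (x : std_pair r) (j : J) : R := dualI x (mdelta R j).

Lemma dual_coefE x (f : {ffun J -> R^o}) : dualI x f = \sum_j f j * dual_coef x j.
Proof.
rewrite /dual_coef /dual; under [RHS]eq_bigr => j _ do rewrite mulr_sumr.
rewrite exchange_big /=; apply: eq_bigr => w _.
set A := _ @: _; rewrite (bigD1 (A, w)) //= ffunE eqxx mulr1 big1 => [|j /negPf nj].
  by rewrite addr0 mulrC.
by rewrite ffunE nj !mulr0.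
Qed.

(** Row group and column group of [t^lambda] meet only in the identity, so a single [w] contributes,
    with sign 1. *)
Lemma dual_cell_diag (x : std_pair r) : dualI x (hcoord (cellI x)) = 1.
Proof.
case: x => l [s t] /=; rewrite /dual /cell; set p := tab_perm s; set q := tab_perm t.
rewrite (bigD1 (p^-1 * q)%g) /=; last by rewrite mulKVg mulgV col_group1.
rewrite (hcoord_hcell v12) eqxx mulKVg mulgV row_group1 !sgn_char1 mulr1.
rewrite big1 ?addr0 // => w /andP[cw wn]; rewrite (hcoord_hcell v12).
case: ifP => [/andP[rw _]|_]; last by rewrite mulr0.
case/negP: wn; apply/eqP; have := row_col_trivial rw cw.
by move/(canRL (mulgKV _)); rewrite mul1g => /(canRL (mulKg _)).
Qed.

Lemma card_std_pair_marked : #|{: std_pair r}| = #|{: J}|.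
Proof.
by rewrite card_std_pair card_prod /= card_Sn -cardsT -powersetT card_powerset cardsT card_ord.
Qed.

Lemma dual_cell_le (x y : std_pair r) : dualI y (hcoord (cellI x)) != 0 -> pair_le x y.
Proof. by move/(dual_hcell_le v12) => h; split=> k c i; have [] := h k c i. Qed.

Lemma hcoord_sum_cell (a : std_pair r -> R) j :
  hcoord (\sum_(x : std_pair r) a x *: cellI x) j = \sum_x a x * hcoord (cellI x) j.
Proof.
rewrite (hcoord_sum v12) sum_ffunE; apply: eq_bigr => x _.
by rewrite (hcoordZ v12) ffunE.
Qed.

Lemma cell_expansion (h : H) : exists a : std_pair r -> R,
  h = \sum_(x : std_pair r) a x *: cellI x /\
  (forall x, a x != 0 -> exists2 y : std_pair r, dualI y (hcoord h) != 0 & pair_le y x).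
Proof.
have [|a [ha hle]] := dual_expansion (@pair_le_refl r) (@pair_le_trans r) (@pair_rank_lt r)
  (G := fun x y : std_pair r => dualI y (hcoord (cellI x)))
  dual_cell_le dual_cell_diag card_std_pair_marked
  (Phi := fun (x : std_pair r) j => hcoord (cellI x) j) (Psi := dual_coef) _ (hcoord h).
  by move=> x y; apply: dual_coefE.
exists a; split.
  by apply: (hcoord_inj v12); apply/ffunP => j; rewrite hcoord_sum_cell ha.
by move=> x /hle[y]; rewrite -dual_coefE => ? ?; exists y.
Qed.

Lemma cell_independent (a : std_pair r -> R) :
  \sum_(x : std_pair r) a x *: cellI x = 0 -> forall x, a x = 0.
Proof.
move=> a0; apply: (dual_independent (@pair_le_refl r) (@pair_le_trans r) (@pair_rank_lt r)
  (G := fun x y : std_pair r => dualI y (hcoord (cellI x))) dual_cell_le dual_cell_diag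
  (Phi := fun (x : std_pair r) j => hcoord (cellI x) j) (Psi := dual_coef)) => [x y|j].
  exact: dual_coefE.
have := hcoord_sum_cell a j; rewrite a0 => <-.
by rewrite /hcoord (hact0 v12) ffunE.
Qed.

Lemma cell_basis : is_basis (fun x : std_pair r => cellI x).
Proof.
move=> h; have [a [ha _]] := cell_expansion h.
exists [ffun x => a x]; split=> [|f hf].
  by rewrite ha; apply: eq_bigr => x _; rewrite ffunE.
apply/ffunP => x; rewrite ffunE; apply/eqP; rewrite -subr_eq0; apply/eqP.
apply: (@cell_independent (fun x => a x - f x)).
under eq_bigr => y _ do rewrite scalerBl.
by rewrite sumrB -ha -hf subrr.
Qed.

Definition upper (l : bipart r) (h : H) : Prop := in_upper_span cell l h.

Lemma tab_le_shape (l m : bipart r) (s : stdtab l) (t : stdtab m) : tab_le s t -> dominated l m.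
Proof.
by move=> st; apply: psum_dominated => c i _; have := st r c i; rewrite !rows_count_psum.
Qed.

Lemma sum_std_pair (F : std_pair r -> H) :
  \sum_x F x = \sum_(m : bipart r) \sum_(s : stdtab m) \sum_(t : stdtab m) F (Tagged _ (s, t)).
Proof.
under [RHS]eq_bigr => m _ do rewrite pair_bigA.
by rewrite sig_big_dep; apply: eq_bigr => -[m [s t]].
Qed.

(** A coefficient can be nonzero only above a functional that does not kill [h], and [tab_le] of
    left tableaux already implies dominance of shapes. *)
Lemma upper_dual l h : (forall y : std_pair r, dualI y (hcoord h) != 0 -> (l < tag y)%O) -> upper l h.
Proof.
move=> hl; have [a [ha hle]] := cell_expansion h.
exists (fun m s t => a (Tagged _ (s, t))).
rewrite ha sum_std_pair [RHS]big_mkcond; apply: eq_bigr => m _.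
case: ifP => // lm; rewrite big1 // => s _; rewrite big1 // => t _.
have [->|/hle[y /hl ly [le_y _]]] := eqVneq (a (Tagged _ (s, t))) 0; first by rewrite scale0r.
by rewrite (lt_le_trans ly (tab_le_shape le_y)) in lm.
Qed.

Lemma upperD l x y : upper l x -> upper l y -> upper l (x + y).
Proof.
move=> [f ->] [g ->]; exists (fun m s t => f m s t + g m s t).
rewrite -big_split; apply: eq_bigr => m _; rewrite -big_split; apply: eq_bigr => s _.
by rewrite -big_split; apply: eq_bigr => t _; rewrite scalerDl.
Qed.

Lemma upperZ l a x : upper l x -> upper l (a *: x).
Proof.
move=> [f ->]; exists (fun m s t => a * f m s t).
rewrite scaler_sumr; apply: eq_bigr => m _; rewrite scaler_sumr; apply: eq_bigr => s _.
by rewrite scaler_sumr; apply: eq_bigr => t _; rewrite scalerA.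
Qed.

Lemma upper0 l : upper l 0.
Proof.
exists (fun m s t => 0).
by rewrite big1 // => m _; rewrite big1 // => s _; rewrite big1 // => t _; rewrite scale0r.
Qed.

Lemma upper_sum l I (s : seq I) (P : pred I) (F : I -> H) :
  (forall i, P i -> upper l (F i)) -> upper l (\sum_(i <- s | P i) F i).
Proof. by move=> PF; apply: big_ind => //; [apply: upper0 | apply: upperD]. Qed.

Lemma upper_hcell l m p q : (l < m)%O -> upper l (hcell m p q).
Proof.
move=> lm; apply: upper_dual => y /(dual_hcell_shape v12) my.
exact: lt_le_trans lm my.
Qed.

Lemma upper_mono l m h : (l <= m)%O -> upper m h -> upper l h.
Proof.
move=> lm [f ->]; apply: upper_sum => m' mm'; apply: upper_sum => s _; apply: upper_sum => t _.
by apply: upperZ; apply: upper_hcell; apply: le_lt_trans lm mm'.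
Qed.

Lemma hcell_mulT l p q w : hcell l p q * T w = hcell l p (q * w)%g.
Proof. by rewrite /hcell -mulrA -hpermM. Qed.

Lemma mulT_hcell l p q w : T w * hcell l p q = hcell l (p * w^-1)%g q.
Proof. by rewrite /hcell !mulrA -hpermM invMg invgK. Qed.

Lemma upper_mulT l h w : upper l h -> upper l (h * T w).
Proof.
move=> [f ->]; rewrite mulr_suml; apply: upper_sum => m lm; rewrite mulr_suml.
apply: upper_sum => s _; rewrite mulr_suml; apply: upper_sum => t _.
by rewrite -hecke_scaleAl; apply: upperZ; rewrite hcell_mulT; apply: upper_hcell.
Qed.

Lemma upper_Tmul l h w : upper l h -> upper l (T w * h).
Proof.
move=> [f ->]; rewrite mulr_sumr; apply: upper_sum => m lm; rewrite mulr_sumr.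
apply: upper_sum => s _; rewrite mulr_sumr; apply: upper_sum => t _.
by rewrite -hecke_scaleAr; apply: upperZ; rewrite mulT_hcell; apply: upper_hcell.
Qed.

(** Only pairs whose left tableau lies above [t^lambda] occur. Within the shape [l], maximality
    leaves [t^lambda] itself; all other shapes are strictly larger. *)
Lemma hcell_row_expansion l q : exists f : stdtab l -> R,
  upper l (hcell l 1%g q - \sum_v f v *: hcell l 1%g (tab_perm v)).
Proof.
have [a [ha hle]] := cell_expansion (hcell l 1%g q).
exists (fun v => a (Tagged _ (initial_std l, v))).
rewrite {1}ha sum_std_pair (bigD1 l) //= (bigD1 (initial_std l)) //=.
rewrite /cell initial_std_perm -[X in X - _]addrA [X in X - _]addrC addrK.
have small m (s t : stdtab m) : a (Tagged _ (s, t)) != 0 -> tab_le (initial_std l) s.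
  move=> /hle[y /(dual_hcell_le v12) h [le_s _]] k c i; rewrite initial_std_perm.
  by have [h1 _] := h k c i; apply: leq_trans h1 (le_s k c i).
apply: upperD.
  apply: upper_sum => s ns; apply: upper_sum => t _.
  have [->|/small/initial_std_max es] := eqVneq (a (Tagged _ (s, t))) 0.
    by rewrite scale0r; apply: upper0.
  by rewrite es eqxx in ns.
apply: upper_sum => m nm; apply: upper_sum => s _; apply: upper_sum => t _.
have [->|/small/tab_le_shape lm] := eqVneq (a (Tagged _ (s, t))) 0.
  by rewrite scale0r; apply: upper0.
by apply: upperZ; apply: upper_hcell; rewrite lt_neqAle eq_sym nm.
Qed.

(** All permutations are allowed, not only those of standard tableaux, so multiplication by [T w]
    needs no straightening; the return to standard tableaux is left to [cell_mul]. *)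
Definition row_module l (h : H) : Prop :=
  exists f : 'S_r -> R, upper l (h - \sum_w f w *: hcell l 1%g w).

Lemma row_moduleD l x y : row_module l x -> row_module l y -> row_module l (x + y).
Proof.
move=> [f hf] [g hg]; exists (fun w => f w + g w).
under eq_bigr => w _ do rewrite scalerDl.
by rewrite big_split /= opprD addrACA; apply: upperD.
Qed.

Lemma row_moduleZ l a x : row_module l x -> row_module l (a *: x).
Proof.
move=> [f hf]; exists (fun w => a * f w).
under eq_bigr => w _ do rewrite -scalerA.
by rewrite -scaler_sumr -scalerBr; apply: upperZ.
Qed.

Lemma row_module_upper l x : upper l x -> row_module l x.
Proof.
move=> hx; exists (fun=> 0); rewrite big1 ?subr0 // => w _.
by rewrite scale0r.
Qed.

Lemma row_module0 l : row_module l 0.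
Proof. exact/row_module_upper/upper0. Qed.

Lemma row_moduleB l x y : row_module l x -> row_module l y -> row_module l (x - y).
Proof. by move=> hx hy; apply: row_moduleD => //; rewrite -scaleN1r; apply: row_moduleZ. Qed.

Lemma row_module_sum l I (s : seq I) (P : pred I) (F : I -> H) :
  (forall i, P i -> row_module l (F i)) -> row_module l (\sum_(i <- s | P i) F i).
Proof. by move=> PF; apply: big_ind => //; [apply: row_module0 | apply: row_moduleD]. Qed.

Lemma row_module_hcell l q : row_module l (hcell l 1%g q).
Proof.
exists (fun w => (w == q)%:R); rewrite (bigD1 q) //= eqxx scale1r big1 ?addr0 ?subrr.
  exact: upper0.
by move=> w /negPf ->; rewrite scale0r.
Qed.

Definition preserves_rows (a : H) : Prop := forall l q, row_module l (hcell l 1%g q * a).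

(** Each cell element is a left translate of one whose left index is [t^mu]. The hypothesis treats
    the latter, and the upper part is stable under left translation. *)
Lemma upper_mul a l h : preserves_rows a -> upper l h -> upper l (h * a).
Proof.
move=> ga [f ->]; rewrite mulr_suml; apply: upper_sum => m lm; rewrite mulr_suml.
apply: upper_sum => s _; rewrite mulr_suml; apply: upper_sum => t _.
rewrite -hecke_scaleAl; apply: upperZ.
have -> : cell s t = T (tab_perm s)^-1%g * hcell m 1%g (tab_perm t).
  by rewrite mulT_hcell invgK mul1g.
rewrite -mulrA; have [g hg] := ga m (tab_perm t).
rewrite -[_ * a](subrK (\sum_w g w *: hcell m 1%g w)) mulrDr; apply: upperD.
  by apply: upper_Tmul; apply: upper_mono hg; apply: ltW.
rewrite mulr_sumr; apply: upper_sum => w _; rewrite -hecke_scaleAr; apply: upperZ.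
by rewrite mulT_hcell; apply: upper_hcell.
Qed.

Lemma row_module_mul a l h : preserves_rows a -> row_module l h -> row_module l (h * a).
Proof.
move=> ga [f hf]; rewrite -[h](subrK (\sum_w f w *: hcell l 1%g w)) mulrDl; apply: row_moduleD.
  by apply: row_module_upper; apply: upper_mul.
rewrite mulr_suml; apply: row_module_sum => w _; rewrite -hecke_scaleAl.
by apply: row_moduleZ; apply: ga.
Qed.

(** The rule for left multiplication is carried over by [star], which fixes [hz k] and [hpis A]. *)
Lemma hpis_hz_in (A : {set 'I_r}) k : k \in A -> hpis A * hz k = v1 *: hpis A.
Proof.
move=> kA; apply: (can_inj (starK (u1 := u1) (u2 := u2))).
by rewrite starM star_hz starZ star_hpis (hz_hpis_in v12).
Qed.

Lemma hpis_hz_notin (A : {set 'I_r}) k : k \notin A ->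
  hpis A * hz k = v2 *: hpis A + hpis (k |: A) - \sum_(l in A) hpis A * T (tperm l k).
Proof.
move=> kA; apply: (can_inj (starK (u1 := u1) (u2 := u2))).
rewrite starM star_hz star_hpis hz_hpis_notin // starB starD starZ !star_hpis star_sum.
congr (_ - _); apply: eq_bigr => l _.
by rewrite starM star_hpis star_hperm tpermV.
Qed.

Lemma hperm_hz_swap q j : T q * hz j = hz (q^-1%g j) * T q.
Proof. by have := hperm_hz u1 u2 q (q^-1%g j); rewrite permKV. Qed.

Lemma hrows_hpi0 l : GRing.comm (hrows l) (hpi0 (comp_size l false)).
Proof.
apply: commr_sym; apply: commr_sum => w rw; rewrite /GRing.comm -hecke_scaleAl -hecke_scaleAr.
congr (_ *: _); apply: commr_sym; apply: hperm_hpi0 => [|i]; first exact: comp_size_le.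
by have := row_group_comp i rw; rewrite !pos_comp => /negb_inj.
Qed.

Lemma hcell_hrows l q : hcell l 1%g q = hrows l * hpis (initial_set r (comp_size l false)) * T q.
Proof.
by rewrite /hcell invg1 hperm1 mul1r hpis_initial ?comp_size_le // hrows_hpi0.
Qed.

Lemma preserves_hperm w : preserves_rows (T w).
Proof. by move=> l q; rewrite hcell_mulT; apply: row_module_hcell. Qed.

(** Moving [hz j] past [T q] turns it into [hz m], where [m] is the position of [j]. In the first
    component it acts as a scalar. Outside, the [v2] term and the transpositions stay in the row
    span, while the enlarged set gives [hcell_up], seen only by functionals of larger shape. *)
Lemma preserves_hz j : preserves_rows (hz j).
Proof.
move=> l q; rewrite hcell_hrows -mulrA hperm_hz_swap.
set m := q^-1%g j; set A := initial_set r _; rewrite mulrA -[X in X * T q]mulrA.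
have [mA|mA] := boolP (m \in A).
  rewrite hpis_hz_in // -hecke_scaleAr -hecke_scaleAl -hcell_hrows.
  by apply: row_moduleZ; apply: row_module_hcell.
rewrite hpis_hz_notin // mulrBr mulrDr -hecke_scaleAr mulrBl mulrDl -hecke_scaleAl -hcell_hrows.
apply: row_moduleB; first apply: row_moduleD.
- by apply: row_moduleZ; apply: row_module_hcell.
- apply: row_module_upper; apply: upper_mulT; apply: upper_dual => y.
  apply: (dual_hcell_up_lt v12).
  by move: mA; rewrite mem_initial_set -leqNgt.
rewrite mulr_sumr mulr_suml; apply: row_module_sum => k _.
rewrite [hrows l * _]mulrA -[_ * T q]mulrA -hpermM -hcell_hrows; exact: row_module_hcell.
Qed.

Lemma preserves_all a : preserves_rows a.
Proof.
elim/hecke_ind: a => [a|i|j|x y gx gy|x y gx gy] l q.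
- by rewrite -hecke_scaleAr mulr1; apply: row_moduleZ; apply: row_module_hcell.
- by rewrite -hperm_simple; apply: preserves_hperm.
- rewrite -[hy j](subrK (\sum_(k < r | (k < j)%N) T (tperm k j))) mulrDr.
  apply: row_moduleD; first exact: (preserves_hz j).
  by rewrite mulr_sumr; apply: row_module_sum => k _; apply: preserves_hperm.
- by rewrite mulrDr; apply: row_moduleD; [apply: gx | apply: gy].
- by rewrite mulrA; apply: row_module_mul => //; apply: gx.
Qed.

(** The expansion is made once, for the left index [t^lambda], and then multiplied on the left by
    the permutation of [s]; hence the coefficients do not depend on [s]. *)
Lemma cell_mul (l : bipart r) (t : stdtab l) (a : H) : exists f : stdtab l -> R,
  forall s : stdtab l, upper l (cell s t * a - \sum_v f v *: cell s v).
Proof.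
have [g hg] := preserves_all a l (tab_perm t).
have [F hF] := fin_all_exists (hcell_row_expansion l).
exists (fun v => \sum_w g w * F w v) => s.
have cellE v : cell s v = T (tab_perm s)^-1%g * hcell l 1%g (tab_perm v).
  by rewrite mulT_hcell invgK mul1g.
under eq_bigr => v _ do rewrite cellE hecke_scaleAr.
rewrite cellE -mulr_sumr -mulrA -mulrBr; apply: upper_Tmul.
rewrite -[_ - _](subrKA (\sum_w g w *: hcell l 1%g w)); apply: upperD => //.
under [X in _ - X]eq_bigr => v _ do rewrite scaler_suml.
rewrite exchange_big /= -sumrB; apply: upper_sum => w _.
under eq_bigr => v _ do rewrite -scalerA.
by rewrite -scaler_sumr -scalerBr; apply: upperZ.
Qed.

Lemma sgn_onV b (S : {set 'I_r}) w : w \in 'N(S | 'P)%g -> sgn_on R b S w^-1 = sgn_on R b S w.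
Proof. by move=> wS; rewrite /sgn_on; case: b => //; rewrite morphV // odd_permV. Qed.

Lemma star_hrows l : star (hrows l) = hrows l.
Proof.
rewrite /hrows star_sum (reindex_inj invg_inj) /=; apply: eq_big => [w|w rw].
  by apply/idP/idP => /row_groupV; rewrite ?invgK.
have hb := row_group_block (row_groupV rw); rewrite invgK in hb.
by rewrite starZ star_hperm invgK /sgn_char !sgn_onV // block_preserving_stab.
Qed.

Lemma star_cell (l : bipart r) (s t : stdtab l) : star (cell s t) = cell t s.
Proof.
rewrite /cell /hcell !starM !star_hperm star_hrows star_hpi0 ?comp_size_le // invgK.
by rewrite -!mulrA [hrows l * _]mulrA hrows_hpi0 !mulrA.
Qed.

Lemma cell_cellular : cellular_basis cell star.
Proof. by split; [exact: cell_basis | exact: star_cell | exact: cell_mul]. Qed.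

Lemma cellular_ext (c : forall l : bipart r, stdtab l -> stdtab l -> H) :
  (forall l s t, c l s t = cell s t) -> cellular_basis c star.
Proof.
move=> ec; suff -> : c = cell by exact: cell_cellular.
by apply: boolp.functional_extensionality_dep => l; apply/boolp.funext => s; apply/boolp.funext => t.
Qed.

End CellularBasis.

Theorem lemma3p3 (R : comPzRingType) (r : nat) (u1 u2 : R) :
  (0 < r)%N ->
  exists star : hecke r u1 u2 -> hecke r u1 u2,
    [/\ anti_involution star,
        (forall i : 'I_r.-1, star (hs u1 u2 i) = hs u1 u2 i),
        (forall j : 'I_r, star (hy u1 u2 j) = hy u1 u2 j)
      & [/\ cellular_basis (T := @stdtab r) (@xst R r u1 u2) star,
            cellular_basis (T := @stdtab r) (@yst R r u1 u2) star,
            cellular_basis (T := @stdtab r) (@xbarst R r u1 u2) star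
          & cellular_basis (T := @stdtab r) (@ybarst R r u1 u2) star]].
Proof.
move=> _; exists (@star R r u1 u2); split.
- exact: star_anti_involution.
- exact: star_hs.
- exact: star_hy.
(* The second member of each pair is the parameter in [hpi]; below, [id] puts the signs on the
   second component and [negb] on the first. *)
have h12 : (u1 = u1 /\ u2 = u2) \/ (u1 = u2 /\ u2 = u1) by left.
have h21 : (u2 = u1 /\ u1 = u2) \/ (u2 = u2 /\ u1 = u1) by right.
split.
- apply: (cellular_ext h12 (e := id)) => l s t.
  by rewrite /xst /cell /hcell -hrow_mul !hrow_hx hrow_hxsgn !mulrA.
- apply: (cellular_ext h21 (e := id)) => l s t.
  by rewrite /yst /cell /hcell -hrow_mul !hrow_hx hrow_hxsgn !mulrA.
- apply: (cellular_ext h12 (e := negb)) => l s t.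
  by rewrite /xbarst /cell /hcell -hrow_mul !hrow_hx hrow_hxsgn !mulrA.
- apply: (cellular_ext h21 (e := negb)) => l s t.
  by rewrite /ybarst /cell /hcell -hrow_mul !hrow_hx hrow_hxsgn !mulrA.
Qed.
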